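(* Let $s>0$. Let $X_s(z,\cdot)$ be the evaluator at $z$ in the Hilbert space $mPW_s$, and let $R_s(x,y)$ be the resolvent kernel on $L^2(-1,1;dx)$ of the Dirichlet kernel $D_s(x,y)=\frac{\sin(s(x-y))}{\pi(x-y)}$, i.e. $1+R_s=(1-D_s)^{-1}$. The resolvent kernel $R_s(x,y)$ is entire in $(x,y)$ and $$\forall z,w\in\mathbb C\qquad R_s(z,w)=X_s(\overline z,w).$$
   Context: $mPW_s$ is the Hilbert space of entire functions $f$ of exponential type at most $s$ with $\|f\|^2=\int_{\mathbb R\setminus(-1,1)}|f(t)|^2\,dt<\infty$ (as a set it is the Paley–Wiener space of entire functions of exponential type at most $s$ that are square integrable on $\mathbb R$), with scalar product $(f,g)=\int_{\mathbb R\setminus(-1,1)}f(t)\overline{g(t)}\,dt$. For $z\in\mathbb C$, $X_s(z,\cdot)\in mPW_s$ is the unique element with $(f,X_s(z,\cdot))=f(z)$ for all $f\in mPW_s$. $D_s$ also denotes the integral operator on $L^2(-1,1;dx)$ with kernel $D_s(x,y)$, and $R_s$ the integral operator with kernel $R_s(x,y)$. *)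

(* Defs.v *)
From HB Require Import structures.
From mathcomp Require Import all_boot all_order all_algebra.
From mathcomp Require Import all_classical all_reals all_analysis.
From mathcomp Require Import complex.

Set Implicit Arguments.
Unset Strict Implicit.
Unset Printing Implicit Defensive.

Import Order.TTheory GRing.Theory Num.Theory.
Import numFieldNormedType.Exports.

Local Open Scope classical_set_scope.
Local Open Scope ring_scope.
Local Open Scope complex_scope.

Local Notation normc := ComplexField.Normc.normc.

Definition itv11 {R : realType} : set R := `]-1, 1[.

(* The analysis library has no integral of complex-valued functions: everything
   below goes through the real and imaginary parts. *)

Definition Cmeasurable (d : measure_display) (T : measurableType d)
    (R : realType) (D : set T) (f : T -> R[i]) : Prop :=
  measurable_fun D (fun x => complex.Re (f x)) /\
  measurable_fun D (fun x => complex.Im (f x)).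

Definition Cintegrable (R : realType) (D : set R) (f : R -> R[i]) : Prop :=
  lebesgue_measure.-integrable D (fun x => (complex.Re (f x))%:E) /\
  lebesgue_measure.-integrable D (fun x => (complex.Im (f x))%:E).

Definition Cintegral (R : realType) (D : set R) (f : R -> R[i]) : R[i] :=
  (\int[lebesgue_measure]_(x in D) complex.Re (f x)) +i*
  (\int[lebesgue_measure]_(x in D) complex.Im (f x)).

(* Square-integrable functions, not quotiented by equality almost everywhere *)
Definition L2 (R : realType) (D : set R) (f : R -> R[i]) : Prop :=
  Cmeasurable D f /\
  (\int[lebesgue_measure]_(x in D) (normc (f x) ^+ 2)%:E < +oo)%E.

(* The scalar field R[i] is seen as a normed module over itself through _^o, so
   that derivable and differentiable are meant over the complex numbers. *)
Definition entire (R : realType) (f : R[i] -> R[i]) : Prop :=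
  forall z : (R[i])^o, derivable (f : (R[i])^o -> (R[i])^o) z 1.

Definition entire2 (R : realType) (F : R[i] -> R[i] -> R[i]) : Prop :=
  forall p : (R[i])^o * (R[i])^o,
    differentiable (fun q : (R[i])^o * (R[i])^o => F q.1 q.2 : (R[i])^o) p.

Definition exp_type_le (R : realType) (s : R) (f : R[i] -> R[i]) : Prop :=
  forall e : R, 0 < e ->
    exists A : R, forall z, normc (f z) <= A * expR ((s + e) * normc z).

Definition mPW (R : realType) (s : R) : set (R[i] -> R[i]) :=
  [set f | [/\ entire f, exp_type_le s f &
    L2 (~` itv11) (fun t : R => f t%:C)]].

Definition mPW_dot (R : realType) (f g : R[i] -> R[i]) : R[i] :=
  Cintegral (~` itv11) (fun t : R => f t%:C * (g t%:C)^*).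

Definition is_evaluator (R : realType) (s : R) (z : R[i]) (X : R[i] -> R[i]) :
    Prop :=
  mPW s X /\ forall f, mPW s f -> mPW_dot f X = f z.

(* The element of mPW s representing evaluation at z. It is unique; the default
   value of xget is only there to make the definition total. *)
Definition evaluator (R : realType) (s : R) (z : R[i]) : R[i] -> R[i] :=
  xget (fun=> 0) [set X | is_evaluator s z X].

Definition dirichlet_kernel (R : realType) (s : R) (x y : R) : R :=
  if x == y then s / pi else sin (s * (x - y)) / (pi * (x - y)).

Definition integral_op (R : realType) (K : R -> R -> R[i]) (f : R -> R[i]) :
    R -> R[i] :=
  fun x => Cintegral itv11 (fun y => K x y * f y).

(* K is measurable and integral_op K is an everywhere defined operator on
   L^2(-1,1): the integrals converge absolutely for almost every x. *)
Definition L2_kernel (R : realType) (K : R -> R -> R[i]) : Prop :=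
  Cmeasurable (itv11 `*` itv11 : set (R * R)) (fun p => K p.1 p.2) /\
  forall f, L2 itv11 f ->
    (\forall x \ae lebesgue_measure, itv11 x ->
       Cintegrable itv11 (fun y => K x y * f y)) /\
    L2 itv11 (integral_op K f).

(* (1 + K)(1 - D_s) = 1 = (1 - D_s)(1 + K) on L^2(-1,1) *)
Definition is_resolvent_kernel (R : realType) (s : R) (K : R -> R -> R[i]) :
    Prop :=
  let D := integral_op (fun x y => (dirichlet_kernel s x y)%:C) in
  let oneD (f : R -> R[i]) := f \- D f in
  let oneK (f : R -> R[i]) := f \+ integral_op K f in
  L2_kernel K /\
  forall f, L2 itv11 f ->
    oneK (oneD f) = f %[ae lebesgue_measure in itv11] /\
    oneD (oneK f) = f %[ae lebesgue_measure in itv11].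

(* Main.v *)
From HB Require Import structures.
Require Import Defs.
From mathcomp Require Import all_boot all_order all_algebra.
From mathcomp Require Import all_classical all_reals all_analysis.
From mathcomp Require Import complex.
From mathcomp Require Import measurable_realfun ring lra.
Import Order.TTheory GRing.Theory Num.Theory.
Import numFieldNormedType.Exports.
Local Open Scope classical_set_scope.
Local Open Scope ring_scope.
Local Open Scope complex_scope.
Set Implicit Arguments.
Unset Strict Implicit.
Unset Printing Implicit Defensive.

Local Notation normc := ComplexField.Normc.normc.
Local Notation Re := complex.Re.
Local Notation Im := complex.Im.

(** Let D be the operator on L^2(-1,1) with the Dirichlet kernel, and write sinc for its
    entire extension, so that D(x, y) = sinc (x - y).

    An entire function f of exponential type at most s that is square integrable on the
    line satisfies f(z) = int f(t) sinc(z - t) dt over the whole line (reproducing). To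
    see this, subtract from f(k) e^(is'(k - z)), with s' > s, a rational term with the
    same value at z, divide by k - z, and integrate along the boundary of the upper
    half-plane: the integral is zero, because a half-line of integration can be rotated
    through a quadrant (quadrant_axes). The same for the lower half-plane, and then s'
    decreases to s.

    Functions D u are of this kind. Hence D u, on the line, is the projection of u onto
    the band-limited functions, and its energies inside and outside (-1,1) satisfy
    A + 2 B <= |u|^2 (Dop_interior_exterior). A band-limited function is also nearly a
    linear combination of its translates by distances at least 2 (sinc_shifts), so that
    A is bounded by B up to a small error. Therefore D is a strict contraction
    (contraction), and its Neumann series converges uniformly to a bounded symmetric
    kernel R with R = D + D R = D + R D (rsv_eql, rsv_eqr). These equations contain the
    resolvent identities (rsv_is_resolvent). They also continue R to an entire function
    rsvC of two complex variables, because the arguments of R may be moved onto the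
    factors sinc (rsvC_entire2).

    For the evaluators, let f be in mPW_s. The reproducing formula at a point x of (-1,1)
    says that the integral of f(t) sinc(x - t) outside (-1,1) equals (1 - D) f at x.
    Multiplying the equation rsvC(z, t) = sinc(z - t) + int rsvC(z, x) sinc(x - t) dx by
    f(t) and integrating over the complement of (-1,1) gives f(z) (rsvC_reproduces). As
    rsvC(z, t) is the conjugate of rsvC(z^*, t) for real t, the function rsvC(z^*, .) is
    the evaluator at z, and an evaluator is unique (evaluatorE).

    If K is another resolvent kernel, K and R define the same operator. Testing with
    indicators of half-lines with rational endpoints identifies almost every row of K
    (resolvent_kernel_unique). *)

(** * Modulus, holomorphy and continuity over R[i] *)

Section ComplexNorm.
Variable R : realType.
Implicit Types (x y : R) (z w : R[i]).

Lemma normrC z : `|z| = (normc z)%:C.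
Proof. by []. Qed.

Lemma normc_ge0 z : 0 <= normc z.
Proof. by case: z => a b; exact: sqrtr_ge0. Qed.

Lemma normc_sqr z : normc z ^+ 2 = Re z ^+ 2 + Im z ^+ 2.
Proof. by case: z => a b; rewrite /= sqr_sqrtr ?addr_ge0 ?sqr_ge0. Qed.

Lemma normcD z w : normc (z + w) <= normc z + normc w.
Proof. exact: le_normcD. Qed.

Lemma normcN z : normc (- z) = normc z.
Proof. by case: z => a b; rewrite /= !sqrrN. Qed.

Lemma normcB z w : normc (z - w) = normc (w - z).
Proof. by rewrite -normcN opprB. Qed.

Lemma normcM z w : normc (z * w) = normc z * normc w.
Proof. exact: ComplexField.Normc.normcM. Qed.

Lemma normcV z : normc z^-1 = (normc z)^-1.
Proof. exact: ComplexField.Normc.normcV. Qed.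

Lemma normc_R x : normc x%:C = `|x|.
Proof. by rewrite /= expr0n /= addr0 sqrtr_sqr. Qed.

Lemma normc_0 : normc (0 : R[i]) = 0.
Proof. exact: ComplexField.Normc.normc0. Qed.

Lemma normc_1 : normc (1 : R[i]) = 1.
Proof. exact: ComplexField.Normc.normc1. Qed.

Lemma normc_i : normc ('i : R[i]) = 1.
Proof. by rewrite /= expr0n /= add0r expr1n sqrtr1. Qed.

Lemma normc_eq0 z : (normc z == 0) = (z == 0).
Proof.
apply/eqP/eqP => [/ComplexField.Normc.eq0_normc //|->]; exact: normc_0.
Qed.

Lemma normc_gt0 z : (0 < normc z) = (z != 0).
Proof. by rewrite lt_def normc_ge0 normc_eq0 andbT. Qed.

Lemma normcJ z : normc z^* = normc z.
Proof. by case: z => a b; rewrite /= sqrrN. Qed.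

Lemma Re_le z : `|Re z| <= normc z.
Proof. 
rewrite -sqrtr_sqr; case: z => a b /=; rewrite ler_wsqrtr // lerDl; exact: sqr_ge0.
Qed.

Lemma Im_le z : `|Im z| <= normc z.
Proof. 
rewrite -sqrtr_sqr; case: z => a b /=; rewrite ler_wsqrtr // lerDr; exact: sqr_ge0.
Qed.

Lemma normc_leD z : normc z <= `|Re z| + `|Im z|.
Proof.
rewrite -(@ler_pXn2r _ 2) ?nnegrE ?normc_ge0 ?addr_ge0 // normc_sqr.
rewrite sqrrD !real_normK ?num_real //; rewrite -addrA lerD2l lerDr.
by rewrite mulrn_wge0 // mulr_ge0.
Qed.

Lemma ReD z w : Re (z + w) = Re z + Re w.
Proof. by case: z; case: w. Qed.
Lemma ImD z w : Im (z + w) = Im z + Im w.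
Proof. by case: z; case: w. Qed.
Lemma ReN z : Re (- z) = - Re z.
Proof. by case: z. Qed.
Lemma ImN z : Im (- z) = - Im z.
Proof. by case: z. Qed.
Lemma ReM z w : Re (z * w) = Re z * Re w - Im z * Im w.
Proof. by case: z; case: w. Qed.
Lemma ImM z w : Im (z * w) = Re z * Im w + Im z * Re w.
Proof. by case: z; case: w. Qed.

Lemma eqC z w : Re z = Re w -> Im z = Im w -> z = w.
Proof. by case: z => a b; case: w => c d /= -> ->. Qed.

Lemma Ccont_normc (g : R[i] -> R[i]) (z : R[i]) :
  {for z, continuous (g : (R[i])^o -> (R[i])^o)} <->
  forall e : R, 0 < e -> exists2 d : R, 0 < d &
    forall w, normc (w - z) < d -> normc (g w - g z) < e.
Proof.
split=> [/cvgrPdist_lt gz e e0|gz].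
  have /gz /nbhs_normP[d /= d0 dP] : 0 < e%:C by rewrite ltcR.
  have d0' : 0 < Re d by move: d0; rewrite ltcE => /andP[].
  have dE : d = (Re d)%:C.
    by move: d0; rewrite ltcE => /andP[/eqP /= d0 _]; apply: eqC.
  exists (Re d) => // w wz.
  have : `|g z - g w| < e%:C.
    by apply: dP => /=; rewrite /ball_ /= dE ltcR normcB.
  by rewrite ltcR normcB.
apply: (iffRL (@cvgrPdist_lt R[i] (R[i])^o (R[i])^o (nbhs (z : (R[i])^o)) (@nbhs_filter (R[i])^o z) g (g z))) => e e0.
have e0' : 0 < Re e by move: e0; rewrite ltcE => /andP[].
have eE : e = (Re e)%:C.
  by move: e0; rewrite ltcE => /andP[/eqP /= e0 _]; apply: eqC.
have [d d0 dP] := gz _ e0'.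
apply: (iffRL (@nbhs_normP R[i] (R[i])^o z _)); exists d%:C.
  by rewrite /= ltcR.
move=> w /=; rewrite /ball_ /= ltcR normcB => wz.
by rewrite eE ltcR normcB; exact: dP.
Qed.

Definition holo (g : R[i] -> R[i]) z := derivable (g : (R[i])^o -> (R[i])^o) z 1.
Definition Ccont (g : R[i] -> R[i]) z := {for z, continuous (g : (R[i])^o -> (R[i])^o)}.

Lemma holo_cont g z : holo g z -> Ccont g z.
Proof. by move=> /derivable1_diffP; exact: differentiable_continuous. Qed.

Lemma holo_cst c z : holo (fun=> c) z.
Proof. exact: derivable_cst. Qed.

Lemma holo_id z : holo id z.
Proof. exact: derivable_id. Qed.

Lemma holoD f g z : holo f z -> holo g z -> holo (fun w => f w + g w) z.
Proof. exact: derivableD. Qed.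

Lemma holoB f g z : holo f z -> holo g z -> holo (fun w => f w - g w) z.
Proof. exact: derivableB. Qed.

Lemma holoM f g z : holo f z -> holo g z -> holo (fun w => f w * g w) z.
Proof. exact: derivableM. Qed.

Lemma holoV f z : f z != 0 -> holo f z -> holo (fun w => (f w)^-1) z.
Proof. by move=> f0 hf; exact: derivableV. Qed.

Lemma holo_comp (f g : R[i] -> R[i]) z : holo g z -> holo f (g z) ->
  holo (fun w => f (g w)) z.
Proof.
move=> /derivable1_diffP hg /derivable1_diffP hf; apply/derivable1_diffP.
exact: (@differentiable_comp R[i] (R[i])^o (R[i])^o (R[i])^o g f z hg hf).
Qed.

Lemma contB f g z : Ccont f z -> Ccont g z -> Ccont (fun w => f w - g w) z.
Proof. by move=> cf cg; exact: (@continuousB R[i] (R[i])^o (R[i])^o f g z cf cg). Qed.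
Lemma contM f g z : Ccont f z -> Ccont g z -> Ccont (fun w => f w * g w) z.
Proof. by move=> cf cg; exact: (@continuousM R[i] (R[i])^o f g z cf cg). Qed.
Lemma cont_comp (f g : R[i] -> R[i]) z : Ccont g z -> Ccont f (g z) ->
  Ccont (fun w => f (g w)) z.
Proof. by move=> cg cf; exact: (@continuous_comp (R[i])^o (R[i])^o (R[i])^o g f z cg cf). Qed.

(** The first-order expansion with real error bounds, as used at the limit point of
    Goursat's bisection. *)
Lemma holo_eps (g : R[i] -> R[i]) z : holo g z -> exists l, forall e : R, 0 < e -> exists2 d : R, 0 < d &
    forall h, normc h < d -> normc (g (z + h) - g z - l * h) <= e * normc h.
Proof.
move=> hg.
exists ('D_1 (g : (R[i])^o -> (R[i])^o) z) => e e0.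
move: hg => /cvgrPdist_lt hg; have /hg : 0 < e%:C by rewrite ltcR.
rewrite near_withinE => /nbhs_normP[d /= d0 dP].
have d0' : 0 < Re d by move: d0; rewrite ltcE => /andP[].
have dE : d = (Re d)%:C.
  by move: d0; rewrite ltcE => /andP[/eqP /= d0 _]; apply: eqC.
exists (Re d) => // h hd.
have [->|h0] := eqVneq h 0.
  by rewrite addr0 subrr mulr0 subr0 normc_0 mulr0.
have := dP h; rewrite /ball_ /= sub0r normrN dE ltcR => /(_ hd h0).
rewrite ltcR => /ltW P.
have -> : g (z + h) - g z - 'D_1 (g : (R[i])^o -> (R[i])^o) z * h = 
  - (('D_1 (g : (R[i])^o -> (R[i])^o) z - h^-1 * (g (h * 1 + z) - g z)) * h).
  by rewrite mulr1 [h + z]addrC; field.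
by rewrite normcN normcM ler_wpM2r ?normc_ge0.
Qed.

(** A quadratic remainder in the first-order expansion is what the estimates below
    provide for every concrete kernel. *)
Lemma holo_quad (g : R[i] -> R[i]) z (l : R[i]) (c d : R) : 0 < d ->
  (forall h, normc h < d -> normc (g (z + h) - g z - l * h) <= c * normc h ^+ 2) ->
  holo g z.
Proof.
move=> d0 H; rewrite /holo /derivable; apply/cvg_ex; exists l.
apply/cvgrPdist_lt => e e0.
have e0' : 0 < Re e by move: e0; rewrite ltcE => /andP[].
have eE : e = (Re e)%:C.
  by move: e0; rewrite ltcE => /andP[/eqP /= e0 _]; apply: eqC.
rewrite near_withinE; apply: (iffRL (@nbhs_normP R[i] (R[i])^o 0 _)).
have cp : 0 < `|c| + 1 by rewrite ltr_wpDl.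
exists (Num.min d (Re e / (`|c| + 1)))%:C.
  by rewrite /= ltcR lt_min d0 divr_gt0.
move=> h /=; rewrite /ball_ /= sub0r normrN ltcR lt_min => /andP[hd he] h0.
have nh0 : 0 < normc h by rewrite normc_gt0.
rewrite eE ltcR.
have -> : l - h^-1 *: (g (h *: 1 + z) - g z) = - ((g (z + h) - g z - l * h) * h^-1).
  by rewrite /GRing.scale /= mulr1 [h + z]addrC; field.
rewrite normcN normcM normcV ltr_pdivrMr //.
apply: le_lt_trans (H _ hd) _; rewrite expr2 mulrA ltr_pM2r //.
apply: le_lt_trans (_ : (`|c| + 1) * normc h < _); last first.
  by rewrite mulrC -ltr_pdivlMr.
by rewrite ler_wpM2r ?normc_ge0 // (le_trans (ler_norm _)) // lerDl.
Qed.

End ComplexNorm.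

(** * The complex exponential *)

Section ComplexExp.
Variable R : realType.
Implicit Types (x y : R) (z w : R[i]).

Lemma MVT_norm (f f' : R -> R) (x : R) :
  (forall t : R, is_derive t (1 : R) f (f' t)) -> exists2 c, `|c| <= `|x| & f x - f 0 = f' c * x.
Proof.
move=> df.
have cf : forall a b, {within `[a, b], continuous f}.
  by move=> a b; apply: derivable_within_continuous => t _; have := df t => -[].
have [x0|x0] := leP 0 x.
  have [c /[!in_itv]/= /andP[c0 cx] ->] :=
    @MVT_segment R f f' 0 x x0 (fun t _ => df t) (cf _ _).
  by exists c; rewrite ?subr0 // !ger0_norm.
have [c /[!in_itv]/= /andP[c0 cx] E] :=
  @MVT_segment R f f' x 0 (ltW x0) (fun t _ => df t) (cf _ _).
exists c; first by rewrite !ler0_norm ?lerN2 // ltW.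
by rewrite -opprB E sub0r mulrN opprK.
Qed.

Lemma sin_le x : `|sin x| <= `|x|.
Proof.
have [c _] := @MVT_norm sin cos x (fun t => is_derive_sin t).
rewrite sin0 subr0 => ->; rewrite normrM -[leRHS]mul1r ler_wpM2r //.
exact: cos_max.
Qed.

Lemma cosB1_le x : `|cos x - 1| <= x ^+ 2.
Proof.
have [c cx] := @MVT_norm cos (fun t => - sin t) x (fun t => is_derive_cos t).
rewrite cos0 => ->; rewrite normrM normrN -[x ^+ 2]ger0_norm ?sqr_ge0 // expr2 normrM.
by rewrite ler_wpM2r // (le_trans (sin_le _)).
Qed.

Lemma sinBid_le x : `|sin x - x| <= `|x| ^+ 3.
Proof.
have [c cx] := @MVT_norm (fun t => sin t - t) (fun t => cos t - 1) x
  (fun t => is_deriveB _ _).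
rewrite sin0 !subr0 => ->; rewrite normrM exprSr ler_wpM2r //.
apply: le_trans (cosB1_le _) _; rewrite -real_normK ?num_real //.
by rewrite ler_pXn2r ?nnegrE.
Qed.

Lemma expRB1_le x : `|x| <= 1 / 2 -> `|expR x - 1 - x| <= 2 * x ^+ 2 /\ expR x <= 2.
Proof.
rewrite ler_norml => /andP[x1 x2].
have e1 := expR_ge1Dx x.
have e2 := expR_ge1Dx (- x); rewrite expRN in e2.
have e0 := expR_gt0 x.
have H : expR x * (1 - x) <= 1.
  apply: (@le_trans _ _ (expR x * (expR x)^-1)); first by rewrite ler_pM2l.
  by rewrite mulfV ?lt0r_neq0.
split; last by nra.
rewrite ler_norml; apply/andP; split; nra.
Qed.

Definition cexp (z : R[i]) : R[i] :=
  (expR (Re z) * cos (Im z)) +i* (expR (Re z) * sin (Im z)).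

Lemma cexpD z w : cexp (z + w) = cexp z * cexp w.
Proof.
by apply: eqC; rewrite ?ReM ?ImM /= ReD ImD expRD ?cosD ?sinD; ring.
Qed.

Lemma cexp0 : cexp 0 = 1.
Proof. by apply: eqC; rewrite /cexp /= expR0 ?cos0 ?sin0 ?mulr1 ?mulr0. Qed.

Lemma normc_cexp z : normc (cexp z) = expR (Re z).
Proof.
rewrite /cexp /= !exprMn -mulrDr cos2Dsin2 mulr1 sqrtr_sqr ger0_norm //.
Qed.

Lemma cexp_conj z : (cexp z)^* = cexp z^*.
Proof. by case: z => a b; apply: eqC; rewrite /cexp /= ?cosN ?sinN ?mulrN. Qed.

(** Euler's formula reduces the estimate to the real exponential, sine and cosine; the
    constant 10 is not optimal. *)
Lemma cexpB1_le h : normc h <= 1 / 2 ->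
  normc (cexp h - 1 - h) <= 10 * normc h ^+ 2.
Proof.
move=> h1; apply: le_trans (normc_leD _) _.
have hR := le_trans (Re_le h) h1; have hI := le_trans (Im_le h) h1.
rewrite normc_sqr !ReD !ReN !ImD !ImN /=.
move: (Re h) (Im h) hR hI => a b ha hb {h h1}.
have [E1 E2] := expRB1_le ha.
have C1 := cosB1_le b.
have S1 := sinBid_le b.
have e0 := expR_ge0 a.
have -> : expR a * cos b - 1 - a = (expR a - 1 - a) + expR a * (cos b - 1) by ring.
have -> : expR a * sin b - 0 - b = (sin b - b) + (expR a - 1) * sin b by ring.
have H1 : `|expR a * (cos b - 1)| <= 2 * b ^+ 2.
  by rewrite normrM ger0_norm //; apply: ler_pM.
have H2 : `|expR a - 1| <= 2 * `|a|.
  have -> : expR a - 1 = (expR a - 1 - a) + a by ring.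
  apply: le_trans (ler_normD _ _) _.
  rewrite (_ : 2 * `|a| = `|a| + `|a|); last by ring.
  rewrite lerD2r (le_trans E1) // -real_normK ?num_real //.
  by have := normr_ge0 a; nra.
have H3 : `|(expR a - 1) * sin b| <= 2 * `|a| * `|b|.
  by rewrite normrM; apply: ler_pM => //; exact: sin_le.
have H4 : 2 * `|a| * `|b| <= a ^+ 2 + b ^+ 2.
  rewrite -[a ^+ 2]real_normK ?num_real // -[b ^+ 2]real_normK ?num_real //.
  by rewrite -subr_ge0; have := sqr_ge0 (`|a| - `|b|); nra.
have H5 : `|b| ^+ 3 <= b ^+ 2.
  by rewrite -[b ^+ 2]real_normK ?num_real // exprS; have := sqr_ge0 `|b|; have := normr_ge0 b; nra.
have := ler_normD (expR a - 1 - a) (expR a * (cos b - 1)).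
have := ler_normD (sin b - b) ((expR a - 1) * sin b).
have := sqr_ge0 a; have := sqr_ge0 b; lra.
Qed.

Lemma cexp_quad z h : normc h <= 1 / 2 ->
  normc (cexp (z + h) - cexp z - cexp z * h) <= 10 * expR (Re z) * normc h ^+ 2.
Proof.
move=> h1; rewrite cexpD.
have -> : cexp z * cexp h - cexp z - cexp z * h = cexp z * (cexp h - 1 - h) by ring.
rewrite normcM normc_cexp mulrAC [leRHS]mulrC ler_wpM2l ?expR_ge0 //.
exact: cexpB1_le.
Qed.

Lemma holo_cexp z : holo cexp z.
Proof.
apply: (@holo_quad _ cexp z (cexp z) (10 * expR (Re z)) (1 / 2)) => // h h1.
by apply: cexp_quad; exact: ltW.
Qed.

End ComplexExp.

(** * Integrals of real and complex functions *)

Section RealIntegral.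
Variable R : realType.
Local Notation mu := (@lebesgue_measure R).
Implicit Types (D : set R) (f g : R -> R).

Definition itg D f := mu.-integrable D (EFin \o f).

Lemma itg_meas D f : itg D f -> measurable_fun D f.
Proof. by move=> /(measurable_int mu)/measurable_EFinP. Qed.

Lemma itg_dom D f g : measurable D -> measurable_fun D f -> itg D g ->
  (forall x, D x -> `|f x| <= g x) -> itg D f.
Proof.
move=> mD mf ig fg; apply: (@le_integrable _ _ _ mu D mD _ _ _ _ ig).
  exact/(@measurable_EFinP _ (measurableTypeR R)).
by move=> x Dx /=; rewrite lee_fin (le_trans (fg x Dx)) // ler_norm.
Qed.

Lemma itgD D f g : measurable D -> itg D f -> itg D g -> itg D (fun x => f x + g x).
Proof. by move=> mD f1 f2; exact: (@integrableD _ _ _ mu D mD _ _ f1 f2). Qed.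

Lemma itgB D f g : measurable D -> itg D f -> itg D g -> itg D (fun x => f x - g x).
Proof. by move=> mD f1 f2; exact: (@integrableB _ _ _ mu D mD _ _ f1 f2). Qed.

Lemma itgZ D k f : measurable D -> itg D f -> itg D (fun x => k * f x).
Proof. by move=> mD f1; exact: (@integrableZl _ _ _ mu D mD k _ f1). Qed.

Lemma itg_eq D f g : measurable D -> (forall x, D x -> f x = g x) -> itg D f -> itg D g.
Proof.
by move=> mD fg; apply: (@eq_integrable _ _ _ mu D mD) => x /set_mem xD; rewrite /= fg.
Qed.

Lemma itg_sub D E f : measurable D -> measurable E -> E `<=` D -> itg D f -> itg E f.
Proof. by move=> mD mE ED fi; exact: (@integrableS _ _ _ mu D E _ mD mE ED fi). Qed.

Lemma Rint_eq D f g : (forall x, D x -> f x = g x) ->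
  \int[mu]_(x in D) f x = \int[mu]_(x in D) g x.
Proof. by move=> fg; apply: eq_Rintegral => x /set_mem /fg. Qed.

Lemma Rint_norm D f g : measurable D -> itg D f -> itg D g ->
  (forall x, D x -> `|f x| <= g x) -> `|\int[mu]_(x in D) f x| <= \int[mu]_(x in D) g x.
Proof.
move=> mD fi gi fg; apply: le_trans (@le_normr_Rintegral _ _ _ mu D f mD fi) _.
by apply: (@le_Rintegral _ _ _ mu D _ _ mD (integrable_norm fi) gi).
Qed.

Lemma itg_bounded D f (M : R) : measurable D -> (mu D < +oo)%E -> measurable_fun D f ->
  (forall x, D x -> `|f x| <= M) -> itg D f.
Proof.
move=> mD muD mf fM; apply: (@measurable_bounded_integrable _ _ _ mu f D mD muD mf).
exists M; split; first exact: num_real.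
by move=> N MN x Dx; rewrite /= (le_trans (fM x Dx)) // ltW.
Qed.

Lemma itg_cont (a b : R) f : (forall x, a <= x <= b -> {for x, continuous f}) ->
  itg `[a, b] f.
Proof.
move=> cf; apply: continuous_compact_integrable; first exact: segment_compact.
apply/continuous_in_subspaceT => x /set_mem /=; rewrite in_itv /=; exact: cf.
Qed.

Lemma Rint_split (a m b : R) f : a <= m -> m <= b -> itg `[a, b] f ->
  \int[mu]_(x in `[a, b]) f x = \int[mu]_(x in `[a, m]) f x + \int[mu]_(x in `[m, b]) f x.
Proof.
move=> am mb fi; have := @Rintegral_itvB R f (BLeft a) (BRight b) m fi.
rewrite !bnd_simp => /(_ am mb) E.
rewrite -(@Rintegral_itv_obnd_cbnd _ m) -?E; first by rewrite addrC subrK.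
apply: itg_sub fi => //; apply: subset_itv; rewrite bnd_simp //.
Qed.

Lemma Rint_len (a b M : R) : a <= b -> \int[mu]_(x in `[a, b]) M = M * (b - a).
Proof.
move=> ab; rewrite Rintegral_cst //.
transitivity (M * fine (if (a%:E < b%:E)%E then b%:E - a%:E else 0)%E).
  by congr (_ * fine _); exact: (@lebesgue_measure_itv R `[a, b]).
rewrite /= lte_fin; case: ifP => //.
by rewrite lt_neqAle ab andbT => /negbFE/eqP ->; rewrite subrr !mulr0.
Qed.

End RealIntegral.

Section ComplexIntegral.
Variable R : realType.
Local Notation mu := (@lebesgue_measure R).
Implicit Types (D : set R) (f g : R -> R[i]).

Lemma Cint_eq D f g : (forall x, D x -> f x = g x) -> Cintegral D f = Cintegral D g.
Proof.
by move=> fg; apply: eqC; apply: Rint_eq => x Dx; rewrite fg.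
Qed.

Lemma Citg_eq D f g : measurable D -> (forall x, D x -> f x = g x) ->
  Cintegrable D f -> Cintegrable D g.
Proof.
move=> mD fg [f1 f2]; split.
  by apply: (itg_eq _ _ f1) => // x Dx; rewrite fg.
by apply: (itg_eq _ _ f2) => // x Dx; rewrite fg.
Qed.

Lemma Citg_dom D f (g : R -> R) : measurable D -> Cmeasurable D f -> itg D g ->
  (forall x, D x -> normc (f x) <= g x) -> Cintegrable D f.
Proof.
move=> mD [m1 m2] ig fg; split; apply: (@itg_dom _ _ _ g) => // x Dx.
  exact: le_trans (Re_le _) (fg x Dx).
exact: le_trans (Im_le _) (fg x Dx).
Qed.

Lemma CitgD D f g : measurable D -> Cintegrable D f -> Cintegrable D g ->
  Cintegrable D (fun x => f x + g x).
Proof.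
move=> mD [f1 f2] [g1 g2]; split.
  by apply: (itg_eq _ _ (itgD _ f1 g1)) => // x _; rewrite ReD.
by apply: (itg_eq _ _ (itgD _ f2 g2)) => // x _; rewrite ImD.
Qed.

Lemma CintD D f g : measurable D -> Cintegrable D f -> Cintegrable D g ->
  Cintegral D (fun x => f x + g x) = Cintegral D f + Cintegral D g.
Proof.
move=> mD [f1 f2] [g1 g2]; apply: eqC; rewrite ?ReD ?ImD /= -RintegralD //.
  by apply: Rint_eq => x _; rewrite ReD.
by apply: Rint_eq => x _; rewrite ImD.
Qed.

Lemma CitgZ D c f : measurable D -> Cintegrable D f -> Cintegrable D (fun x => c * f x).
Proof.
move=> mD [f1 f2]; split.
  by apply: (itg_eq _ _ (itgB _ (itgZ (Re c) _ f1) (itgZ (Im c) _ f2))) => // x _; rewrite ReM.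
by apply: (itg_eq _ _ (itgD _ (itgZ (Re c) _ f2) (itgZ (Im c) _ f1))) => // x _; rewrite ImM.
Qed.

Lemma CintZ D c f : measurable D -> Cintegrable D f ->
  Cintegral D (fun x => c * f x) = c * Cintegral D f.
Proof.
move=> mD [f1 f2]; apply: eqC; rewrite ?ReM ?ImM /= -!RintegralZl //.
  rewrite -RintegralB //; [|exact: itgZ|exact: itgZ].
  by apply: Rint_eq => x _; rewrite ReM.
rewrite -RintegralD //; [|exact: itgZ|exact: itgZ].
by apply: Rint_eq => x _; rewrite ImM.
Qed.

Lemma CitgN D f : measurable D -> Cintegrable D f -> Cintegrable D (fun x => - f x).
Proof.
move=> mD /(CitgZ (-1) mD); apply: Citg_eq => // x _; by rewrite mulN1r.
Qed.

Lemma CitgB D f g : measurable D -> Cintegrable D f -> Cintegrable D g ->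
  Cintegrable D (fun x => f x - g x).
Proof. by move=> mD f1 /CitgN g1; apply: CitgD => //; exact: g1. Qed.

Lemma CintN D f : measurable D -> Cintegrable D f ->
  Cintegral D (fun x => - f x) = - Cintegral D f.
Proof.
move=> mD fi; rewrite -mulN1r -CintZ //; apply: Cint_eq => x _; by rewrite mulN1r.
Qed.

Lemma CintB D f g : measurable D -> Cintegrable D f -> Cintegrable D g ->
  Cintegral D (fun x => f x - g x) = Cintegral D f - Cintegral D g.
Proof.
by move=> mD f1 g1; rewrite -CintN // -CintD //; exact: CitgN.
Qed.

(** Multiplying by the conjugate of the value of the integral makes that value real and
    nonnegative, which reduces the triangle inequality to real integrals. *)
Lemma Cint_norm D f (g : R -> R) : measurable D -> Cintegrable D f -> itg D g ->
  (forall x, D x -> normc (f x) <= g x) ->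
  normc (Cintegral D f) <= \int[mu]_(x in D) g x.
Proof.
move=> mD fi gi fg; set I := Cintegral D f.
have [->|I0] := eqVneq I 0.
  rewrite normc_0; apply: Rintegral_ge0 => x Dx.
  exact: le_trans (normc_ge0 _) (fg x Dx).
have nI : 0 < normc I by rewrite normc_gt0.
rewrite -(ler_pM2l nI) -expr2.
have -> : normc I ^+ 2 = Re (Cintegral D (fun x => I^* * f x)).
  by rewrite CintZ // -/I normc_sqr ReM; case: (I) => a b /=; ring.
rewrite -RintegralZl //= (le_trans (ler_norm _)) //.
apply: Rint_norm => //; [exact: (CitgZ _ mD fi).1|exact: itgZ|].
move=> x Dx; apply: le_trans (Re_le _) _; rewrite normcM normcJ.
by rewrite ler_wpM2l ?normc_ge0 // fg.
Qed.

Definition Rcont f x :=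
  {for x, continuous (fun t => Re (f t))} /\ {for x, continuous (fun t => Im (f t))}.

Lemma Rcont_eps f x : (forall e : R, 0 < e -> exists2 d : R, 0 < d &
   forall y, `|y - x| < d -> normc (f y - f x) < e) -> Rcont f x.
Proof.
move=> H; split; apply/cvgrPdist_lt => e e0; have [d d0 dP] := H _ e0;
  apply/nbhs_normP; exists d => //= y; rewrite /ball_ /= distrC => /dP.
  by apply: le_lt_trans; rewrite normcB; apply: le_trans (Re_le _); rewrite ReD ReN.
by apply: le_lt_trans; rewrite normcB; apply: le_trans (Im_le _); rewrite ImD ImN.
Qed.

Lemma Ccont_Rcont (g : R[i] -> R[i]) (z0 w : R[i]) x : Ccont g (z0 + x%:C * w) ->
  Rcont (fun t => g (z0 + t%:C * w)) x.
Proof.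
move=> /Ccont_normc cg; apply: Rcont_eps => e /cg[d d0 dP].
exists (d / (normc w + 1)).
  by rewrite divr_gt0 // ltr_wpDl // normc_ge0.
move=> y yx; apply: dP.
have -> : z0 + y%:C * w - (z0 + x%:C * w) = (y - x)%:C * w by rewrite rmorphB /=; ring.
rewrite normcM normc_R; move: yx; rewrite ltr_pdivlMr ?ltr_wpDl ?normc_ge0 //.
by apply: le_lt_trans; rewrite ler_wpM2l // lerDl.
Qed.

Lemma Citg_cont (a b : R) f : (forall x, a <= x <= b -> Rcont f x) ->
  Cintegrable `[a, b] f.
Proof. by move=> H; split; apply: itg_cont => x /H[]. Qed.

Lemma Cint_split (a m b : R) f : a <= m -> m <= b -> Cintegrable `[a, b] f ->
  Cintegral `[a, b] f = Cintegral `[a, m] f + Cintegral `[m, b] f.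
Proof.
by move=> am mb [f1 f2]; apply: eqC; rewrite ?ReD ?ImD; exact: Rint_split.
Qed.

End ComplexIntegral.

(** * The Cauchy-Goursat theorem on rectangles *)

Section Goursat.
Variable R : realType.
Local Notation mu := (@lebesgue_measure R).
Implicit Types (f g : R[i] -> R[i]).

Lemma Rcont_h g (c x : R) : Ccont g (x +i* c) -> Rcont (fun t => g (t +i* c)) x.
Proof.
have E t : t +i* c = c*i + t%:C * 1 by apply: eqC; rewrite ?ReD ?ImD ?ReM ?ImM /=; ring.
rewrite E => /Ccont_Rcont; congr Rcont; apply: funext => t; by rewrite E.
Qed.

Lemma Rcont_v g (a y : R) : Ccont g (a +i* y) -> Rcont (fun t => g (a +i* t)) y.
Proof.
have E t : a +i* t = a%:C + t%:C * 'i by apply: eqC; rewrite ?ReD ?ImD ?ReM ?ImM /=; ring.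
rewrite E => /Ccont_Rcont; congr Rcont; apply: funext => t; by rewrite E.
Qed.

(** The counterclockwise contour integral along the boundary of the rectangle [a, b] x
    [c, d]. *)
Definition bdrect g (a b c d : R) : R[i] :=
  Cintegral `[a, b] (fun x => g (x +i* c)) + 'i * Cintegral `[c, d] (fun y => g (b +i* y))
  - Cintegral `[a, b] (fun x => g (x +i* d)) - 'i * Cintegral `[c, d] (fun y => g (a +i* y)).

Arguments bdrect : simpl never.

Definition contrect g (a b c d : R) :=
  forall x y, a <= x <= b -> c <= y <= d -> Ccont g (x +i* y).

Lemma citg_h g a b c d y : contrect g a b c d -> c <= y <= d ->
  Cintegrable `[a, b] (fun x => g (x +i* y)).
Proof. by move=> cg yd; apply: Citg_cont => x xb; apply/Rcont_h/cg. Qed.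

Lemma citg_v g a b c d x : contrect g a b c d -> a <= x <= b ->
  Cintegrable `[c, d] (fun y => g (x +i* y)).
Proof. by move=> cg xb; apply: Citg_cont => y yd; apply/Rcont_v/cg. Qed.

Lemma contrect_sub g a b c d a' b' c' d' : a <= a' -> b' <= b -> c <= c' -> d' <= d ->
  contrect g a b c d -> contrect g a' b' c' d'.
Proof.
move=> aa bb cc dd cg x y /andP[x1 x2] /andP[y1 y2]; apply: cg.
  by rewrite (le_trans aa x1) (le_trans x2 bb).
by rewrite (le_trans cc y1) (le_trans y2 dd).
Qed.

Lemma bdrect_split g a m b c n d : a <= m -> m <= b -> c <= n -> n <= d ->
  contrect g a b c d ->
  bdrect g a b c d = bdrect g a m c n + bdrect g m b c n + bdrect g a m n d + bdrect g m b n d.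
Proof.
move=> am mb cn nd cg; rewrite /bdrect.
have ab := le_trans am mb; have cd := le_trans cn nd.
rewrite (Cint_split am mb (citg_h cg (y := c) _)) ?lexx //.
rewrite (Cint_split am mb (citg_h cg (y := d) _)) ?lexx ?cd //.
rewrite (Cint_split cn nd (citg_v cg (x := a) _)) ?lexx //.
rewrite (Cint_split cn nd (citg_v cg (x := b) _)) ?lexx ?ab //.
ring.
Qed.

Lemma Cint_cst (a b : R) c : a <= b -> Cintegral `[a, b] (fun=> c) = (b - a)%:C * c.
Proof.
by move=> ab; apply: eqC; rewrite ?ReM ?ImM /= Rint_len //; ring.
Qed.

Lemma cont_affine (p q l z : R[i]) : Ccont (fun w => p + l * (w - q)) z.
Proof.
apply/holo_cont/holoD; first exact: holo_cst.
apply: holoM; first exact: holo_cst.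
by apply: holoB; [exact: holo_id|exact: holo_cst].
Qed.

(** On opposite sides an affine function differs by a constant, and the contributions of
    the two pairs of sides cancel. *)
Lemma bdrect_affine (p q l : R[i]) (a b c d : R) : a <= b -> c <= d ->
  bdrect (fun w => p + l * (w - q)) a b c d = 0.
Proof.
move=> ab cd; set g := fun w => _.
have cg : contrect g a b c d by move=> x y _ _; exact: cont_affine.
have E1 : Cintegral `[a, b] (fun x => g (x +i* c)) - Cintegral `[a, b] (fun x => g (x +i* d))
   = (b - a)%:C * (l * 'i * (c - d)%:C).
  rewrite -CintB //; [|apply: citg_h cg _; rewrite lexx//|apply: citg_h cg _; rewrite lexx ?cd//].
  rewrite -Cint_cst //; apply: Cint_eq => x _; rewrite /g.
  have -> : x +i* c = x%:C + 'i * c%:C by rewrite [LHS]complexE.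
  have -> : x +i* d = x%:C + 'i * d%:C by rewrite [LHS]complexE.
  by rewrite rmorphB /=; ring.
have E2 : Cintegral `[c, d] (fun y => g (b +i* y)) - Cintegral `[c, d] (fun y => g (a +i* y))
   = (d - c)%:C * (l * (b - a)%:C).
  rewrite -CintB //; [|apply: citg_v cg _; rewrite lexx ?ab//|apply: citg_v cg _; rewrite lexx//].
  rewrite -Cint_cst //; apply: Cint_eq => y _; rewrite /g.
  have -> : b +i* y = b%:C + 'i * y%:C by rewrite [LHS]complexE.
  have -> : a +i* y = a%:C + 'i * y%:C by rewrite [LHS]complexE.
  by rewrite rmorphB /=; ring.
rewrite /bdrect.
have -> : forall u v w x : R[i], u + 'i * v - w - 'i * x = (u - w) + 'i * (v - x) by move=> *; ring.
by rewrite E1 E2 !rmorphB /=; ring.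
Qed.

Lemma bdrectD f g (a b c d : R) : a <= b -> c <= d ->
  contrect f a b c d -> contrect g a b c d ->
  bdrect (fun w => f w + g w) a b c d = bdrect f a b c d + bdrect g a b c d.
Proof.
move=> ab cd cf cg; rewrite /bdrect.
rewrite !CintD //; try (by apply: citg_h cf _; rewrite lexx ?cd);
 try (by apply: citg_h cg _; rewrite lexx ?cd);
 try (by apply: citg_v cf _; rewrite lexx ?ab);
 try (by apply: citg_v cg _; rewrite lexx ?ab).
ring.
Qed.

Lemma bdrect_norm g (a b c d M : R) : a <= b -> c <= d -> contrect g a b c d ->
  (forall x y, a <= x <= b -> c <= y <= d -> normc (g (x +i* y)) <= M) ->
  normc (bdrect g a b c d) <= 2 * M * ((b - a) + (d - c)).
Proof.
move=> ab cd cg gM.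
have Hh y : c <= y <= d -> normc (Cintegral `[a, b] (fun x => g (x +i* y))) <= M * (b - a).
  move=> yd; rewrite -Rint_len //; apply: Cint_norm => //.
  - exact: citg_h cg yd.
  - by apply: itg_cont => x _; exact: cvg_cst.
  - by move=> x; rewrite /= in_itv /= => xb; exact: gM.
have Hv x : a <= x <= b -> normc ('i * Cintegral `[c, d] (fun y => g (x +i* y))) <= M * (d - c).
  move=> xb; rewrite normcM normc_i mul1r -Rint_len //; apply: Cint_norm => //.
  - exact: citg_v cg xb.
  - by apply: itg_cont => y _; exact: cvg_cst.
  - by move=> y; rewrite /= in_itv /= => yd; exact: gM.
rewrite /bdrect; apply: le_trans (normcD _ _) _; rewrite normcN.
have h4 := Hv a; have h2 := Hv b; have h1 := Hh c; have h3 := Hh d.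
rewrite !lexx ?ab in h4 h2; rewrite !lexx ?cd in h1 h3.
have := h4 isT; have := h3 isT; have := h2 isT; have := h1 isT.
set u := Cintegral _ _; set v := 'i * _; set w := Cintegral _ _; set x := 'i * _ => H1 H2 H3 H4.
have := normcD (u + v) (- w); have := normcD u v; rewrite normcN; lra.
Qed.

Section Bisection.
Variables (g : R[i] -> R[i]) (a c w h : R).
Hypotheses (w0 : 0 <= w) (h0 : 0 <= h).
Hypothesis cg : contrect g a (a + w) c (c + h).

Let Q (w h : R) (p : R * R) := normc (bdrect g p.1 (p.1 + w) p.2 (p.2 + h)).
Let step (w h : R) (p : R * R) : R * R :=
  let ok q := Q (w + w) (h + h) p / 4 <= Q w h q in
  if ok (p.1 + w, p.2) then (p.1 + w, p.2) else
  if ok (p.1, p.2 + h) then (p.1, p.2 + h) else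
  (* the last quarter is the one left when the other three fail *)
  if ok (p.1 + w, p.2 + h) then (p.1 + w, p.2 + h) else p.

Let stepP (w' h' : R) (p : R * R) : 0 <= w' -> 0 <= h' ->
  contrect g p.1 (p.1 + (w' + w')) p.2 (p.2 + (h' + h')) ->
  let q := step w' h' p in
  [/\ Q (w' + w') (h' + h') p / 4 <= Q w' h' q,
   p.1 <= q.1 <= p.1 + w' & p.2 <= q.2 <= p.2 + h'].
Proof.
move=> ww hh cp /=; rewrite /step.
case: ifP => [H|/negbT]; first by rewrite H /= !lexx !lerDl ww hh.
rewrite -ltNge => H1.
case: ifP => [H|/negbT]; first by rewrite H /= !lexx !lerDl ww hh.
rewrite -ltNge => H2.
case: ifP => [H|/negbT]; first by rewrite H /= !lexx !lerDl ww hh.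
rewrite -ltNge => H3.
rewrite !lexx !lerDl ww hh; split => //.
rewrite leNgt; apply/negP => H4.
have := @bdrect_split g p.1 (p.1 + w') (p.1 + (w' + w')) p.2 (p.2 + h') (p.2 + (h' + h')).
rewrite !lerD2l !lerDl => /(_ ww ww hh hh cp) E.
have H1' : normc (bdrect g (p.1 + w') (p.1 + (w' + w')) p.2 (p.2 + h')) <
  Q (w' + w') (h' + h') p / 4 by rewrite (addrA p.1).
have H2' : normc (bdrect g p.1 (p.1 + w') (p.2 + h') (p.2 + (h' + h'))) <
  Q (w' + w') (h' + h') p / 4 by rewrite (addrA p.2).
have H3' : normc (bdrect g (p.1 + w') (p.1 + (w' + w')) (p.2 + h') (p.2 + (h' + h'))) <
  Q (w' + w') (h' + h') p / 4 by rewrite (addrA p.1) (addrA p.2).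
move: H1' H2' H3' H4; rewrite /Q E.
move: (bdrect g p.1 (p.1 + w') p.2 (p.2 + h')) => x1.
move: (bdrect g (p.1 + w') (p.1 + (w' + w')) p.2 (p.2 + h')) => x2.
move: (bdrect g p.1 (p.1 + w') (p.2 + h') (p.2 + (h' + h'))) => x3.
move: (bdrect g (p.1 + w') (p.1 + (w' + w')) (p.2 + h') (p.2 + (h' + h'))) => x4.
have := normcD (x1 + x2 + x3) x4; have := normcD (x1 + x2) x3; have := normcD x1 x2.
lra.
Qed.

Fixpoint bisect n : R * R :=
  if n is m.+1 then step (w / 2 ^+ m.+1) (h / 2 ^+ m.+1) (bisect m) else (a, c).

Let half (x : R) n : x / 2 ^+ n.+1 + x / 2 ^+ n.+1 = x / 2 ^+ n.
Proof. by rewrite exprS; field; rewrite expf_neq0. Qed.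

Let ww n : 0 <= w / 2 ^+ n. Proof. by rewrite divr_ge0 // exprn_ge0. Qed.
Let hh n : 0 <= h / 2 ^+ n. Proof. by rewrite divr_ge0 // exprn_ge0. Qed.

Let bisect_sub n : [/\ a <= (bisect n).1, (bisect n).1 + w / 2 ^+ n <= a + w,
  c <= (bisect n).2 & (bisect n).2 + h / 2 ^+ n <= c + h].
Proof.
elim: n => [|n [h1 h2 h3 h4]]; first by rewrite /= expr0 !divr1 !lexx.
have cp : contrect g (bisect n).1 ((bisect n).1 + w / 2 ^+ n) (bisect n).2 ((bisect n).2 + h / 2 ^+ n).
  exact: contrect_sub cg.
have := @stepP (w / 2 ^+ n.+1) (h / 2 ^+ n.+1) (bisect n) (ww _) (hh _).
rewrite !half => /(_ cp) /= [_ /andP[x1 x2] /andP[y1 y2]].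
have := half w n; have := half h n.
split; [exact: le_trans x1| | exact: le_trans y1|]; lra.
Qed.

Let bisect_step n : [/\ Q (w / 2 ^+ n) (h / 2 ^+ n) (bisect n) / 4 <=
     Q (w / 2 ^+ n.+1) (h / 2 ^+ n.+1) (bisect n.+1),
  (bisect n).1 <= (bisect n.+1).1 <= (bisect n).1 + w / 2 ^+ n.+1 &
  (bisect n).2 <= (bisect n.+1).2 <= (bisect n).2 + h / 2 ^+ n.+1].
Proof.
have [h1 h2 h3 h4] := bisect_sub n.
have cp : contrect g (bisect n).1 ((bisect n).1 + w / 2 ^+ n) (bisect n).2 ((bisect n).2 + h / 2 ^+ n).
  exact: contrect_sub cg.
have := @stepP (w / 2 ^+ n.+1) (h / 2 ^+ n.+1) (bisect n) (ww _) (hh _).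
by rewrite !half => /(_ cp).
Qed.

Let bisect_le n m : [/\ (bisect n).1 <= (bisect (n + m)).1,
  (bisect (n + m)).1 + w / 2 ^+ (n + m) <= (bisect n).1 + w / 2 ^+ n,
  (bisect n).2 <= (bisect (n + m)).2 &
  (bisect (n + m)).2 + h / 2 ^+ (n + m) <= (bisect n).2 + h / 2 ^+ n].
Proof.
elim: m => [|m [h1 h2 h3 h4]]; first by rewrite addn0 !lexx.
rewrite addnS; have [_ /andP[x1 x2] /andP[y1 y2]] := bisect_step (n + m).
have := half w (n + m); have := half h (n + m).
split; [exact: le_trans x1| | exact: le_trans y1|]; lra.
Qed.

Let nested (u : nat -> R) (v : nat -> R) : (forall n, 0 <= v n) ->
  (forall n m, u n <= u (n + m)%N /\ u (n + m)%N + v (n + m)%N <= u n + v n) ->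
  exists x, forall n, u n <= x <= u n + v n.
Proof.
move=> v0 uv; have H n m : u n <= u m + v m.
  have [a1 _] := uv n m; have [_ b2] := uv m n; rewrite addnC in b2.
  by have := v0 (n + m)%N; lra.
exists (sup (range u)) => n; apply/andP; split.
  apply: ub_le_sup; last by exists n.
  by exists (u 0%N + v 0%N) => _ [m _ <-].
apply: ge_sup; first by exists (u 0%N), 0%N.
by move=> _ [m _ <-].
Qed.

(** Among the four quarters of a rectangle one carries at least a quarter of the modulus
    of the contour integral; iterating this choice shrinks to a point. *)
Lemma bisection_point : exists p : R * R,
  [/\ a <= p.1 <= a + w, c <= p.2 <= c + h &
   forall n, exists q : R * R,
    [/\ contrect g q.1 (q.1 + w / 2 ^+ n) q.2 (q.2 + h / 2 ^+ n),
     q.1 <= p.1 <= q.1 + w / 2 ^+ n, q.2 <= p.2 <= q.2 + h / 2 ^+ n &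
     normc (bdrect g a (a + w) c (c + h)) <=
       4 ^+ n * normc (bdrect g q.1 (q.1 + w / 2 ^+ n) q.2 (q.2 + h / 2 ^+ n))]].
Proof.
have [x xP] : exists x, forall n, (bisect n).1 <= x <= (bisect n).1 + w / 2 ^+ n.
  by apply: nested => // n m; have [] := bisect_le n m.
have [y yP] : exists x, forall n, (bisect n).2 <= x <= (bisect n).2 + h / 2 ^+ n.
  by apply: nested => // n m; have [] := bisect_le n m.
exists (x, y); split.
- by have := xP 0%N; rewrite expr0 divr1.
- by have := yP 0%N; rewrite expr0 divr1.
- move=> n; exists (bisect n); split => //.
    by have [h1 h2 h3 h4] := bisect_sub n; exact: contrect_sub cg.
  elim: n => [|n IH]; first by rewrite /= !expr0 !divr1 mul1r.
  apply: le_trans IH _; rewrite exprSr -mulrA ler_wpM2l ?exprn_ge0 //.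
  by have [+ _ _] := bisect_step n; rewrite /Q; lra.
Qed.

End Bisection.

(** Around the limit point the function is affine up to an error small compared with the
    distance, while the n-th rectangle has diameter times perimeter of order 4^-n. *)
Lemma goursat_size g (a c w h : R) : 0 <= w -> 0 <= h ->
  (forall x y, a <= x <= a + w -> c <= y <= c + h -> holo g (x +i* y)) ->
  bdrect g a (a + w) c (c + h) = 0.
Proof.
move=> w0 h0 hg.
have cg : contrect g a (a + w) c (c + h) by move=> x y xw yh; apply/holo_cont/hg.
have [p [p1 p2 pP]] := bisection_point w0 h0 cg.
have [l lP] := holo_eps (hg _ _ p1 p2).
apply/eqP; rewrite -normc_eq0; apply/eqP/le_anti; rewrite normc_ge0 andbT.
apply/ler_addgt0Pl => e e0; rewrite addr0.
pose S := w + h + 1; have S0 : 0 < S by rewrite /S; lra.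
have eS : 0 < e / (2 * S ^+ 2) by rewrite divr_gt0 // mulr_gt0 // exprn_gt0.
have [d d0 dP] := lP _ eS.
have [n nP] : exists n, S / d < 2 ^+ n.
  exists (Num.truncn (S / d)).+1; apply: lt_le_trans (truncnS_gt _) _.
  by rewrite -natrX ler_nat ltnW // ltn_expl.
have {}nP : S / 2 ^+ n < d.
  by rewrite ltr_pdivrMr ?exprn_gt0 // mulrC -ltr_pdivrMr.
have [q [cq q1 q2 qP]] := pP n.
apply: le_trans qP _.
set b := q.1 + _; set k := q.2 + _.
pose z := p.1 +i* p.2.
pose r := fun v => g v - (g z + l * (v - z)).
have cr : contrect r q.1 b q.2 k.
  by move=> x y xb yk; apply: contB; [exact: cq|exact: cont_affine].
have E : bdrect g q.1 b q.2 k = bdrect r q.1 b q.2 k.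
  have qb : q.1 <= b by rewrite lerDl divr_ge0 // exprn_ge0.
  have qk : q.2 <= k by rewrite lerDl divr_ge0 // exprn_ge0.
  transitivity (bdrect (fun v => r v + (g z + l * (v - z))) q.1 b q.2 k).
    have H v : g v = r v + (g z + l * (v - z)) by rewrite /r subrK.
    exact: (f_equal (fun G => bdrect G q.1 b q.2 k) (funext H)).
  have ca : contrect (fun v => g z + l * (v - z)) q.1 b q.2 k.
    by move=> x y _ _; exact: cont_affine.
  rewrite (bdrectD qb qk cr ca) (bdrect_affine (g z) z l qb qk); exact: addr0.
have B : normc (bdrect r q.1 b q.2 k) <= 2 * (e / (2 * S ^+ 2) * (S / 2 ^+ n)) * ((b - q.1) + (k - q.2)).
  have p2n : 0 < 2 ^+ n :> R by rewrite exprn_gt0.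
  apply: bdrect_norm => //; rewrite ?lerDl ?divr_ge0 ?exprn_ge0 //.
  move=> x y /andP[xq xb] /andP[yq yk].
  have hS : normc (x +i* y - z) <= S / 2 ^+ n.
    apply: le_trans (normc_leD _) _; rewrite /z /=.
    move: q1 q2 => /andP[q11 q12] /andP[q21 q22].
    apply: (@le_trans _ _ (w / 2 ^+ n + h / 2 ^+ n)).
      by apply: lerD; rewrite ler_norml; apply/andP; split; rewrite /b /k in xb yk; lra.
    by rewrite -mulrDl ler_pM2r ?invr_gt0 // lerDl.
  have := dP (x +i* y - z) (le_lt_trans hS nP).
  rewrite /r [_ + (_ - z)]addrC subrK opprD addrA => H; apply: le_trans H _.
  rewrite ler_wpM2l //; by rewrite divr_ge0 ?ltW // mulr_gt0 // exprn_gt0.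
rewrite E; apply: (@le_trans _ _ (4 ^+ n * (2 * (e / (2 * S ^+ 2) * (S / 2 ^+ n)) * (S / 2 ^+ n)))).
  rewrite ler_wpM2l ?exprn_ge0 //; apply: le_trans B _.
  rewrite ler_wpM2l //.
    by rewrite !(mulr_ge0, divr_ge0, exprn_ge0, invr_ge0) // ltW.
  have -> : b - q.1 = w / 2 ^+ n by rewrite /b addrC addKr.
  have -> : k - q.2 = h / 2 ^+ n by rewrite /k addrC addKr.
  by rewrite -mulrDl ler_wpM2r ?invr_ge0 ?exprn_ge0 // /S lerDl.
have -> : 4 ^+ n = 2 ^+ n * 2 ^+ n :> R by rewrite -exprMn; congr (_ ^+ _); ring.
rewrite le_eqVlt; apply/orP; left; apply/eqP; field.
by rewrite expf_neq0 //= gt_eqF.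
Qed.

End Goursat.

(** * Dominated convergence *)

Section DominatedConvergence.
Variable R : realType.
Local Notation mu := (@lebesgue_measure R).

Definition Ccvg (u : nat -> R[i]) (l : R[i]) :=
  (Re (u n) @[n --> \oo] --> Re l) /\ (Im (u n) @[n --> \oo] --> Im l).

Lemma Ccvg_eps (u : nat -> R[i]) l :
  (forall e : R, 0 < e -> exists N, forall n, (N <= n)%N -> normc (u n - l) < e) -> Ccvg u l.
Proof.
move=> H; split; apply/cvgrPdist_lt => e /H[N NP]; near=> n;
  (have /NP : (N <= n)%N by near: n; exact: nbhs_infty_ge); apply: le_lt_trans;
  rewrite distrC.
- by apply: le_trans (Re_le _); rewrite ReD ReN.
- by apply: le_trans (Im_le _); rewrite ImD ImN.
Unshelve. all: by end_near. Qed.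

Lemma Ccvg_le (u : nat -> R[i]) l (v : nat -> R) :
  (forall n, normc (u n - l) <= v n) -> v n @[n --> \oo] --> 0 -> Ccvg u l.
Proof.
move=> uv v0; apply: Ccvg_eps => e e0.
have /cvgrPdist_lt/(_ e e0)[N _ NP] := v0.
exists N => n /NP; rewrite sub0r normrN; apply: le_lt_trans.
exact: le_trans (uv n) (ler_norm _).
Qed.

Lemma Ccvg_cst l : Ccvg (fun=> l) l.
Proof. by split; exact: cvg_cst. Qed.

Lemma CcvgD u v l m : Ccvg u l -> Ccvg v m -> Ccvg (fun n => u n + v n) (l + m).
Proof.
move=> [u1 u2] [v1 v2]; split; rewrite ?ReD ?ImD.
  by under eq_cvg => n do rewrite ReD; exact: cvgD.
by under eq_cvg => n do rewrite ImD; exact: cvgD.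
Qed.

Lemma CcvgM u v l m : Ccvg u l -> Ccvg v m -> Ccvg (fun n => u n * v n) (l * m).
Proof.
move=> [u1 u2] [v1 v2]; split; rewrite ?ReM ?ImM.
  by under eq_cvg => n do rewrite ReM; apply: cvgB; exact: cvgM.
by under eq_cvg => n do rewrite ImM; apply: cvgD; exact: cvgM.
Qed.

Lemma CcvgZ c u l : Ccvg u l -> Ccvg (fun n => c * u n) (c * l).
Proof. exact/CcvgM/Ccvg_cst. Qed.

Lemma CcvgN u l : Ccvg u l -> Ccvg (fun n => - u n) (- l).
Proof.
move=> [u1 u2]; split; rewrite ?ReN ?ImN.
  by under eq_cvg => n do rewrite ReN; exact: cvgN.
by under eq_cvg => n do rewrite ImN; exact: cvgN.
Qed.

Lemma CcvgB u v l m : Ccvg u l -> Ccvg v m -> Ccvg (fun n => u n - v n) (l - m).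
Proof. by move=> ? /CcvgN; exact: CcvgD. Qed.

Lemma Ccvg_unique u l m : Ccvg u l -> Ccvg u m -> l = m.
Proof.
move=> [u1 u2] [v1 v2]; apply: eqC.
  exact: (@cvg_unique _ (@norm_hausdorff _ R) _ _ _ _ u1 v1).
exact: (@cvg_unique _ (@norm_hausdorff _ R) _ _ _ _ u2 v2).
Qed.

Lemma Ccvg_comp (g : R[i] -> R[i]) u z : Ccont g z -> (normc (u n - z) @[n --> \oo] --> (0 : R)) ->
  Ccvg (fun n => g (u n)) (g z).
Proof.
move=> /Ccont_normc cg uz; apply: Ccvg_eps => e /cg[d d0 dP].
have /cvgrPdist_lt/(_ d d0)[N _ NP] := uz.
by exists N => n /NP; rewrite sub0r normrN ger0_norm ?normc_ge0 // => /dP.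
Qed.

Lemma Rint_dct (D : set R) (F : nat -> R -> R) (f g : R -> R) :
  measurable D -> (forall n, measurable_fun D (F n)) -> itg D g ->
  (forall n x, D x -> `|F n x| <= g x) ->
  (forall x, D x -> F n x @[n --> \oo] --> f x) ->
  itg D f /\ (\int[mu]_(x in D) F n x @[n --> \oo] --> \int[mu]_(x in D) f x).
Proof.
move=> mD mF ig Fg Ff.
have mf : measurable_fun D f.
  exact: (measurable_fun_cvg mF Ff).
have [|||||] := @dominated_convergence _ (measurableTypeR R) R mu D mD
  (fun n x => (F n x)%:E) (fun x => (f x)%:E) (fun x => (g x)%:E).
- by move=> n; apply/(@measurable_EFinP _ (measurableTypeR R)); exact: mF.
- by apply/(@measurable_EFinP _ (measurableTypeR R)).
- by apply: aeW => x Dx; apply: cvg_EFin; [exact: nearW|exact: Ff].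
- exact: ig.
- by apply: aeW => x n Dx; rewrite lee_fin Fg.
move=> fi _ cv; split; first exact: fi.
rewrite /Rintegral.
apply: fine_cvg; rewrite fineK //.
exact: (@integrable_fin_num _ (measurableTypeR R) R mu D mD _ fi).
Qed.

Lemma Cint_dct (D : set R) (F : nat -> R -> R[i]) (f : R -> R[i]) (g : R -> R) :
  measurable D -> (forall n, Cmeasurable D (F n)) -> itg D g ->
  (forall n x, D x -> normc (F n x) <= g x) ->
  (forall x, D x -> Ccvg (F^~ x) (f x)) ->
  Cintegrable D f /\ Ccvg (fun n => Cintegral D (F n)) (Cintegral D f).
Proof.
move=> mD mF ig Fg Ff.
have [||||i1 c1] := @Rint_dct D (fun n x => Re (F n x)) (fun x => Re (f x)) g mD.
- by move=> n; exact: (mF n).1.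
- exact: ig.
- by move=> n x Dx; exact: le_trans (Re_le _) (Fg n x Dx).
- by move=> x Dx; exact: (Ff x Dx).1.
have [||||i2 c2] := @Rint_dct D (fun n x => Im (F n x)) (fun x => Im (f x)) g mD.
- by move=> n; exact: (mF n).2.
- exact: ig.
- by move=> n x Dx; exact: le_trans (Im_le _) (Fg n x Dx).
- by move=> x Dx; exact: (Ff x Dx).2.
by [].
Qed.

Lemma Cmeas_itg (D : set R) f : Cintegrable D f -> Cmeasurable D f.
Proof. by move=> [i1 i2]; split; exact: itg_meas. Qed.

Lemma Rint_trunc (f : R -> R) (u : nat -> R) : itg `[0, +oo[ f ->
  (forall x, exists N, forall n, (N <= n)%N -> x <= u n) ->
  \int[mu]_(x in `[0, u n]) f x @[n --> \oo] --> \int[mu]_(x in `[0, +oo[) f x.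
Proof.
move=> fi uoo.
pose P n : set R := `]-oo, u n]%classic.
pose F n x := f x * \1_(P n) x.
have [|||||_] := @Rint_dct `[0, +oo[ F f (fun x => `|f x|).
- by [].
- move=> n; apply: measurable_funM; first exact: itg_meas.
  by apply: measurable_indic; exact: measurable_itv.
- exact: (integrable_norm fi).
- move=> n x _; rewrite /F indicE; case: (_ \in _); first by rewrite mulr1.
  by rewrite mulr0 normr0.
- move=> x _; apply/cvgrPdist_lt => e e0; have [N NP] := uoo x; near=> n.
  have /NP xu : (N <= n)%N by near: n; exact: nbhs_infty_ge.
  by rewrite /F indicE mem_set ?mulr1 ?subrr ?normr0 //= /P /= in_itv.
apply: cvg_trans; apply: near_eq_cvg; apply: nearW => n.
have -> : `[0, u n]%classic = (`[0, +oo[%classic `&` P n : set R).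
  by apply/seteqP; split => x /=; rewrite /P /= !in_itv /= ?andbT; [move=> /andP[]|move=> [-> ->]].
rewrite Rintegral_mkcondr; apply: Rint_eq => x _.
by rewrite /F /patch indicE; case: (_ \in _); rewrite ?mulr1 ?mulr0.
Unshelve. all: by end_near. Qed.

Lemma Cint_trunc (f : R -> R[i]) (u : nat -> R) : Cintegrable `[0, +oo[ f ->
  (forall x, exists N, forall n, (N <= n)%N -> x <= u n) ->
  Ccvg (fun n => Cintegral `[0, u n] f) (Cintegral `[0, +oo[ f).
Proof. by move=> [f1 f2] uoo; split; exact: Rint_trunc. Qed.

End DominatedConvergence.

(** * Rotation of a half-line of integration *)

Section Quadrant.
Variable R : realType.
Local Notation mu := (@lebesgue_measure R).
Implicit Types (z w : R[i]).

Lemma sqrtc_Re_ge0 z : 0 <= Re (sqrtc z).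
Proof. by case: z => a b; rewrite /sqrtc /= sqrtr_ge0. Qed.

Lemma sqrtc_norm z : normc (sqrtc z) ^+ 2 = normc z.
Proof. by rewrite expr2 -normcM -expr2 sqr_sqrtc. Qed.

Lemma sqrtc_quadrant x y : 0 <= x -> 0 <= y ->
  0 <= Im (sqrtc (x +i* y : R[i])) <= Re (sqrtc (x +i* y : R[i])).
Proof.
move=> x0 y0; rewrite /sqrtc /=.
have -> : (if y == 0 then 1 else Num.sg y) = 1.
  by case: eqP => // /eqP yN; rewrite gtr0_sg // lt_def yN.
by rewrite mul1r sqrtr_ge0 ler_wsqrtr // ler_pM2r // lerD2l; lra.
Qed.

Lemma sqrtc_Re2 x y : 0 <= x -> 0 <= y ->
  normc (x +i* y : R[i]) <= 2 * Re (sqrtc (x +i* y : R[i])) ^+ 2.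
Proof.
move=> x0 y0; rewrite -sqrtc_norm normc_sqr.
have /andP[a b] := sqrtc_quadrant x0 y0; nra.
Qed.

Lemma sqrtc_dist z w : 0 < Re (sqrtc z) ->
  normc (sqrtc w - sqrtc z) <= normc (w - z) / Re (sqrtc z).
Proof.
move=> p0; rewrite ler_pdivlMr //.
have -> : w - z = (sqrtc w - sqrtc z) * (sqrtc w + sqrtc z).
  by rewrite -subr_sqr !sqr_sqrtc.
rewrite normcM ler_wpM2l ?normc_ge0 // (le_trans _ (Re_le _)) //.
by rewrite ReD (le_trans _ (ler_norm _)) // lerDr sqrtc_Re_ge0.
Qed.

Lemma sqrtc_holo z : 0 < Re (sqrtc z) -> holo (@sqrtc R) z.
Proof.
move=> p0; set p := Re (sqrtc z).
have S0 : sqrtc z != 0 by apply/eqP => E; move: p0; rewrite E ltxx.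
apply: (@holo_quad _ _ z (2 * sqrtc z)^-1 (1 / (2 * p ^+ 3)) 1) => // h _.
have S1 : sqrtc (z + h) + sqrtc z != 0.
  apply/eqP => /(congr1 (@complex.Re R)); rewrite ReD /= => E.
  by have := sqrtc_Re_ge0 (z + h); move: p0 E; rewrite -/p; lra.
have hE : h = (sqrtc (z + h) - sqrtc z) * (sqrtc (z + h) + sqrtc z).
  by rewrite -subr_sqr !sqr_sqrtc addrC addKr.
have := sqrtc_dist (z + h) p0; rewrite -/p (_ : z + h - z = h); last by rewrite addrC addKr.
set S' := sqrtc (z + h) in S1 hE *; set S := sqrtc z in S0 S1 hE *.
move=> hd.
have -> : S' - S - (2 * S)^-1 * h = (S' - S) ^+ 2 * (-1 / (2 * S)).
  by rewrite {1}hE; field.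
have n2 : normc (2 : R[i]) = 2.
  by rewrite (_ : 2 = (2 : R)%:C) ?normc_R ?ger0_norm // rmorphMn.
have nS : normc (-1 / (2 * S)) = (2 * normc S)^-1.
  by rewrite mulN1r normcN normcV normcM n2.
rewrite normcM nS (_ : normc ((S' - S) ^+ 2) = normc (S' - S) ^+ 2); last by rewrite !expr2 normcM.
have pS : p <= normc S by rewrite (le_trans (ler_norm _)) // Re_le.
have -> : 1 / (2 * p ^+ 3) * normc h ^+ 2 = (normc h / p) ^+ 2 * (2 * p)^-1.
  by field; rewrite gt_eqF.
apply: ler_pM; rewrite ?exprn_ge0 ?normc_ge0 ?invr_ge0 ?mulr_ge0 ?normc_ge0 //.
  by rewrite ler_pXn2r ?nnegrE ?normc_ge0 // (le_trans (normc_ge0 _) hd).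
by rewrite lef_pV2 ?posrE ?mulr_gt0 // ?ler_pM2l // (lt_le_trans p0 pS).
Qed.

Lemma sqrtc_cont0 : Ccont (@sqrtc R) 0.
Proof.
apply/Ccont_normc => e e0; exists (e ^+ 2); first by rewrite exprn_gt0.
move=> w; rewrite sqrtc0 !subr0 -sqrtc_norm ltr_pXn2r ?nnegrE ?normc_ge0 // ltW //.
Qed.

Lemma sqrtc_Re_gt0 x y : 0 <= x -> 0 <= y -> x +i* y != 0 -> 0 < Re (sqrtc (x +i* y : R[i])).
Proof.
move=> x0 y0 z0; rewrite lt_def sqrtc_Re_ge0 andbT; apply/eqP => E.
have := sqrtc_Re2 x0 y0; rewrite E expr0n /= mulr0 => H.
by move: z0; rewrite -normc_eq0 eq_le H normc_ge0.
Qed.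

Lemma sqrtc_cont x y : 0 <= x -> 0 <= y -> Ccont (@sqrtc R) (x +i* y).
Proof.
move=> x0 y0; have [->|z0] := eqVneq (x +i* y) 0; first exact: sqrtc_cont0.
exact/holo_cont/sqrtc_holo/sqrtc_Re_gt0.
Qed.

(** This is exp(-d (1 - 2i) z^(3/2)). In the closed first quadrant sqrt z = p + iq with
    0 <= q <= p, and then Re ((1 - 2i) (p + iq)^3) >= p^3, so the factor decays faster
    than any exponential in |z|. *)
Definition damp (d : R) (z : R[i]) : R[i] :=
  cexp (- d%:C * (1 - 2 * 'i) * (z * sqrtc z)).

Lemma damp_norm d x y : 0 <= d -> 0 <= x -> 0 <= y ->
  normc (damp d (x +i* y)) <= expR (- d * Re (sqrtc (x +i* y : R[i])) ^+ 3).
Proof.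
move=> d0 x0 y0; rewrite /damp normc_cexp ler_expR.
have /andP[] := sqrtc_quadrant x0 y0; have := sqr_sqrtc (x +i* y : R[i]).
move: (sqrtc _) => [p q] /= E q0 qp.
have Ex : x = p * p - q * q by have := congr1 (@complex.Re R) E; rewrite expr2.
have Ey : y = p * q + q * p by have := congr1 (@complex.Im R) E; rewrite expr2.
rewrite Ex Ey [leLHS](_ : _ = - d * (p ^+ 3 + 6 * p ^+ 2 * q - 3 * p * q ^+ 2 - 2 * q ^+ 3)).
  2: by ring.
rewrite !mulNr lerN2 ler_wpM2l //.
have p0 : 0 <= p by lra.
have := mulr_ge0 p0 (mulr_ge0 p0 q0); have := mulr_ge0 p0 (mulr_ge0 q0 (_ : 0 <= p - q)).
have := mulr_ge0 q0 (mulr_ge0 q0 (_ : 0 <= p - q)); have qp' : 0 <= p - q by lra.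
move=> /(_ qp') H1 /(_ qp') H2 H3; nra.
Qed.

Lemma damp_le1 d x y : 0 <= d -> 0 <= x -> 0 <= y -> normc (damp d (x +i* y)) <= 1.
Proof.
move=> d0 x0 y0; apply: le_trans (damp_norm d0 x0 y0) _.
by rewrite expR_le1 mulNr oppr_le0 mulr_ge0 // exprn_ge0 // sqrtc_Re_ge0.
Qed.

Lemma damp_cont d x y : 0 <= x -> 0 <= y -> Ccont (damp d) (x +i* y).
Proof.
move=> x0 y0; apply: cont_comp; last exact/holo_cont/holo_cexp.
apply: contM; first exact/holo_cont/holo_cst.
by apply: contM; [exact/holo_cont/holo_id|exact: sqrtc_cont].
Qed.

Lemma damp_holo d x y : 0 < x -> 0 < y -> holo (damp d) (x +i* y).
Proof.
move=> x0 y0; apply: holo_comp; last exact/holo_cexp.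
apply: holoM; first exact/holo_cst.
apply: holoM; first exact/holo_id.
apply/sqrtc_holo/sqrtc_Re_gt0; rewrite ?ltW //.
by rewrite eq_complex /= gt_eqF.
Qed.

Variables (V : R[i] -> R[i]) (A C : R).
Hypothesis (C0 : 0 <= C).
Hypothesis Vcont : forall x y, 0 <= x -> 0 <= y -> Ccont V (x +i* y).
Hypothesis Vholo : forall x y, 0 < x -> 0 < y -> holo V (x +i* y).
Hypothesis Vgrowth : forall x y, 0 <= x -> 0 <= y -> normc (V (x +i* y)) <= A * expR (C * (x + y)).

Let A0 : 0 <= A.
Proof.
have := Vgrowth (lexx 0) (lexx 0); rewrite addr0 mulr0 expR0 mulr1.
exact: le_trans (normc_ge0 _).
Qed.

Let invn_cvg : ((n.+1%:R)^-1 : R) @[n --> \oo] --> 0.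
Proof. exact: cvg_harmonic. Qed.

(** As V is merely continuous on the boundary of the quadrant, Goursat's theorem is
    applied to its translates by t + it, and then t tends to 0. *)
Lemma bdrect_quadrant (X : R) : 0 <= X -> bdrect V 0 X 0 X = 0.
Proof.
move=> X0.
pose t n : R := (n.+1%:R)^-1.
have t0 n : 0 < t n by rewrite invr_gt0.
have t1 n : t n <= 1 by rewrite invf_le1 // ler1n.
pose Vn n z := V (z + (t n +i* t n)).
have E n x y : (x +i* y) + (t n +i* t n) = (x + t n) +i* (y + t n) by [].
have hV n x y : 0 <= x -> 0 <= y -> holo (Vn n) (x +i* y).
  move=> x0 y0; apply: holo_comp.
    by apply: holoD; [exact: holo_id|exact: holo_cst].
  by rewrite E; apply: Vholo; rewrite ltr_wpDl.
have b0 n : bdrect (Vn n) 0 X 0 X = 0.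
  have := @goursat_size R (Vn n) 0 0 X X X0 X0; rewrite !add0r; apply.
  by move=> x y /andP[x0 _] /andP[y0 _]; exact: hV.
have cX : contrect V 0 X 0 X by move=> x y /andP[? _] /andP[? _]; exact: Vcont.
have cXn n : contrect (Vn n) 0 X 0 X.
  by move=> x y /andP[? _] /andP[? _]; exact/holo_cont/hV.
pose M := A * expR (C * (X + 1 + (X + 1))).
have bn n x y : 0 <= x <= X -> 0 <= y <= X -> normc (Vn n (x +i* y)) <= M.
  move=> /andP[x0 xX] /andP[y0 yX]; rewrite /Vn E.
  have xt : 0 <= x + t n by rewrite addr_ge0 // ltW.
  have yt : 0 <= y + t n by rewrite addr_ge0 // ltW.
  apply: le_trans (Vgrowth xt yt) _.
  rewrite ler_wpM2l // ler_expR ler_wpM2l //; have := t1 n; lra.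
have cvV x y : 0 <= x <= X -> 0 <= y <= X -> Ccvg (fun n => Vn n (x +i* y)) (V (x +i* y)).
  move=> /andP[x0 _] /andP[y0 _]; apply: (Ccvg_comp (g := V)); first exact: Vcont.
  apply/cvgrPdist_lt => e e0.
  have e2 : 0 < e / 2 by rewrite divr_gt0.
  have /cvgrPdist_lt/(_ _ e2)[N _ NP] := invn_cvg.
  exists N => // n Nn.
  have tn : t n < e / 2.
    by have := NP n Nn; rewrite sub0r normrN; exact/le_lt_trans/ler_norm.
  rewrite sub0r normrN ger0_norm ?normc_ge0 //.
  rewrite [X in normc X](_ : _ = t n +i* t n); last by rewrite addrC addKr.
  apply: le_lt_trans (normc_leD _) _; rewrite /= !gtr0_norm //; lra.
have XX : 0 <= X <= X by rewrite X0 lexx.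
have ZX : 0 <= (0 : R) <= X by rewrite lexx X0.
have dct f (F : nat -> R -> R[i]) : (forall n, Cintegrable `[0, X] (F n)) ->
   (forall n x, 0 <= x <= X -> normc (F n x) <= M) ->
   (forall x, 0 <= x <= X -> Ccvg (F^~ x) (f x)) ->
   Ccvg (fun n => Cintegral `[0, X] (F n)) (Cintegral `[0, X] f).
  move=> F1 F2 F3.
  have mF n : Cmeasurable `[0, X] (F n) := Cmeas_itg (F1 n).
  have iM : itg `[0, X] (fun=> M) by apply: itg_cont => x _; exact: cvg_cst.
  apply: (proj2 (@Cint_dct R `[0, X] F f (fun=> M) _ mF iM _ _)) => //.
have : Ccvg (fun n => bdrect (Vn n) 0 X 0 X) (bdrect V 0 X 0 X).
  rewrite /bdrect; apply: CcvgB; [apply: CcvgB; [apply: CcvgD|]|].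
  - apply: dct => [n|n x xX|x xX]; [exact: citg_h (cXn n) _|exact: bn|exact: cvV].
  - apply: CcvgZ; apply: dct => [n|n x xX|x xX]; [exact: citg_v (cXn n) _|exact: bn|exact: cvV].
  - apply: dct => [n|n x xX|x xX]; [exact: citg_h (cXn n) _|exact: bn|exact: cvV].
  - apply: CcvgZ; apply: dct => [n|n x xX|x xX]; [exact: citg_v (cXn n) _|exact: bn|exact: cvV].
move=> H; apply: (Ccvg_unique H).
rewrite (_ : (fun n => _) = fun=> 0); first exact: Ccvg_cst.
by apply: funext => n; rewrite b0.
Qed.

End Quadrant.

Section QuadrantTheorem.
Variable R : realType.
Local Notation mu := (@lebesgue_measure R).

Lemma meas_cont (D : set R) (f : R -> R) : measurable D ->
  (forall x, D x -> {for x, continuous f}) -> measurable_fun D f.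
Proof.
move=> mD cf; apply: subspace_continuous_measurable_fun => //.
by apply: continuous_in_subspaceT => x /set_mem /cf.
Qed.

Lemma Cmeas_cont (D : set R) (f : R -> R[i]) : measurable D ->
  (forall x, D x -> Rcont f x) -> Cmeasurable D f.
Proof. by move=> mD cf; split; apply: meas_cont => // x /cf[]. Qed.

Lemma Cmeas_normc d (T : measurableType d) (D : set T) (f : T -> R[i]) :
  Cmeasurable D f -> measurable_fun D (fun t => normc (f t)).
Proof.
move=> [m1 m2].
rewrite (_ : (fun t => _) = (@Num.sqrt R) \o (fun t => Re (f t) ^+ 2 + Im (f t) ^+ 2)).
  have mS : measurable_fun setT (@Num.sqrt R).
    by apply: continuous_measurable_fun; exact: sqrt_continuous.
  apply: (measurableT_comp mS).
  by apply: measurable_funD; apply: measurable_funX.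
by apply: funext => t /=; case: (f t).
Qed.

Lemma Citg_normc (D : set R) (f : R -> R[i]) : measurable D ->
  Cintegrable D f -> itg D (fun t => normc (f t)).
Proof.
move=> mD fi; have [f1 f2] := fi.
apply: (@itg_dom R _ _ (fun t => `|Re (f t)| + `|Im (f t)|)) => //.
- exact/Cmeas_normc/Cmeas_itg.
- by apply: itgD => //; exact: integrable_norm.
- by move=> t _; rewrite ger0_norm ?normc_ge0 //; exact: normc_leD.
Qed.

(** This bounds the far sides of the square of side 2 n^2, where sqrt z has real part at
    least n: the cubic damping wins against the exponential growth of order n^2. *)
Lemma damped_tail_cvg (A C d : R) : 0 <= A -> 0 <= C -> 0 < d ->
  2 * n%:R ^+ 2 * (A * expR (C * (4 * n%:R ^+ 2) - d * n%:R ^+ 3)) @[n --> \oo] --> 0.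
Proof.
move=> A0 C0 d0; apply/cvgrPdist_le => e e0.
pose N := (Num.truncn (8 * C / d) + Num.truncn (4 * A / (d * e))).+1.
near=> n.
have Nn : (N <= n)%N by near: n; exact: nbhs_infty_ge.
have n0 : 0 < n%:R :> R by rewrite ltr0n (leq_trans _ Nn).
rewrite sub0r normrN ger0_norm; last by rewrite !mulr_ge0 // ?expR_ge0 // exprn_ge0.
have h1 : 8 * C / d < n%:R.
  apply: lt_le_trans (truncnS_gt _) _; rewrite ler_nat; apply: leq_trans Nn.
  by rewrite ltnS leq_addr.
have h2 : 4 * A / (d * e) < n%:R.
  apply: lt_le_trans (truncnS_gt _) _; rewrite ler_nat; apply: leq_trans Nn.
  by rewrite ltnS leq_addl.
move: h1 h2; rewrite !ltr_pdivrMr ?mulr_gt0 // => h1 h2.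
move: n0 h1 h2; move: (n%:R) => m m0 h1 h2.
have E : expR (C * (4 * m ^+ 2) - d * m ^+ 3) <= (d * m ^+ 3 / 2)^-1.
  apply: (@le_trans _ _ (expR (- (d * m ^+ 3 / 2)))).
    rewrite ler_expR; have : 0 <= m ^+ 2 * (m * d - 8 * C).
      by rewrite mulr_ge0 ?exprn_ge0 ?ltW // subr_gt0.
    lra.
  rewrite expRN lef_pV2 ?posrE ?expR_gt0 ?divr_gt0 ?mulr_gt0 ?exprn_gt0 //.
  by apply: le_trans (expR_ge1Dx _); rewrite lerDr.
apply: (@le_trans _ _ (2 * m ^+ 2 * (A * (d * m ^+ 3 / 2)^-1))).
  have m0' := ltW m0.
  by rewrite ler_wpM2l ?mulr_ge0 ?exprn_ge0 // ler_wpM2l.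
have -> : 2 * m ^+ 2 * (A * (d * m ^+ 3 / 2)^-1) = 4 * A / (d * m).
  by field; rewrite !gt_eqF.
rewrite ler_pdivrMr ?mulr_gt0 //; lra.
Unshelve. all: by end_near. Qed.

(** Cauchy's theorem on large squares holds for the damped function without any decay of
    V inside the quadrant; dominated convergence on the two half-lines then removes the
    damping. *)
Lemma quadrant_axes (V : R[i] -> R[i]) (A C : R) : 0 <= C ->
  (forall x y : R, 0 <= x -> 0 <= y -> Ccont V (x +i* y)) ->
  (forall x y : R, 0 < x -> 0 < y -> holo V (x +i* y)) ->
  (forall x y : R, 0 <= x -> 0 <= y -> normc (V (x +i* y)) <= A * expR (C * (x + y))) ->
  Cintegrable `[0, +oo[ (fun t => V (t +i* 0)) ->
  Cintegrable `[0, +oo[ (fun t => V (0 +i* t)) ->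
  Cintegral `[0, +oo[ (fun t => V (t +i* 0)) = 'i * Cintegral `[0, +oo[ (fun t => V (0 +i* t)).
Proof.
move=> C0 cV hV gV ix iy.
have A0 : 0 <= A.
  have := gV _ _ (lexx 0) (lexx 0); rewrite addr0 mulr0 expR0 mulr1.
  exact: le_trans (normc_ge0 _).
pose W d z := V z * damp d z.
have cW d x y : 0 <= x -> 0 <= y -> Ccont (W d) (x +i* y).
  by move=> x0 y0; apply: contM; [exact: cV|exact: damp_cont].
have hW d x y : 0 < x -> 0 < y -> holo (W d) (x +i* y).
  by move=> x0 y0; apply: holoM; [exact: hV|exact: damp_holo].
have WV d x y : 0 <= d -> 0 <= x -> 0 <= y -> normc (W d (x +i* y)) <= normc (V (x +i* y)).
  move=> d0 x0 y0; rewrite normcM -[leRHS]mulr1 ler_wpM2l ?normc_ge0 //.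
  exact: damp_le1.
have gW d x y : 0 <= d -> 0 <= x -> 0 <= y -> normc (W d (x +i* y)) <= A * expR (C * (x + y)).
  by move=> d0 x0 y0; apply: le_trans (WV _ _ _ d0 x0 y0) (gV _ _ x0 y0).
have mWx d : Cmeasurable (`[0, +oo[%classic : set R) (fun t => W d (t +i* 0)).
  by apply: Cmeas_cont => // x; rewrite /= in_itv /= andbT => x0; exact/Rcont_h/cW.
have mWy d : Cmeasurable (`[0, +oo[%classic : set R) (fun t => W d (0 +i* t)).
  by apply: Cmeas_cont => // x; rewrite /= in_itv /= andbT => x0; exact/Rcont_v/cW.
have normi f : Cintegrable `[0, +oo[ f -> itg `[0, +oo[ (fun t : R => normc (f t)).
  exact: Citg_normc.
have iWx d : 0 <= d -> Cintegrable `[0, +oo[ (fun t => W d (t +i* 0)).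
  move=> d0; apply: (@Citg_dom _ _ _ _ _ (mWx d) (normi _ ix)) => // t.
  by rewrite /= in_itv /= andbT => t0; exact: WV.
have iWy d : 0 <= d -> Cintegrable `[0, +oo[ (fun t => W d (0 +i* t)).
  move=> d0; apply: (@Citg_dom _ _ _ _ _ (mWy d) (normi _ iy)) => // t.
  by rewrite /= in_itv /= andbT => t0; exact: WV.
have damped d : 0 < d -> Cintegral `[0, +oo[ (fun t => W d (t +i* 0)) =
    'i * Cintegral `[0, +oo[ (fun t => W d (0 +i* t)).
  move=> d0; have d0' := ltW d0.
  pose X n : R := 2 * n%:R ^+ 2.
  have X0 n : 0 <= X n by rewrite mulr_ge0 // exprn_ge0.
  have Xoo (x : R) : exists N, forall n, (N <= n)%N -> x <= X n.
    exists (Num.truncn x).+1 => n Nn; apply: ltW; apply: lt_le_trans (truncnS_gt _) _.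
    apply: (@le_trans _ _ n%:R); first by rewrite ler_nat.
    have : 1 <= n%:R :> R by rewrite ler1n (leq_trans _ Nn).
    by rewrite /X; nra.
  have far n x y : 0 <= x <= X n -> 0 <= y <= X n -> X n <= x \/ X n <= y ->
      normc (W d (x +i* y)) <= A * expR (C * (4 * n%:R ^+ 2) - d * n%:R ^+ 3).
    move=> /andP[x0 xX] /andP[y0 yX] XX.
    rewrite normcM expRD mulrA; apply: ler_pM; rewrite ?normc_ge0 //.
      apply: le_trans (gV _ _ x0 y0) _; rewrite ler_wpM2l // ler_expR ler_wpM2l //.
      by move: xX yX; rewrite /X; lra.
    apply: le_trans (damp_norm d0' x0 y0) _.
    rewrite ler_expR mulNr lerN2 ler_wpM2l // ler_pXn2r ?nnegrE ?sqrtc_Re_ge0 //.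
    rewrite -(@ler_pXn2r _ 2) ?nnegrE ?sqrtc_Re_ge0 //.
    have := sqrtc_Re2 x0 y0; have := Re_le (x +i* y); have := Im_le (x +i* y).
    rewrite /= !ger0_norm //; move: XX; rewrite /X => -[]; lra.
  have sq n : bdrect (W d) 0 (X n) 0 (X n) = 0.
    exact: (bdrect_quadrant C0 (cW d) (hW d) (fun x y x0 y0 => gW d x y d0' x0 y0) (X0 n)).
  have cr n : contrect (W d) 0 (X n) 0 (X n).
    by move=> x y /andP[? _] /andP[? _]; exact: cW.
  have XX n : 0 <= X n <= X n by rewrite X0 lexx.
  pose b n := 2 * n%:R ^+ 2 * (A * expR (C * (4 * n%:R ^+ 2) - d * n%:R ^+ 3)).
  have top n : normc (Cintegral `[0, X n] (fun x => W d (x +i* X n))) <= b n.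
    rewrite /b mulrC -[2 * _]subr0 -Rint_len //; apply: Cint_norm => //.
    - exact: citg_h (cr n) (XX n).
    - by apply: itg_cont => x _; exact: cvg_cst.
    - by move=> x; rewrite /= in_itv /= => xX; apply: far => //; right.
  have right n : normc ('i * Cintegral `[0, X n] (fun y => W d (X n +i* y))) <= b n.
    rewrite normcM normc_i mul1r /b mulrC -[2 * _]subr0 -Rint_len //; apply: Cint_norm => //.
    - exact: citg_v (cr n) (XX n).
    - by apply: itg_cont => x _; exact: cvg_cst.
    - by move=> x; rewrite /= in_itv /= => xX; apply: far => //; left.
  have := CcvgB (Cint_trunc (iWx d d0') Xoo) (CcvgZ 'i (Cint_trunc (iWy d d0') Xoo)).
  move=> cvI; apply/eqP; rewrite -subr_eq0; apply/eqP; apply: (Ccvg_unique cvI).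
  apply: (@Ccvg_le _ _ _ (fun n => 2 * b n)).
    move=> n; have := sq n; rewrite /bdrect subr0 => E.
    have EE (h r t l : R[i]) : h + r - t - l = 0 -> h - l = t - r.
      by move=> H; apply/eqP; rewrite -subr_eq0; apply/eqP; rewrite -[RHS]H; ring.
    rewrite (EE _ _ _ _ E); apply: le_trans (normcD _ _) _; rewrite normcN.
    by have := top n; have := right n; lra.
  by rewrite -(mulr0 2); apply: cvgMr; exact: damped_tail_cvg.
pose t n : R := (n.+1%:R)^-1.
have t0 n : 0 < t n by rewrite invr_gt0.
have cvW x y : Ccvg (fun n => W (t n) (x +i* y)) (V (x +i* y)).
  rewrite -[V (x +i* y)]mulr1 /W /damp; apply: CcvgZ.
  rewrite -[X in Ccvg _ X](@cexp0 R).
  apply: (Ccvg_comp (g := @cexp R)); first exact/holo_cont/holo_cexp.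
  pose c := normc ((1 - 2 * 'i) * ((x +i* y) * sqrtc (x +i* y)) : R[i]).
  rewrite (_ : (fun n => _) = fun n => t n * c); last first.
    by apply: funext => n; rewrite subr0 -mulrA normcM normcN normc_R gtr0_norm.
  by rewrite -(mul0r c); apply: cvgMl; exact: cvg_harmonic.
have dx : Ccvg (fun n => Cintegral `[0, +oo[ (fun s => W (t n) (s +i* 0)))
    (Cintegral `[0, +oo[ (fun s => V (s +i* 0))).
  apply: (proj2 (@Cint_dct R `[0, +oo[ (fun n s => W (t n) (s +i* 0)) _ _ _ _ (normi _ ix) _ _)) => //.
  by move=> n s; rewrite /= in_itv /= andbT => s0; apply: WV => //; exact: ltW.
have dy : Ccvg (fun n => Cintegral `[0, +oo[ (fun s => W (t n) (0 +i* s)))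
    (Cintegral `[0, +oo[ (fun s => V (0 +i* s))).
  apply: (proj2 (@Cint_dct R `[0, +oo[ (fun n s => W (t n) (0 +i* s)) _ _ _ _ (normi _ iy) _ _)) => //.
  by move=> n s; rewrite /= in_itv /= andbT => s0; apply: WV => //; exact: ltW.
apply: (Ccvg_unique dx).
rewrite (_ : (fun n => _) = fun n => 'i * Cintegral `[0, +oo[ (fun s => W (t n) (0 +i* s))).
  exact: CcvgZ.
by apply: funext => n; exact: damped.
Qed.

End QuadrantTheorem.

(** * Changes of variable and the Cauchy density *)

Section Invariance.
Variable R : realType.
Local Notation mu := (@lebesgue_measure R).

Lemma pushforward_itg (phi : R -> R) (f : R -> R) : measurable_fun setT phi ->
  (forall a b : R, mu (phi @^-1` `]a, b]) = mu `]a, b]) ->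
  measurable_fun setT f -> itg setT (f \o phi) ->
  itg setT f /\ \int[mu]_(x in setT) f x = \int[mu]_(x in setT) f (phi x).
Proof.
move=> mphi muphi mf ifp.
pose m' : {measure set (measurableTypeR R) -> \bar R} :=
  @pushforward _ _ (measurableTypeR R) (measurableTypeR R) R mu phi.
pose m := m' mphi.
have mE : forall A, measurable A -> mu A = m A.
  by apply: lebesgue_measure_unique => _ [[a b] _ <-] /=; rewrite /m /m' /pushforward /= muphi.
have mfE : measurable_fun [set: measurableTypeR R] (EFin \o f) by exact/measurable_EFinP.
have ifm : m.-integrable setT (EFin \o f).
  by apply: (@integrable_pushforward _ _ (measurableTypeR R) (measurableTypeR R) R phi mphi mu setT _ mfE).
have fi : itg setT f.
  apply/integrableP; split; first exact: mfE.
  rewrite (@eq_measure_integral _ (measurableTypeR R) R _ m) //.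
    by have /integrableP[] := ifm.
  by move=> A mA _; exact: mE.
split => //; rewrite /Rintegral; congr fine.
rewrite (@eq_measure_integral _ (measurableTypeR R) R _ m) //.
  exact: (@integral_pushforward _ _ (measurableTypeR R) (measurableTypeR R) R phi mphi mu setT _ mfE).
by move=> A mA _; exact: mE.
Qed.

Lemma itg_translate (f : R -> R) c : itg setT f ->
  itg setT (fun x => f (x + c)) /\ \int[mu]_(x in setT) f (x + c) = \int[mu]_(x in setT) f x.
Proof.
move=> fi; have mf := itg_meas fi.
have msh (d : R) : measurable_fun setT (fun x : R => x + d) by exact: measurable_funD.
have [|||i E] := @pushforward_itg (fun x => x - c) (fun x => f (x + c)) (msh _).
- move=> a b; rewrite (_ : _ @^-1` _ = `]a + c, b + c]%classic); last first.
    by apply/seteqP; split => x /=; rewrite !in_itv /= ltrBrDr lerBlDr.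
  rewrite !(@lebesgue_measure_itv R) /= !lte_fin ltrD2r.
  by case: ifP => // _; congr (_%:E); ring.
- exact: (measurableT_comp mf (msh c)).
- by apply: (itg_eq _ _ fi) => // x _; rewrite /= subrK.
split => //; rewrite E; apply: Rint_eq => x _; by rewrite subrK.
Qed.

Lemma itg_reflect (f : R -> R) : itg setT f ->
  itg setT (fun x => f (- x)) /\ \int[mu]_(x in setT) f (- x) = \int[mu]_(x in setT) f x.
Proof.
move=> fi; have mf := itg_meas fi.
have mop : measurable_fun setT (fun x : R => - x) by exact: measurable_funN.
have [|||i E] := @pushforward_itg (fun x => - x) (fun x => f (- x)) mop.
- move=> a b; rewrite (_ : _ @^-1` _ = `[- b, - a[%classic); last first.
    by apply/seteqP; split => x /=; rewrite !in_itv /= ltrNr lerNl andbC.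
  rewrite !(@lebesgue_measure_itv R) /= !lte_fin ltrN2.
  by case: ifP => // _; congr (_%:E); ring.
- exact: (measurableT_comp mf mop).
- by apply: (itg_eq _ _ fi) => // x _; rewrite /= opprK.
split => //; rewrite E; apply: Rint_eq => x _; by rewrite opprK.
Qed.

Lemma Rint_halves (f : R -> R) : itg setT f ->
  \int[mu]_(x in setT) f x =
  \int[mu]_(x in `[0, +oo[) f x + \int[mu]_(x in `[0, +oo[) f (- x).
Proof.
move=> fi.
have [fi' _] := itg_reflect fi.
have sub g (D : set R) : measurable D -> itg setT g -> itg D g.
  by move=> mD; exact: itg_sub.
have H (g : R -> R) : itg setT g -> \int[mu]_(x in setT) g x =
    \int[mu]_(x in `[0, +oo[) g x + \int[mu]_(x in `]-oo, 0[) g x.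
  move=> gi; rewrite -(@Rintegral_setU _ _ _ mu) //.
  - by congr Rintegral; rewrite setUC -itv_bndbnd_setU // set_itvNyy.
  - by rewrite setUC -itv_bndbnd_setU // set_itvNyy.
  - apply/disj_setPS => x [/=]; rewrite !in_itv /= andbT => x0.
    by rewrite ltNge x0.
rewrite (H _ fi); congr (_ + _).
pose k x := f x * \1_(`]-oo, 0[%classic : set R) x.
have mI : measurable_fun setT (\1_(`]-oo, 0[%classic : set R) : R -> R).
  by apply: measurable_indic; exact: measurable_itv.
have ki : itg setT k.
  apply: (@itg_dom R setT _ (fun x => `|f x|)) => //.
  - by apply: measurable_funM => //; exact: itg_meas.
  - exact: (integrable_norm fi).
  - by move=> x _; rewrite /k indicE; case: (_ \in _); rewrite ?mulr1 ?mulr0 ?normr0.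
have -> : \int[mu]_(x in `]-oo, 0[) f x = \int[mu]_(x in setT) k x.
  rewrite Rintegral_mkcond; apply: Rint_eq => x _; rewrite /k /patch indicE.
  by case: (_ \in _); rewrite ?mulr1 ?mulr0.
have [_ <-] := itg_reflect ki.
have -> : \int[mu]_(x in `[0, +oo[) f (- x) = \int[mu]_(x in `]0, +oo[) f (- x).
  rewrite Rintegral_itv_obnd_cbnd //; exact: sub.
rewrite [RHS]Rintegral_mkcond; apply: Rint_eq => x _; rewrite /k /patch indicE.
have -> : (- x \in (`]-oo, 0[%classic : set R)) = (x \in (`]0, +oo[%classic : set R)).
  by apply/idP/idP => /set_mem /=; rewrite in_itv /= => h; apply/mem_set => /=;
    rewrite in_itv /= ?andbT; lra.
by case: (_ \in _); rewrite ?mulr1 ?mulr0.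
Qed.

Lemma Cint_halves (f : R -> R[i]) : Cintegrable setT f ->
  Cintegral setT f = Cintegral `[0, +oo[ f + Cintegral `[0, +oo[ (fun x => f (- x)).
Proof. by move=> [f1 f2]; apply: eqC; rewrite ?ReD ?ImD /= Rint_halves. Qed.

Lemma Cint_reflect (f : R -> R[i]) : Cintegrable setT f ->
  Cintegrable setT (fun x => f (- x)) /\
  Cintegral setT (fun x => f (- x)) = Cintegral setT f.
Proof.
move=> [/itg_reflect[i1 e1] /itg_reflect[i2 e2]]; split => //.
by apply: eqC => /=; rewrite ?e1 ?e2.
Qed.

Lemma Cint_translate (f : R -> R[i]) c : Cintegrable setT f ->
  Cintegrable setT (fun x => f (x + c)) /\
  Cintegral setT (fun x => f (x + c)) = Cintegral setT f.
Proof.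
move=> [/(itg_translate c)[i1 e1] /(itg_translate c)[i2 e2]]; split => //.
by apply: eqC => /=; rewrite ?e1 ?e2.
Qed.

Lemma Rint_eq_except (p : R) (D : set R) (f g : R -> R) : measurable D -> itg D f -> itg D g ->
  (forall x, D x -> x != p -> f x = g x) ->
  \int[mu]_(x in D) f x = \int[mu]_(x in D) g x.
Proof.
move=> mD fi gi fg; rewrite /Rintegral; congr fine.
apply: (@ae_eq_integral _ (measurableTypeR R) R mu D) => //.
- exact: (measurable_int mu fi).
- exact: (measurable_int mu gi).
exists [set p]; split; [exact: measurable_set1|exact: lebesgue_measure_set1|].
move=> x /= /not_implyP[Dx /= h]; apply: contrapT => /eqP xp; apply: h.
by rewrite fg.
Qed.

Lemma Cint_eq_except (p : R) (D : set R) (f g : R -> R[i]) : measurable D ->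
  Cintegrable D f -> Cintegrable D g ->
  (forall x, D x -> x != p -> f x = g x) -> Cintegral D f = Cintegral D g.
Proof.
move=> mD [f1 f2] [g1 g2] fg; apply: eqC; apply: (@Rint_eq_except p) => // x Dx xp.
  by rewrite fg.
by rewrite fg.
Qed.

Definition cauchyd (t : R) : R := (1 + t ^+ 2)^-1.

Lemma cauchyd_gt0 t : 0 < cauchyd t.
Proof. by rewrite invr_gt0 ltr_pwDl // sqr_ge0. Qed.

Lemma cauchyd_cont : continuous cauchyd.
Proof. exact: continuous_oneDsqrV. Qed.

Lemma cauchyd_meas D : measurable D -> measurable_fun D cauchyd.
Proof. by move=> mD; apply: meas_cont => // x _; exact: cauchyd_cont. Qed.

Lemma itg_cauchyd_half : itg `[0, +oo[ cauchyd.
Proof.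
apply/integrableP; split.
  by apply/(@measurable_EFinP _ (measurableTypeR R)); exact: cauchyd_meas.
rewrite (_ : (\int[mu]_(x in _) _)%E = (pi / 2)%:E); first exact: ltry.
rewrite -integral0y_oneDsqr; apply: eq_integral => x _.
by rewrite /= ger0_norm // ltW // cauchyd_gt0.
Qed.

Lemma integral_cauchyd : itg setT cauchyd /\ \int[mu]_(x in setT) cauchyd x = pi.
Proof.
have ci : itg setT cauchyd.
  apply/integrableP; split.
    by apply/(@measurable_EFinP _ (measurableTypeR R)); exact: cauchyd_meas.
  rewrite (_ : (\int[mu]_(x in setT) _)%E = (\int[mu]_x (cauchyd x)%:E)%E); last first.
    by apply: eq_integral => x _; rewrite /= ger0_norm // ltW // cauchyd_gt0.
  rewrite ge0_symfun_integralT.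
  - rewrite -set_itvcy integral0y_oneDsqr; exact: ltry.
  - by move=> x; rewrite ltW // cauchyd_gt0.
  - exact: cauchyd_cont.
  - by move=> x; rewrite /cauchyd /= sqrrN.
split => //; rewrite Rint_halves //.
have -> : \int[mu]_(x in `[0, +oo[) cauchyd (- x) = \int[mu]_(x in `[0, +oo[) cauchyd x.
  by apply: Rint_eq => x _; rewrite /cauchyd sqrrN.
have -> : \int[mu]_(x in `[0, +oo[) cauchyd x = pi / 2.
  by rewrite /Rintegral integral0y_oneDsqr.
by field.
Qed.

End Invariance.

(** * The Dirichlet kernel as an entire function *)

#[local] Arguments pi : simpl never.

Section SincKernel.
Variable R : realType.
Local Notation mu := (@lebesgue_measure R).
Implicit Types (z w h : R[i]).

Lemma FTC_line (F f : R -> R) (a b : R) : a <= b -> (forall t : R, is_derive t (1 : R) F (f t)) ->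
  continuous f -> \int[mu]_(t in `[a, b]) f t = F b - F a.
Proof.
rewrite le_eqVlt => /predU1P[<-|ab] dF cf; first by rewrite set_itv1 Rintegral_set1 subrr.
have cF : continuous F.
  by move=> t; apply: differentiable_continuous; apply/derivable1_diffP; have := dF t => -[].
rewrite /Rintegral (@continuous_FTC2 _ f F a b ab) //.
- by apply: continuous_in_subspaceT => x _; exact: cf.
- split.
  + by move=> x _; have := dF x => -[].
  + by apply: cvg_at_right_filter; exact: cF.
  + by apply: cvg_at_left_filter; exact: cF.
- by move=> x _; rewrite derive1E; have := dF x => -[].
Qed.

Lemma cexp_line_cont (l : R[i]) (t : R) : Rcont (fun u => cexp (u%:C * l)) t.
Proof.
have H := @Ccont_Rcont R (@cexp R) 0 l t.
rewrite (_ : (fun u => _) = fun u : R => cexp (0 + u%:C * l)).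
  by apply: H; exact/holo_cont/holo_cexp.
by apply: funext => u; rewrite add0r.
Qed.

Lemma cexp_line_citg (l : R[i]) (a b : R) : Cintegrable `[a, b] (fun t => cexp (t%:C * l)).
Proof. by apply: Citg_cont => x _; exact: cexp_line_cont. Qed.

Lemma Cint_cexp (l : R[i]) (a b : R) : a <= b ->
  l * Cintegral `[a, b] (fun t => cexp (t%:C * l)) = cexp (b%:C * l) - cexp (a%:C * l).
Proof.
move=> ab; have ci := cexp_line_citg l a b.
rewrite -CintZ //.
have c1 := cexp_line_cont l.
case: l ci c1 => p q ci c1.
have E1 t : Re (cexp (t%:C * (p +i* q))) = expR (t * p) * cos (t * q).
  by rewrite /cexp /= !mul0r subr0 addr0.
have E2 t : Im (cexp (t%:C * (p +i* q))) = expR (t * p) * sin (t * q).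
  by rewrite /cexp /= !mul0r subr0 addr0.
have d1 (t : R) : is_derive t (1 : R) (fun t => Re (cexp (t%:C * (p +i* q))))
    (Re ((p +i* q) * cexp (t%:C * (p +i* q)))).
  rewrite (_ : (fun t => Re _) = fun t => expR (t * p) * cos (t * q)); last exact: funext.
  by rewrite ReM E1 E2 /=; apply: is_derive_eq; rewrite /GRing.scale /=; ring.
have d2 (t : R) : is_derive t (1 : R) (fun t => Im (cexp (t%:C * (p +i* q))))
    (Im ((p +i* q) * cexp (t%:C * (p +i* q)))).
  rewrite (_ : (fun t => Im _) = fun t => expR (t * p) * sin (t * q)); last exact: funext.
  by rewrite ImM E1 E2 /=; apply: is_derive_eq; rewrite /GRing.scale /=; ring.
apply: eqC; rewrite ?ReD ?ImD ?ReN ?ImN.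
  apply: (FTC_line ab d1) => t; have [h1 h2] := c1 t.
  have -> : (fun t => Re ((p +i* q) * cexp (t%:C * (p +i* q)))) =
    fun t => p * Re (cexp (t%:C * (p +i* q))) - q * Im (cexp (t%:C * (p +i* q))).
    by apply: funext => u; rewrite ReM.
  by apply: cvgB; apply: cvgMr.
apply: (FTC_line ab d2) => t; have [h1 h2] := c1 t.
have -> : (fun t => Im ((p +i* q) * cexp (t%:C * (p +i* q)))) =
    fun t => p * Im (cexp (t%:C * (p +i* q))) + q * Re (cexp (t%:C * (p +i* q))).
  by apply: funext => u; rewrite ImM.
by apply: cvgD; apply: cvgMr.
Qed.

(** This is sin (s z) / (pi z), continued to z = 0. *)
Definition sinc (s : R) z : R[i] :=
  if z == 0 then (s / pi)%:C
  else (cexp (s%:C * ('i * z)) - cexp (- s%:C * ('i * z))) / (2 * 'i * pi%:C * z).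

Let pi0 : (pi : R) != 0. Proof. by rewrite gt_eqF // pi_gt0. Qed.
Let piC0 : (pi%:C : R[i]) != 0. Proof. by rewrite eq_complex /= gt_eqF // pi_gt0. Qed.
Let i0 : ('i : R[i]) != 0. Proof. by rewrite eq_complex /= oner_eq0 andbF. Qed.

(* replaces pi by a variable, since field would try to evaluate it *)
Ltac genpi := have := piC0; have := pi0; move: (pi : R) => P P0 PC0.

(** The Fourier representation: the spectrum of sinc s is the interval [-s, s]. *)
Lemma sinc_integral s z : 0 <= s ->
  sinc s z = (2 * pi%:C)^-1 * Cintegral `[- s, s] (fun t => cexp (t%:C * ('i * z))).
Proof.
move=> s0; have ss : - s <= s by lra.
rewrite /sinc; case: eqVneq => [->|z0].
  rewrite (_ : Cintegral _ _ = Cintegral `[- s, s] (fun=> 1)).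
    rewrite Cint_cst // mulr1 opprK; genpi; rewrite rmorphM /= fmorphV /= rmorphD /=.
    by field.
  by apply: Cint_eq => t _; rewrite !mulr0 cexp0.
have := Cint_cexp ('i * z) ss; rewrite -rmorphN /= => <-.
by genpi; field; rewrite PC0 i0 z0.
Qed.

Lemma cexp_line_norm (t s : R) z : - s <= t <= s ->
  normc (cexp (t%:C * ('i * z))) <= expR (s * `|Im z|).
Proof.
move=> /andP[t1 t2]; rewrite normc_cexp ler_expR; case: z => a b /=.
rewrite !(mul0r, mul1r, sub0r, subr0, add0r, addr0).
apply: le_trans (ler_norm _) _; rewrite normrM normrN ler_wpM2r //.
by rewrite ler_norml t1.
Qed.

Lemma sinc_bound s z : 0 <= s -> normc (sinc s z) <= s / pi * expR (s * `|Im z|).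
Proof.
move=> s0; have ss : - s <= s by lra.
rewrite sinc_integral // normcM normcV normcM normc_R ger0_norm ?pi_ge0 //.
have -> : normc (2 : R[i]) = 2.
  by rewrite (_ : 2 = (2 : R)%:C) ?normc_R ?ger0_norm // rmorphMn.
have -> : s / pi * expR (s * `|Im z|) = (2 * pi)^-1 * (expR (s * `|Im z|) * (s - - s)).
  by genpi; field.
rewrite ler_wpM2l ?invr_ge0 ?mulr_ge0 ?pi_ge0 // -Rint_len //.
apply: Cint_norm => //; first exact: cexp_line_citg.
  by apply: itg_cont => x _; exact: cvg_cst.
by move=> t; rewrite /= in_itv; exact: cexp_line_norm.
Qed.

Lemma sinc_boundM s z : 0 <= s -> normc z * normc (sinc s z) <= expR (s * `|Im z|) / pi.
Proof.
move=> s0; have ss : - s <= s by lra.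
have [->|z0] := eqVneq z 0.
  by rewrite normc_0 mul0r divr_ge0 ?expR_ge0 ?pi_ge0.
rewrite -normcM.
have -> : z * sinc s z = (2 * 'i * pi%:C)^-1 * (cexp (s%:C * ('i * z)) - cexp (- s%:C * ('i * z))).
  by rewrite /sinc (negbTE z0); genpi; field; rewrite PC0 i0 z0.
rewrite normcM normcV !normcM normc_i mulr1 normc_R ger0_norm ?pi_ge0 //.
have -> : normc (2 : R[i]) = 2.
  by rewrite (_ : 2 = (2 : R)%:C) ?normc_R ?ger0_norm // rmorphMn.
have -> : expR (s * `|Im z|) / pi = (2 * pi)^-1 * (expR (s * `|Im z|) + expR (s * `|Im z|)).
  by genpi; field.
rewrite ler_wpM2l ?invr_ge0 ?mulr_ge0 ?pi_ge0 //.
apply: le_trans (normcD _ _) _; rewrite normcN; apply: lerD.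
  by apply: cexp_line_norm; rewrite ss lexx.
by rewrite -rmorphN; apply: cexp_line_norm; rewrite ss lexx.
Qed.

(** Boundedness and decay of order 1/|z| in one estimate, which gives square
    integrability along real lines. *)
Lemma sinc_decay s z : 0 <= s ->
  (1 + normc z) * normc (sinc s z) <= (1 + s) / pi * expR (s * `|Im z|).
Proof.
move=> s0; rewrite mulrDl mul1r.
have := sinc_bound z s0; have := sinc_boundM z s0; lra.
Qed.

Lemma sincN s z : sinc s (- z) = sinc s z.
Proof.
rewrite /sinc oppr_eq0; case: eqVneq => // z0.
by rewrite !mulrN !mulNr opprK; genpi; field; rewrite PC0 i0 z0.
Qed.

Lemma sinc_conj s z : 0 <= s -> (sinc s z)^* = sinc s z^*.
Proof.
move=> s0; have ss : - s <= s by lra.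
rewrite -(sincN s z^*) /sinc oppr_eq0 conjc_eq0; case: eqVneq => [|z0].
  by rewrite conjc_real.
have zc : z^* != 0 by rewrite conjc_eq0.
have cM (u v : R[i]) : conjc (u * v) = conjc u * conjc v by exact: rmorphM.
have cB (u v : R[i]) : conjc (u - v) = conjc u - conjc v by exact: rmorphB.
have cN (u : R[i]) : conjc (- u) = - conjc u by exact: rmorphN.
have ci : ('i : R[i])^* = - 'i by apply: eqC; rewrite /= ?oppr0.
have c2 : (2 : R[i])^* = 2 by rewrite conjc_nat.
rewrite cM cB !cexp_conj conjc_inv !(cM, cN, conjc_real, ci, c2).
rewrite !(mulrN, mulNr, opprK).
by genpi; field; rewrite PC0 i0 zc.
Qed.

Lemma sinc_real s (x y : R) : sinc s (x%:C - y%:C) = (dirichlet_kernel s x y)%:C.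
Proof.
rewrite /sinc /dirichlet_kernel -rmorphB /=.
have -> : ((x - y)%:C == 0 :> R[i]) = (x == y).
  by rewrite -[RHS]subr_eq0 eq_complex /= eqxx andbT.
case: eqVneq => // xy; have xy0 : x - y != 0 by rewrite subr_eq0.
have xyC : ((x - y)%:C : R[i]) != 0 by rewrite eq_complex /= eqxx andbT.
move: (x - y) xy0 xyC => u u0 uC.
have -> : cexp (s%:C * ('i * u%:C)) - cexp (- s%:C * ('i * u%:C)) = 2 * 'i * (sin (s * u))%:C.
  rewrite -rmorphN /=; apply: eqC; rewrite /cexp /= !(mul0r, mulr0, mul1r, mulr1, addr0, subr0, add0r, sub0r, oppr0, expR0, mulNr, cosN, sinN, opprK); first by rewrite subrr.
  by ring.
by genpi; rewrite fmorph_div rmorphM /=; field; rewrite uC PC0 i0.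
Qed.

(** The derivative of sinc s, obtained by differentiating the Fourier representation. *)
Definition sinc' (s : R) z : R[i] :=
  (2 * pi%:C)^-1 * Cintegral `[- s, s] (fun t => t%:C * 'i * cexp (t%:C * ('i * z))).

Let cont_tcexp z (t : R) : Rcont (fun t => t%:C * 'i * cexp (t%:C * ('i * z))) t.
Proof.
have [h1 h2] := cexp_line_cont ('i * z) t.
split.
  rewrite (_ : (fun u => _) = fun u => - u * Im (cexp (u%:C * ('i * z)))); last first.
    by apply: funext => u; case: (cexp _) => p q /=; ring.
  by apply: cvgM => //; apply: cvgN; exact: cvg_id.
rewrite (_ : (fun u => _) = fun u => u * Re (cexp (u%:C * ('i * z)))); last first.
  by apply: funext => u; case: (cexp _) => p q /=; ring.
by apply: cvgM => //; exact: cvg_id.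
Qed.

(** Taylor's formula under the Fourier integral; the restriction on h keeps all
    increments of the exponent below 1/2. *)
Lemma sinc_quad s z h : 0 < s -> normc h <= (2 * s)^-1 ->
  normc (sinc s (z + h) - sinc s z - sinc' s z * h) <=
    10 * s ^+ 3 / pi * expR (s * `|Im z|) * normc h ^+ 2.
Proof.
move=> s0 hh; have s0' := ltW s0; have ss : - s <= s by lra.
pose E w t := cexp (t%:C * ('i * w)) : R[i].
have c1 w : Cintegrable `[- s, s] (E w) by exact: cexp_line_citg.
have c2 : Cintegrable `[- s, s] (fun t => t%:C * 'i * E z t).
  by apply: Citg_cont => t _; exact: cont_tcexp.
have c3 : Cintegrable `[- s, s] (fun t => h * (t%:C * 'i * E z t)) by exact: CitgZ.
have -> : sinc s (z + h) - sinc s z - sinc' s z * h = (2 * pi%:C)^-1 *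
  Cintegral `[- s, s] (fun t => E (z + h) t - E z t - h * (t%:C * 'i * E z t)).
  rewrite CintB //; last exact: CitgB.
  rewrite CintB // CintZ // !sinc_integral // /sinc' /E; ring.
rewrite normcM normcV normcM normc_R ger0_norm ?pi_ge0 //.
have -> : normc (2 : R[i]) = 2.
  by rewrite (_ : 2 = (2 : R)%:C) ?normc_R ?ger0_norm // rmorphMn.
pose M := 10 * expR (s * `|Im z|) * (s * normc h) ^+ 2.
have -> : 10 * s ^+ 3 / pi * expR (s * `|Im z|) * normc h ^+ 2 =
   (2 * pi)^-1 * (M * (s - - s)) by rewrite /M; genpi; field.
rewrite ler_wpM2l ?invr_ge0 ?mulr_ge0 ?pi_ge0 // -Rint_len //.
apply: Cint_norm => //; first by apply: CitgB => //; exact: CitgB.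
  by apply: itg_cont => x _; exact: cvg_cst.
move=> t; rewrite /= in_itv /= => ts; rewrite /E.
have th : normc (t%:C * ('i * h)) <= s * normc h.
  by rewrite !normcM normc_i mul1r normc_R ler_wpM2r ?normc_ge0 // ler_norml.
have sh : s * normc h <= 1 / 2.
  apply: (@le_trans _ _ (s * (2 * s)^-1)); first by rewrite ler_pM2l.
  by rewrite le_eqVlt; apply/orP; left; apply/eqP; field; rewrite gt_eqF.
have H := @cexp_quad R (t%:C * ('i * z)) (t%:C * ('i * h)) (le_trans th sh).
have -> : t%:C * ('i * (z + h)) = t%:C * ('i * z) + t%:C * ('i * h) by ring.
have -> : h * (t%:C * 'i * cexp (t%:C * ('i * z))) = cexp (t%:C * ('i * z)) * (t%:C * ('i * h)) by ring.
apply: le_trans H _; rewrite /M; apply: ler_pM.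
- by rewrite mulr_ge0 // expR_ge0.
- by rewrite exprn_ge0 // normc_ge0.
- by rewrite ler_wpM2l // -normc_cexp; exact: cexp_line_norm.
- by rewrite ler_pXn2r ?nnegrE ?normc_ge0 // ?mulr_ge0 ?normc_ge0 // (le_trans (normc_ge0 _) th).
Qed.

Lemma sinc'_bound s z : 0 <= s -> normc (sinc' s z) <= s ^+ 2 / pi * expR (s * `|Im z|).
Proof.
move=> s0; have ss : - s <= s by lra.
rewrite /sinc' normcM normcV normcM normc_R ger0_norm ?pi_ge0 //.
have -> : normc (2 : R[i]) = 2.
  by rewrite (_ : 2 = (2 : R)%:C) ?normc_R ?ger0_norm // rmorphMn.
have -> : s ^+ 2 / pi * expR (s * `|Im z|) = (2 * pi)^-1 * (s * expR (s * `|Im z|) * (s - - s)).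
  by genpi; field.
rewrite ler_wpM2l ?invr_ge0 ?mulr_ge0 ?pi_ge0 // -Rint_len //.
apply: Cint_norm => //.
- by apply: Citg_cont => t _; exact: cont_tcexp.
- by apply: itg_cont => x _; exact: cvg_cst.
- move=> t tI; have ts : - s <= t <= s by move: tI; rewrite /= in_itv.
  rewrite !normcM normc_i mulr1 normc_R.
  apply: ler_pM; rewrite ?normc_ge0 //; first by rewrite ler_norml.
  exact: cexp_line_norm.
Qed.

Lemma sinc_holo s z : 0 < s -> holo (sinc s) z.
Proof.
move=> s0; apply: (@holo_quad _ _ z (sinc' s z)
  (10 * s ^+ 3 / pi * expR (s * `|Im z|)) (2 * s)^-1).
  by rewrite invr_gt0 mulr_gt0.
by move=> h hh; apply: sinc_quad => //; exact: ltW.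
Qed.

Lemma cexp_imag_dist (u : R) : normc (cexp (0 +i* u) - 1) <= 2 * `|u|.
Proof.
apply: le_trans (normc_leD _) _; rewrite /cexp /= expR0 !mul1r subr0.
have c1 : `|cos u - 1| <= `|u|.
  have [c _] := @MVT_norm R cos (fun t => - sin t) u (fun t => is_derive_cos t).
  by rewrite cos0 => ->; rewrite normrM normrN ler_piMl // sin_max.
have c2 := sin_le u; lra.
Qed.

End SincKernel.

(** * A vanishing integral in the upper half-plane *)

Section HalfPlane.
Variable R : realType.
Local Notation mu := (@lebesgue_measure R).
Implicit Types (z w : R[i]).

(** Two rotations by a right angle turn the positive half-line into the negative one
    with the opposite sign. *)
Lemma halfplane_axis (V : R[i] -> R[i]) (A C : R) : 0 <= C ->
  (forall x y : R, 0 <= y -> Ccont V (x +i* y)) ->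
  (forall x y : R, x != 0 -> 0 < y -> holo V (x +i* y)) ->
  (forall x y : R, 0 <= y -> normc (V (x +i* y)) <= A * expR (C * (`|x| + y))) ->
  Cintegrable setT (fun t => V (t +i* 0)) ->
  Cintegrable `[0, +oo[ (fun t => V (0 +i* t)) ->
  Cintegral setT (fun t => V (t +i* 0)) = 0.
Proof.
move=> C0 cV hV gV ix iy.
have rot (x y : R) : 'i * (x +i* y) = (- y) +i* x by apply: eqC; rewrite /=; ring.
have [ixr _] := Cint_reflect ix.
have sub (f : R -> R[i]) : Cintegrable setT f -> Cintegrable `[0, +oo[ f.
  by move=> [f1 f2]; split; [apply: itg_sub f1|apply: itg_sub f2].
have E1 : Cintegral `[0, +oo[ (fun t => V (t +i* 0)) = 'i * Cintegral `[0, +oo[ (fun t => V (0 +i* t)).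
  apply: (@quadrant_axes R V A C C0 _ _ _ (sub _ ix) iy) => [x y _|x y x0 y0|x y x0 y0].
  - exact: cV.
  - by apply: hV; rewrite ?gt_eqF.
  - by rewrite -{2}(ger0_norm x0); exact: gV.
have E2 : Cintegral `[0, +oo[ (fun t => V (0 +i* t)) = 'i * Cintegral `[0, +oo[ (fun t => V ((- t) +i* 0)).
  have H : (fun t : R => V (0 +i* t)) = fun t => (V \o ( *%R 'i)) (t +i* 0).
    by apply: funext => t /=; rewrite rot oppr0.
  have H' : (fun t : R => V ((- t) +i* 0)) = fun t => (V \o ( *%R 'i)) (0 +i* t).
    by apply: funext => t /=; rewrite rot.
  have hm z : holo ( *%R 'i) z by apply: holoM; [exact: holo_cst|exact: holo_id].
  rewrite H H'; apply: (@quadrant_axes R _ A C C0).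
  - by move=> x y x0 y0; apply: cont_comp; [exact/holo_cont/hm|rewrite rot; exact: cV].
  - move=> x y x0 y0; apply: holo_comp; [exact: hm|rewrite rot; apply: hV => //].
    by rewrite oppr_eq0 gt_eqF.
  - move=> x y x0 y0; rewrite /comp rot; apply: le_trans (gV _ _ x0) _.
    by rewrite normrN (ger0_norm y0) addrC.
  - by rewrite -H.
  - by rewrite -H'; exact: sub.
rewrite Cint_halves // E1 E2 mulrA -expr2 sqr_i mulN1r addNr //.
Qed.

Lemma holo_local (g h : R[i] -> R[i]) z (d : R) : 0 < d ->
  (forall w, normc (w - z) < d -> g w = h w) -> holo h z -> holo g z.
Proof.
move=> d0 gh; apply: near_eq_derivable.
apply: (iffRL (@nbhs_normP R[i] (R[i])^o z _)); exists d%:C; first by rewrite /= ltcR.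
by move=> w /=; rewrite /ball_ /= ltcR normcB => /gh ->.
Qed.

Section UpperVanish.
Variables (f : R[i] -> R[i]) (s' c A y : R).
Hypothesis f_entire : forall w, holo f w.
Hypothesis f_growth : forall w, normc (f w) <= A * expR (c * normc w).
Hypothesis c0 : 0 <= c.
Hypothesis cs' : c < s'.
Hypothesis f_L2 : itg setT (fun t : R => normc (f t%:C) ^+ 2).

Let z : R[i] := 0 +i* y.
Let P (k : R[i]) : R[i] := f k * cexp ('i * s'%:C * (k - z)) - f z * (z + 'i) / (k + 'i).

Let ki0 (k : R[i]) : 0 <= Im k -> k + 'i != 0.
Proof.
move=> k0; apply/eqP => /(congr1 (@complex.Im R)); case: k k0 => a b /= b0 /eqP.
by rewrite gt_eqF // ltr_wpDl.
Qed.

Let P_holo (k : R[i]) : 0 <= Im k -> holo P k.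
Proof.
move=> k0; apply: holoB; apply: holoM => //.
- apply: holo_comp; last exact: holo_cexp.
  apply: holoM; first exact: holo_cst.
  by apply: holoB; [exact: holo_id|exact: holo_cst].
- exact: holo_cst.
- apply: holoV; first exact: ki0.
  by apply: holoD; [exact: holo_id|exact: holo_cst].
Qed.

(* The value of U at z matters only when z lies in the closed half-plane; otherwise
   any l will do. *)
Let l_ex : exists l : R[i], 0 <= y -> forall e : R, 0 < e -> exists2 d : R, 0 < d &
    forall h, normc h < d -> normc (P (z + h) - P z - l * h) <= e * normc h.
Proof.
have [y0|y0] := leP 0 y; last by exists 0.
have [l lP] := holo_eps (@P_holo z y0).
by exists l.
Qed.
Let l := sval (cid l_ex).
Let lP : 0 <= y -> forall e : R, 0 < e -> exists2 d : R, 0 < d &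
    forall h, normc h < d -> normc (P (z + h) - P z - l * h) <= e * normc h.
Proof. exact: svalP (cid l_ex). Qed.

Let Pz : 0 <= y -> P z = 0.
Proof.
by move=> y0; rewrite /P subrr mulr0 cexp0 mulr1 mulfK ?subrr // ki0.
Qed.

Let U (k : R[i]) : R[i] := if k == z then l else P k / (k - z).

Let U_off (k : R[i]) : k != z -> exists2 d : R, 0 < d &
  forall w, normc (w - k) < d -> U w = P w / (w - z).
Proof.
move=> kz; exists (normc (k - z)); first by rewrite normc_gt0 subr_eq0.
move=> w wk; rewrite /U; case: eqVneq => // wz.
by move: wk; rewrite wz normcB ltxx.
Qed.

Let U_holo (k : R[i]) : 0 <= Im k -> k != z -> holo U k.
Proof.
move=> k0 kz; have [d d0 dP] := U_off kz.
apply: (holo_local d0 dP); apply: holoM; first exact: P_holo.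
apply: holoV; first by rewrite subr_eq0.
by apply: holoB; [exact: holo_id|exact: holo_cst].
Qed.

Let U_cont (k : R[i]) : 0 <= Im k -> Ccont U k.
Proof.
move=> k0; have [kz|kz] := eqVneq k z; last exact/holo_cont/U_holo.
have y0 : 0 <= y by move: k0; rewrite kz.
rewrite kz; apply/Ccont_normc => e e0.
have e2 : 0 < e / 2 by rewrite divr_gt0.
have [d d0 dP] := lP y0 e2.
exists d => // w wz; rewrite {2}/U eqxx /U; case: eqVneq => [_|wz0].
  by rewrite subrr normc_0.
have h0 : w - z != 0 by rewrite subr_eq0.
have := dP (w - z) wz; rewrite (_ : z + (w - z) = w); last by rewrite addrC subrK.
rewrite Pz // subr0 => H.
have -> : P w / (w - z) - l = (P w - l * (w - z)) / (w - z) by field.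
rewrite normcM normcV ltr_pdivrMr ?normc_gt0 //.
by apply: le_lt_trans H _; rewrite ltr_pM2r ?normc_gt0 //; lra.
Qed.

Let U_near : exists d K : R, [/\ 0 < d, 0 <= K &
  forall k : R[i], 0 <= Im k -> normc (k - z) < d -> normc (U k) <= K].
Proof.
have [y0|y0] := leP 0 y.
  have /Ccont_normc/(_ 1 ltr01)[d d0 dP] := @U_cont z y0.
  exists d, (1 + normc (U z)); split => //; first by rewrite addr_ge0 ?normc_ge0.
  move=> k _ /dP H; rewrite -(subrK (U z) (U k)); apply: le_trans (normcD _ _) _.
  by rewrite lerD2r ltW.
exists (- y), 0; split => //; first by rewrite oppr_gt0.
move=> k k0; rewrite ltNge => /negP[]; apply: le_trans (Im_le _).
by rewrite ImD ImN /= (le_trans _ (ler_norm _)) // lerDr.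
Qed.

Let U_bound : exists2 B : R, 0 <= B & forall k : R[i], 0 <= Im k ->
  normc (U k) <= B * (normc (f k) * expR (- s' * Im k) / (1 + normc k) + (1 + normc k) ^- 2).
Proof.
have [d [K [d0 K0 near_z]]] := U_near.
pose C1 := (1 + normc z) / d + 1; pose C2 := 2 * normc (f z) * normc (z + 'i).
have nz := normc_ge0 z.
have C10 : 0 <= C1 by rewrite addr_ge0 // divr_ge0 ?addr_ge0 // ltW.
have C20 : 0 <= C2 by rewrite !mulr_ge0 // normc_ge0.
pose B3 := K * (1 + normc z + d) ^+ 2.
have B30 : 0 <= B3 by rewrite mulr_ge0 // exprn_ge0 // !addr_ge0 // ltW.
exists (C1 * expR (s' * y) + C1 * C2 + B3).
  by rewrite !addr_ge0 // mulr_ge0 // expR_ge0.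
move=> k k0; set r := normc k.
have r0 : 0 <= r by exact: normc_ge0.
have r1 : 0 < 1 + r by rewrite ltr_pwDl.
set F := normc (f k) * expR (- s' * Im k) / (1 + r).
have F0 : 0 <= F by rewrite divr_ge0 ?(ltW r1) // mulr_ge0 ?normc_ge0 // expR_ge0.
have G0 : 0 <= (1 + r) ^- 2 by rewrite invr_ge0 exprn_ge0 // ltW.
have rz : r <= normc z + normc (k - z).
  by rewrite addrC; have := normcD (k - z) z; rewrite subrK.
have [kd|kd] := ltP (normc (k - z)) d.
  apply: le_trans (near_z k k0 kd) _.
  apply: (@le_trans _ _ (B3 * (1 + r) ^- 2)).
    rewrite /B3 -mulrA ler_peMr // ler_pdivlMr ?exprn_gt0 // mul1r.
    rewrite ler_pXn2r ?nnegrE ?(ltW r1) //; [lra|rewrite !addr_ge0 // ltW //].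
  rewrite mulrDr; apply: (@le_trans _ _ ((C1 * expR (s' * y) + C1 * C2 + B3) * (1 + r) ^- 2)).
    by rewrite ler_wpM2r // lerDr addr_ge0 // mulr_ge0 // expR_ge0.
  by rewrite lerDr mulr_ge0 // !addr_ge0 // mulr_ge0 // expR_ge0.
have kz : k != z.
  by apply/eqP => E; move: kd; rewrite E subrr normc_0 leNgt d0.
have kz0 : 0 < normc (k - z) by rewrite normc_gt0 subr_eq0.
have H1 : 1 + r <= C1 * normc (k - z).
  rewrite /C1 mulrDl mul1r.
  have : (1 + normc z) <= (1 + normc z) / d * normc (k - z).
    rewrite -mulrA ler_peMr ?addr_ge0 // mulrC ler_pdivlMr // mul1r //.
  lra.
have H2 : 1 + r <= 2 * normc (k + 'i).
  rewrite -(@ler_pXn2r _ 2) ?nnegrE ?(ltW r1) ?mulr_ge0 ?normc_ge0 //.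
  rewrite exprMn normc_sqr ReD ImD /= addr0.
  have := normc_sqr k; rewrite -/r => E; have := sqr_ge0 (1 - r).
  have := sqr_ge0 (Re k); nra.
rewrite /U (negbTE kz) normcM normcV.
have Pk : normc (P k) <= expR (s' * y) * (F * (1 + r)) + C2 / (1 + r).
  apply: le_trans (normcD _ _) _; rewrite normcN; apply: lerD.
    rewrite normcM normc_cexp /F divfK ?gt_eqF //.
    rewrite mulrCA ler_wpM2l ?normc_ge0 // -expRD ler_expR.
    rewrite le_eqVlt; apply/orP; left; apply/eqP.
    by rewrite !ReM ReD ImD ReN ImN ImM /=; ring.
  have kp : 0 < normc (k + 'i) by lra.
  rewrite !normcM normcV ler_pdivlMr // mulrAC ler_pdivrMr //.
  rewrite /C2 -!mulrA [leRHS]mulrCA ler_wpM2l ?normc_ge0 //.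
  by rewrite [leRHS]mulrCA ler_wpM2l ?normc_ge0.
rewrite ler_pdivrMr //; apply: le_trans Pk _.
set G := (1 + r) ^- 2 in G0 *.
have GE : C2 / (1 + r) = C2 * (G * (1 + r)) by rewrite /G; field; rewrite gt_eqF.
set E := expR (s' * y); have E0 : 0 <= E by exact: expR_ge0.
rewrite GE; apply: (@le_trans _ _ ((E + C2) * (F + G) * (1 + r))).
  have : 0 <= E * G + C2 * F by rewrite addr_ge0 // mulr_ge0.
  by have := ltW r1; nra.
apply: (@le_trans _ _ ((E + C2) * (F + G) * (C1 * normc (k - z)))).
  by rewrite ler_wpM2l // mulr_ge0 // addr_ge0.
have : 0 <= B3 * (F + G) * normc (k - z).
  exact: (mulr_ge0 (mulr_ge0 B30 (addr_ge0 F0 G0)) (normc_ge0 _)).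
lra.
Qed.

Let A0 : 0 <= A.
Proof.
have := f_growth 0; rewrite normc_0 mulr0 expR0 mulr1; exact: le_trans (normc_ge0 _).
Qed.

(** The rational term subtracted in P takes the same value as the exponential term at z,
    so that the quotient U has no pole there, and it makes U decay like 1/|k|^2 where
    the exponential term is small. Since s' exceeds the type of f, the exponential
    dominates the growth of f on the positive imaginary axis. *)
Lemma upper_vanish : exists V : R -> R[i], [/\ forall t : R, t%:C != z -> V t = P t%:C / (t%:C - z),
  Cintegrable setT V & Cintegral setT V = 0].
Proof.
have [B B0 UB] := U_bound.
have iR : Cintegrable setT (fun t => U (t +i* 0)).
  apply: (@Citg_dom _ _ _ (fun t : R => B * (normc (f t%:C) ^+ 2) + 2 * B * cauchyd t)) => //.
  + by apply: Cmeas_cont => // t _; apply: Rcont_h; apply: U_cont.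
  + apply: itgD => //; first exact: itgZ.
    by apply: itgZ => //; exact: (integral_cauchyd R).1.
  + move=> t _; apply: le_trans (UB (t +i* 0) (lexx 0)) _.
    rewrite mulr0 expR0 mulr1 -[t +i* 0]/(t%:C).
    set F := normc (f _); set r := normc _.
    have r0 : 0 <= r by exact: normc_ge0.
    have F0 : 0 <= F by exact: normc_ge0.
    pose G := (1 + r)^-1; have G0 : 0 <= G by rewrite invr_ge0 addr_ge0.
    have GC : G ^+ 2 <= cauchyd t.
      rewrite /G /cauchyd exprVn lef_pV2 ?posrE ?exprn_gt0 ?ltr_pwDl ?sqr_ge0 //.
      by have := normc_sqr t%:C; rewrite -/r /=; nra.
    rewrite -/G (_ : (1 + r) ^- 2 = G ^+ 2); last by rewrite /G exprVn.
    have FG : F * G <= F ^+ 2 + G ^+ 2 by have := sqr_ge0 (F - G); have := sqr_ge0 F; have := sqr_ge0 G; nra.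
    apply: (@le_trans _ _ (B * (F ^+ 2 + 2 * cauchyd t))); last by lra.
    by rewrite ler_wpM2l //; lra.
exists (fun t => U (t +i* 0)); split => //.
- by move=> t tz; rewrite /U (negbTE tz).
- apply: (@halfplane_axis U (B * (A + 1)) c) => //.
  + by move=> x y' y0; exact: U_cont.
  + move=> x y' x0 y0; apply: U_holo; first exact: ltW.
    by rewrite /z eq_complex /= negb_and x0.
  + move=> x y' y0; apply: le_trans (UB _ _) _ => //.
    rewrite -[leRHS]mulrA ler_wpM2l //.
    set r := normc (x +i* y'); have r0 : 0 <= r by exact: normc_ge0.
    have rb : expR (c * r) <= expR (c * (`|x| + y')).
      rewrite ler_expR ler_wpM2l //; apply: le_trans (normc_leD _) _.
      by rewrite /= (ger0_norm y0).
    have V1 : (1 + r)^-1 <= 1 by rewrite invf_le1 ?ltr_pwDl // lerDl.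
    have V0 : 0 <= (1 + r)^-1 by rewrite invr_ge0 addr_ge0.
    have E1 : expR (- s' * Im (x +i* y')) <= 1.
      by rewrite expR_le1 mulNr oppr_le0 mulr_ge0 // (le_trans c0 (ltW cs')).
    have e1 : 1 <= expR (c * r).
      by rewrite (le_trans _ (expR_ge1Dx _)) // lerDl mulr_ge0.
    apply: (@le_trans _ _ (A * expR (c * r) + expR (c * r))); last first.
      by rewrite mulrDl mul1r lerD // ler_wpM2l.
    apply: lerD; last first.
      by apply: le_trans e1; rewrite -exprVn expr_le1.
    rewrite -[leRHS]mulr1; apply: ler_pM => //.
      by rewrite mulr_ge0 ?normc_ge0 ?expR_ge0.
    rewrite -[leRHS]mulr1; apply: ler_pM; rewrite ?normc_ge0 ?expR_ge0 //.
  + pose M := 1 + (s' - c)^-1.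
    have k0 : 0 < s' - c by rewrite subr_gt0.
    have M0 : 0 <= M by rewrite addr_ge0 // invr_ge0 ltW.
    apply: (@Citg_dom _ _ _ (fun t => B * (A * M + 1) * cauchyd t)) => //.
    * apply: Cmeas_cont => // t; rewrite /= in_itv /= andbT => t0.
      by apply: Rcont_v; apply: U_cont.
    * by apply: itgZ => //; exact: itg_cauchyd_half.
    * move=> t; rewrite /= in_itv /= andbT => t0; apply: le_trans (UB _ _) _ => //.
      rewrite -[leRHS]mulrA ler_wpM2l //.
      have rt : normc (0 +i* t : R[i]) = t by rewrite /= expr0n /= add0r sqrtr_sqr ger0_norm.
      rewrite -/(normc (0 +i* t : R[i])) rt.
      have G0 : 0 <= (1 + t)^-1 by rewrite invr_ge0 addr_ge0.
      have GC : (1 + t)^-1 ^+ 2 <= cauchyd t.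
        by rewrite /cauchyd exprVn lef_pV2 ?posrE ?exprn_gt0 ?ltr_pwDl ?sqr_ge0 //; nra.
      have H : normc (f (0 +i* t)) * expR (- s' * t) <= A * M * (1 + t)^-1.
        apply: (@le_trans _ _ (A * expR (- ((s' - c) * t)))).
          have := f_growth (0 +i* t); rewrite rt => fg.
          apply: (@le_trans _ _ (A * expR (c * t) * expR (- s' * t))).
            by rewrite ler_wpM2r ?expR_ge0.
          rewrite -mulrA -expRD ler_wpM2l // ler_expR; lra.
        rewrite -[leRHS]mulrA ler_wpM2l // expRN.
        apply: (@le_trans _ _ (1 + (s' - c) * t)^-1).
          rewrite lef_pV2 ?posrE ?expR_gt0 ?ltr_pwDl ?mulr_ge0 ?(ltW k0) //.
          exact: expR_ge1Dx.
        have k0' := ltW k0.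
        have d1 : 0 < 1 + (s' - c) * t by rewrite ltr_pwDl // mulr_ge0.
        rewrite ler_pdivlMr ?ltr_pwDl // mulrC ler_pdivrMr // /M.
        have kk : (s' - c)^-1 * (s' - c) = 1 by rewrite mulVf ?gt_eqF.
        have ki : 0 <= (s' - c)^-1 by rewrite invr_ge0.
        rewrite mulrDl mul1r mulrDr mulr1 mulrA kk mul1r.
        have := mulr_ge0 k0' t0; lra.
      rewrite -exprVn; move: H G0 GC; set G := (1 + t)^-1; set H := _ * expR _ => HH G0 GC.
      apply: (@le_trans _ _ ((A * M + 1) * G ^+ 2)); last first.
        by rewrite ler_wpM2l // addr_ge0 // mulr_ge0.
      rewrite mulrDl mul1r lerD2r expr2 mulrA ler_wpM2r //.
Qed.

End UpperVanish.
End HalfPlane.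

(** * The reproducing formula for band-limited functions *)

Section Reproducing.
Variable R : realType.
Local Notation mu := (@lebesgue_measure R).
Implicit Types (z w : R[i]).

Lemma CmeasM d (T : measurableType d) (D : set T) (f g : T -> R[i]) :
  Cmeasurable D f -> Cmeasurable D g -> Cmeasurable D (fun x => f x * g x).
Proof.
move=> [f1 f2] [g1 g2]; split.
  rewrite (_ : (fun x => _) = fun x => Re (f x) * Re (g x) - Im (f x) * Im (g x)).
    by apply: measurable_funB; apply: measurable_funM.
  by apply: funext => x; rewrite ReM.
rewrite (_ : (fun x => _) = fun x => Re (f x) * Im (g x) + Im (f x) * Re (g x)).
  by apply: measurable_funD; apply: measurable_funM.
by apply: funext => x; rewrite ImM.
Qed.

Lemma CitgM_L2 (D : set R) (f g : R -> R[i]) : measurable D ->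
  Cmeasurable D f -> Cmeasurable D g ->
  itg D (fun t => normc (f t) ^+ 2) -> itg D (fun t => normc (g t) ^+ 2) ->
  Cintegrable D (fun t => f t * g t).
Proof.
move=> mD mf mg f2 g2.
apply: (Citg_dom mD (CmeasM mf mg) (itgD mD f2 g2)) => t _.
rewrite normcM; have := sqr_ge0 (normc (f t) - normc (g t)).
have := sqr_ge0 (normc (f t)); have := sqr_ge0 (normc (g t)); nra.
Qed.

Lemma Cmeas_real (g : R[i] -> R[i]) (D : set R) : measurable D -> (forall w, holo g w) ->
  Cmeasurable D (fun t => g t%:C).
Proof.
by move=> mD hg; apply: Cmeas_cont => // t _; apply: (@Rcont_h R g 0); exact/holo_cont/hg.
Qed.

Lemma Citg_real (D : set R) (g : R -> R) : measurable D -> itg D g ->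
  Cintegrable D (fun t => (g t)%:C).
Proof. by move=> mD gi; split => //; exact: (integrable0 mu D). Qed.

Lemma Cint_real (D : set R) (g : R -> R) :
  Cintegral D (fun t => (g t)%:C) = (\int[mu]_(t in D) g t)%:C.
Proof. by apply: eqC => //; rewrite /= /Rintegral integral0. Qed.

Definition sincK (s : R) z : R := ((1 + s) / pi * expR (s * `|Im z|) * (1 + normc z)) ^+ 2.

Lemma sincK_le s S z : 0 <= s -> s <= S -> sincK s z <= sincK S z.
Proof.
move=> s0 sS; have S0 := le_trans s0 sS.
have nz := normc_ge0 z.
rewrite /sincK ler_pXn2r ?nnegrE //; try by rewrite !mulr_ge0 ?expR_ge0 ?addr_ge0 // invr_ge0 pi_ge0.
rewrite ler_wpM2r ?addr_ge0 //; apply: ler_pM; rewrite ?expR_ge0 //.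
- by rewrite mulr_ge0 ?addr_ge0 // invr_ge0 pi_ge0.
- by rewrite ler_wpM2r ?invr_ge0 ?pi_ge0 // lerD2l.
- by rewrite ler_expR ler_wpM2r.
Qed.

(** One integrable majorant serves for all real translates of the kernel. *)
Lemma sinc_sq_decay s z (t : R) : 0 <= s ->
  normc (sinc s (t%:C - z)) ^+ 2 <= sincK s z * cauchyd t.
Proof.
move=> s0; have := sinc_decay (t%:C - z) s0.
rewrite (_ : `|Im (t%:C - z)| = `|Im z|); last by rewrite ImD ImN /= add0r normrN.
set k := _ / pi * _; set d := normc (t%:C - z); set g := normc _ => H.
have d0 : 0 <= d by exact: normc_ge0.
have g0 : 0 <= g by exact: normc_ge0.
have z0 := normc_ge0 z.
have td : `|t| <= d + normc z by have := normcD (t%:C - z) z; rewrite subrK normc_R.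
have T : 1 + t ^+ 2 <= ((1 + normc z) * (1 + d)) ^+ 2.
  apply: (@le_trans _ _ ((1 + `|t|) ^+ 2)).
    by rewrite -[t ^+ 2]real_normK ?num_real //; have := normr_ge0 t; nra.
  rewrite ler_pXn2r ?nnegrE ?mulr_ge0 ?addr_ge0 //.
  have := mulr_ge0 z0 d0; lra.
rewrite /cauchyd ler_pdivlMr ?ltr_pwDl ?sqr_ge0 //.
apply: (@le_trans _ _ (g ^+ 2 * ((1 + normc z) * (1 + d)) ^+ 2)).
  by rewrite ler_wpM2l ?sqr_ge0.
rewrite /sincK -/k -exprMn ler_pXn2r ?nnegrE ?mulr_ge0 ?addr_ge0 //.
- by rewrite mulrCA mulrC ler_wpM2r ?addr_ge0 // mulrC.
- by rewrite invr_ge0 pi_ge0.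
Qed.

Lemma sinc_meas s z (D : set R) : 0 < s -> measurable D ->
  Cmeasurable D (fun t => sinc s (t%:C - z)).
Proof.
move=> s0 mD; apply: (@Cmeas_real (fun w => sinc s (w - z))) => // w.
apply: holo_comp; last exact: sinc_holo.
by apply: holoB; [exact: holo_id|exact: holo_cst].
Qed.

Lemma sinc_L2 s z (D : set R) : 0 < s -> measurable D ->
  itg D (fun t : R => normc (sinc s (t%:C - z)) ^+ 2).
Proof.
move=> s0 mD; apply: (@itg_dom _ _ _ (fun t => sincK s z * cauchyd t)) => //.
- by apply: measurable_funX; apply: Cmeas_normc; exact: sinc_meas.
- by apply: itgZ => //; apply: itg_sub (integral_cauchyd R).1.
- by move=> t _; rewrite ger0_norm ?sqr_ge0 // sinc_sq_decay // ltW.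
Qed.

Lemma rk_algebra (e1 e2 P a b u v j : R[i]) : u - v != 0 -> u + j != 0 -> j - u != 0 ->
  j != 0 -> P != 0 ->
  (b * e1 - a * (v + j) / (u + j)) / (u - v) + (b * e2 - a * (- v + j) / (- u + j)) / (- u + v) =
  2 * j * P * (b * ((e1 - e2) / (2 * j * P * (u - v)))) - a * 2 * j * - ((u + j) * (j - u))^-1.
Proof.
move=> uv uj ju j0 P0.
have vu : - u + v != 0 by rewrite addrC -opprB oppr_eq0.
have uj' : - u + j != 0 by rewrite addrC.
by field; rewrite ?uv ?uj ?ju ?j0 ?P0 ?vu ?uj'.
Qed.

(** The half-plane identity is applied to f with the exponential e^(is't) and to the
    reflection of f. In the difference the exponentials combine into the sine kernel,
    and the rational terms leave a multiple of the Cauchy density, whose integral is pi.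
    *)
Lemma rk_axis (f : R[i] -> R[i]) (s' c A y : R) :
  (forall w, holo f w) -> (forall w, normc (f w) <= A * expR (c * normc w)) ->
  0 <= c -> c < s' -> itg setT (fun t : R => normc (f t%:C) ^+ 2) ->
  f (0 +i* y) = Cintegral setT (fun t : R => f t%:C * sinc s' (t%:C - (0 +i* y))).
Proof.
move=> hf gf c0 cs f2; have s0 : 0 < s' := le_lt_trans c0 cs.
set z : R[i] := 0 +i* y.
pose g w := f (- w).
have hN w : holo (fun v : R[i] => - v) w.
  rewrite (_ : (fun v : R[i] => - v) = fun v => 0 - v); last by apply: funext => v; rewrite sub0r.
  by apply: holoB; [exact: holo_cst|exact: holo_id].
have hg w : holo g w by apply: holo_comp.
have gg w : normc (g w) <= A * expR (c * normc w) by rewrite -(normcN w); exact: gf.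
have g2 : itg setT (fun t : R => normc (g t%:C) ^+ 2).
  have [h _] := itg_reflect f2; apply: itg_eq h => // t _; by rewrite /g rmorphN.
have [V [VE Vi V0]] := upper_vanish y hf gf c0 cs f2.
have [W [WE Wi W0]] := upper_vanish (- y) hg gg c0 cs g2.
have [Wi' W0'] := Cint_reflect Wi.
pose F (t : R) := f t%:C * sinc s' (t%:C - z).
have Fi : Cintegrable setT F.
  by apply: CitgM_L2 => //; [exact: Cmeas_real|exact: sinc_meas|exact: sinc_L2].
pose H (t : R) : R[i] := (cauchyd t)%:C.
have [ci cI] := integral_cauchyd R.
have Hi : Cintegrable setT H by exact: Citg_real.
have HI : Cintegral setT H = pi%:C by rewrite Cint_real cI.
have zE : 0 +i* (- y) = - z by apply: eqC; rewrite /= ?oppr0.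
have key t : setT t -> t != 0 -> V t + W (- t) = 2 * 'i * pi%:C * F t - f z * 2 * 'i * H t.
  move=> _ t0.
  have tz : t%:C != z by rewrite eq_complex /= negb_and t0.
  have tz' : (- t)%:C != 0 +i* (- y) by rewrite eq_complex /= negb_and oppr_eq0 t0.
  rewrite (VE _ tz) (WE _ tz') zE /F /sinc subr_eq0 (negbTE tz) /g !opprK rmorphN !opprK /=.
  have iN0 : ('i : R[i]) != 0 by rewrite eq_complex /= oner_eq0 andbF.
  have ti : t%:C + 'i != 0 by rewrite eq_complex /= addr0 negb_and t0.
  have it : 'i - t%:C != 0 by rewrite eq_complex /= sub0r negb_and oppr_eq0 t0.
  have tz0 : t%:C - z != 0 by rewrite subr_eq0.
  have HE : H t = - ((t%:C + 'i) * ('i - t%:C))^-1.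
    rewrite /H /cauchyd fmorphV -invrN; congr (_^-1).
    rewrite -[X in X = _]/((1 + t ^+ 2)%:C) rmorphD rmorphXn /= rmorph1.
    have -> : - ((t%:C + 'i) * ('i - t%:C)) = t%:C ^+ 2 - 'i ^+ 2 by ring.
    by rewrite sqr_i opprK addrC.
  rewrite HE.
  have -> : 'i * s'%:C * (t%:C - z) = s'%:C * ('i * (t%:C - z)) by ring.
  have -> : 'i * s'%:C * (- t%:C + z) = - s'%:C * ('i * (t%:C - z)) by ring.
  have piC : (pi%:C : R[i]) != 0 by rewrite eq_complex /= gt_eqF // pi_gt0.
  exact: rk_algebra.
have FHi : Cintegrable setT (fun t => 2 * 'i * pi%:C * F t - f z * 2 * 'i * H t).
  by apply: CitgB => //; exact: CitgZ.
have VWi : Cintegrable setT (fun t => V t + W (- t)) by exact: CitgD.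
have := CintD measurableT Vi Wi'; rewrite V0 W0' W0 addr0.
rewrite (Cint_eq_except measurableT VWi FHi key) CintB //; try exact: CitgZ.
rewrite !CintZ // HI => E.
have piC : (pi%:C : R[i]) != 0 by rewrite eq_complex /= gt_eqF // pi_gt0.
have iN0 : ('i : R[i]) != 0 by rewrite eq_complex /= oner_eq0 andbF.
have k0 : 2 * 'i * pi%:C != 0 :> R[i] by rewrite !mulf_neq0 // pnatr_eq0.
apply: (mulfI k0); apply/esym/eqP; rewrite -subr_eq0 -E; apply/eqP; ring.
Qed.

Lemma cvg_invnD (s : R) : s + (n.+1%:R)^-1 @[n --> \oo] --> s.
Proof.
rewrite -[X in _ --> X]addr0; apply: cvgD; first exact: cvg_cst.
exact: cvg_harmonic.
Qed.

Lemma sinc_cvg (s : R) z : Ccvg (fun n => sinc (s + (n.+1%:R)^-1) z) (sinc s z).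
Proof.
rewrite /sinc; case: eqVneq => z0.
  split; last exact: cvg_cst.
  rewrite [X in _ --> X](_ : _ = s / pi) //; apply: cvgMl; exact: cvg_invnD.
have H (w : R[i]) : Ccvg (fun n => cexp ((s + (n.+1%:R)^-1)%:C * w)) (cexp (s%:C * w)).
  apply: (Ccvg_comp (g := @cexp R)); first exact/holo_cont/holo_cexp.
  rewrite (_ : (fun n => _) = fun n => (n.+1%:R)^-1 * normc w).
    by rewrite -(mul0r (normc w)); apply: cvgMl; exact: cvg_harmonic.
  apply: funext => n; rewrite -mulrBl rmorphD /= [X in normc (X * _)]addrC addKr.
  by rewrite normcM normc_R ger0_norm.
apply: CcvgM; last exact: Ccvg_cst.
apply: CcvgB; first exact: H.
rewrite (_ : (fun n => _) = fun n => cexp ((s + (n.+1%:R)^-1)%:C * (- ('i * z)))).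
  by rewrite mulNr -mulrN; exact: H.
by apply: funext => n; rewrite mulNr mulrN.
Qed.

(** The gap between the type of f and s' is closed by letting s' decrease to s under the
    integral. *)
Lemma rk_axis_lim (f : R[i] -> R[i]) (s y : R) : 0 < s ->
  (forall w, holo f w) -> exp_type_le s f -> itg setT (fun t : R => normc (f t%:C) ^+ 2) ->
  f (0 +i* y) = Cintegral setT (fun t : R => f t%:C * sinc s (t%:C - (0 +i* y))).
Proof.
move=> s0 hf tf f2; set z : R[i] := 0 +i* y.
pose S n : R := s + (n.+1%:R)^-1.
have t0 n : 0 < (n.+1%:R)^-1 :> R by rewrite invr_gt0.
have S0 n : 0 < S n by rewrite addr_gt0.
have S1 n : S n <= s + 1 by rewrite lerD2l invf_le1 // ler1n.
have E n : f z = Cintegral setT (fun t : R => f t%:C * sinc (S n) (t%:C - z)).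
  have e0 : 0 < (n.+1%:R)^-1 / 2 :> R by rewrite divr_gt0.
  have [A AP] := tf _ e0.
  apply: (@rk_axis f (S n) (s + (n.+1%:R)^-1 / 2) A y) => //.
  - by rewrite addr_ge0 // ltW.
  - by rewrite /S ltrD2l ltr_pdivrMr // ltr_pMr // ltr1n.
have mF n : Cmeasurable setT (fun t : R => f t%:C * sinc (S n) (t%:C - z)).
  by apply: CmeasM; [exact: Cmeas_real|exact: sinc_meas].
pose G (t : R) := normc (f t%:C) ^+ 2 + sincK (s + 1) z * cauchyd t.
have Gi : itg setT G.
  by apply: itgD => //; apply: itgZ => //; exact: (integral_cauchyd R).1.
have [||_] := @Cint_dct R setT (fun n t => f t%:C * sinc (S n) (t%:C - z))
  (fun t => f t%:C * sinc s (t%:C - z)) G measurableT mF Gi.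
- move=> n t _; rewrite normcM /G.
  have := sinc_sq_decay z t (ltW (S0 n)); have := sincK_le z (ltW (S0 n)) (S1 n).
  have := ltW (cauchyd_gt0 t); move: (cauchyd t) (sincK _ _) (sincK _ _) => h k1 k2 h0 k12.
  move: (normc (f _)) (normc (sinc _ _)) (normc_ge0 (f t%:C)) => a b a0 H.
  have := ler_wpM2r h0 k12; have := sqr_ge0 (a - b); have := sqr_ge0 a; have := sqr_ge0 b; nra.
- by move=> t _; apply: CcvgZ; exact: sinc_cvg.
move=> cv; apply/esym; apply: (Ccvg_unique cv).
rewrite (_ : (fun n => _) = fun=> f z); first exact: Ccvg_cst.
by apply: funext => n; rewrite -E.
Qed.

(** A real translation moves the point of evaluation to the imaginary axis. *)
Lemma reproducing (f : R[i] -> R[i]) (s : R) z : 0 < s ->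
  (forall w, holo f w) -> exp_type_le s f -> itg setT (fun t : R => normc (f t%:C) ^+ 2) ->
  f z = Cintegral setT (fun t : R => f t%:C * sinc s (z - t%:C)).
Proof.
case: z => x y s0 hf tf f2.
pose g (w : R[i]) := f (w + x%:C).
have hg w : holo g w.
  apply: holo_comp; last exact: hf.
  by apply: holoD; [exact: holo_id|exact: holo_cst].
have gE (t : R) : g t%:C = f (t + x)%:C by rewrite /g rmorphD.
have g2 : itg setT (fun t : R => normc (g t%:C) ^+ 2).
  by have [h _] := itg_translate x f2; apply: itg_eq h => // t _; rewrite gE.
have tg : exp_type_le s g.
  move=> e e0; have [A AP] := tf e e0; exists (A * expR ((s + e) * normc x%:C)) => w.
  apply: le_trans (AP _) _.
  have A0 : 0 <= A.
    have := AP 0; rewrite normc_0 mulr0 expR0 mulr1; exact: le_trans (normc_ge0 _).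
  rewrite -mulrA -expRD ler_wpM2l // ler_expR -mulrDr.
  rewrite ler_wpM2l ?addr_ge0 ?(ltW s0) ?(ltW e0) //.
  by rewrite addrC; exact: normcD.
have -> : f (x +i* y) = g (0 +i* y) by congr f; apply: eqC; rewrite /= ?add0r ?addr0.
rewrite (rk_axis_lim y s0 hg tg g2).
pose F (t : R) := f t%:C * sinc s (x +i* y - t%:C).
have Fi : Cintegrable setT F.
  apply: CitgM_L2 => //; first exact: Cmeas_real.
    rewrite (_ : (fun t : R => _) = fun t : R => sinc s (t%:C - (x +i* y))); first exact: sinc_meas.
    by apply: funext => t; rewrite -sincN opprB.
  rewrite (_ : (fun t : R => _) = fun t : R => normc (sinc s (t%:C - (x +i* y))) ^+ 2); first exact: sinc_L2.
  by apply: funext => t; rewrite -sincN opprB.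
have [_ <-] := Cint_translate x Fi.
apply: Cint_eq => t _; rewrite gE /F; congr (_ * _); rewrite -sincN; congr sinc.
by apply: eqC; rewrite /=; ring.
Qed.

End Reproducing.

(** * Fubini for dominated kernels *)

Section Fubini.
Variable R : realType.
Local Notation mu := (@lebesgue_measure R).
Local Notation T := (measurableTypeR R).

Let fubini_all (F : T -> T -> R) (g h : T -> R) :
  measurable_fun setT (fun p : T * T => F p.1 p.2) -> itg setT g -> itg setT h ->
  (forall x y, `|F x y| <= g x * h y) ->
  itg setT (fun x => \int[mu]_(y in setT) F x y) /\
      \int[mu]_(x in setT) (\int[mu]_(y in setT) F x y) =
      \int[mu]_(y in setT) (\int[mu]_(x in setT) F x y).
Proof.
move=> mF gi hi Fgh.
pose f (p : T * T) : \bar R := (F p.1 p.2)%:E.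
have mf : measurable_fun setT f by exact/measurable_EFinP.
have mF1 (x : T) : measurable_fun setT (F x) by have := measurableT_comp mF (@pair1_measurable _ _ T T x).
have mF2 (y : T) : measurable_fun setT (F^~ y) by have := measurableT_comp mF (@pair2_measurable _ _ T T y).
have i1 x : itg setT (F x) by apply: (itg_dom measurableT (mF1 x) (itgZ (g x) measurableT hi)) => y _.
have i2 y : itg setT (F^~ y).
  by apply: (itg_dom measurableT (mF2 y) (itgZ (h y) measurableT gi)) => x _; rewrite mulrC.
have fi : (mu \x mu)%E.-integrable setT f.
  apply/integrable12ltyP => //.
  have gn := integrable_norm gi; have hn := integrable_norm hi.
  pose H := \int[mu]_(y in setT) `|h y|.
  have mabs : measurable_fun setT (fun p : T * T => `|f p|%E) by exact: measurableT_comp.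
  apply: (@le_lt_trans _ _ (\int[mu]_x (`|g x| * H)%:E)%E).
    apply: ge0_le_integral => //.
    - by move=> x _; exact: integral_ge0.
    - by apply: (@measurable_fun_fubini_tonelli_F _ _ T T R mu (fun p => `|f p|%E)) => // p; exact: abse_ge0.
    - apply/measurable_EFinP; apply: measurable_funM => //; exact: (itg_meas gn).
    move=> x _.
    apply: (@le_trans _ _ (\int[mu]_y (`|g x| * `|h y|)%:E)%E).
      apply: ge0_le_integral => //.
      - by apply: (measurableT_comp _ (measurableT_comp _ (mF1 x))).
      - by apply/measurable_EFinP; apply: measurable_funM => //; exact: (itg_meas hn).
      - by move=> y _; rewrite lee_fin -normrM (le_trans (Fgh x y)) // ler_norm.
    have hh := integrable_fin_num measurableT (itgZ `|g x| measurableT hn).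
    rewrite -(fineK hh) lee_fin -RintegralZl //.
  have := itgZ H measurableT gn; move=> /integrableP[_]; apply: le_lt_trans.
  apply: ge0_le_integral => //.
  - by move=> x _; rewrite lee_fin mulr_ge0 // Rintegral_ge0.
  - apply/measurable_EFinP; apply: measurable_funM => //; exact: (itg_meas gn).
  - apply: measurableT_comp => //; apply/measurable_EFinP; apply: measurable_funM => //; exact: (itg_meas gn).
  - by move=> x _; rewrite lee_fin mulrC ler_norm.
have E1 : fubini_F mu f = EFin \o (fun x => \int[mu]_(y in setT) F x y).
  apply: funext => x /=; rewrite /fubini_F /f /Rintegral fineK //.
  exact: (integrable_fin_num measurableT (i1 x)).
have E2 : fubini_G mu f = EFin \o (fun y => \int[mu]_(x in setT) F x y).
  apply: funext => y /=; rewrite /fubini_G /f /Rintegral fineK //.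
  exact: (integrable_fin_num measurableT (i2 y)).
split.
- by rewrite /itg -E1; exact: integrable_fubini_F.
- have EF : (\int[mu]_x fubini_F mu f x = \int[mu]_y fubini_G mu f y)%E by exact: Fubini fi.
  by rewrite /Rintegral; move: EF; rewrite E1 E2 => /(congr1 fine).
Qed.

(** Fubini for functions dominated by a product of integrable functions, together with
    the integrability of the two partial integrals. *)
Lemma Rfubini (A B : set T) (F : T -> T -> R) (g h : T -> R) : measurable A -> measurable B ->
  measurable_fun (A `*` B : set (T * T)) (fun p : T * T => F p.1 p.2) -> itg A g -> itg B h ->
  (forall x y, A x -> B y -> `|F x y| <= g x * h y) ->
  [/\ itg A (fun x => \int[mu]_(y in B) F x y),
      itg B (fun y => \int[mu]_(x in A) F x y) &
      \int[mu]_(x in A) (\int[mu]_(y in B) F x y) =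
      \int[mu]_(y in B) (\int[mu]_(x in A) F x y)].
Proof.
move=> mA mB mF gi hi Fgh.
pose G (x y : T) : R := if (x \in A) && (y \in B) then F x y else 0.
have GE : (fun p : T * T => G p.1 p.2) = patch (fun=> 0) (A `*` B) (fun p : T * T => F p.1 p.2).
  apply: funext => -[x y]; rewrite /patch /G /=; congr (if _ then _ else _).
  by apply/idP/idP; rewrite ?inE; [move=> /andP[]; rewrite !inE|move=> [/= ? ?]; rewrite !mem_set].
have mG : measurable_fun setT (fun p : T * T => G p.1 p.2).
  rewrite GE; apply/(measurable_restrictT _ _).1 => //; exact: measurableX.
have mk (D : set T) (f : T -> R) : measurable D -> itg D f <-> itg setT (f \_ D).
  by move=> mD; rewrite /itg -restrict_EFin; exact: integrable_mkcond.
have gi' : itg setT (g \_ A) by exact: (proj1 (mk A g mA) gi).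
have hi' : itg setT (h \_ B) by exact: (proj1 (mk B h mB) hi).
have G1 x : x \in A -> \int[mu]_(y in setT) G x y = \int[mu]_(y in B) F x y.
  move=> xA; rewrite [RHS]Rintegral_mkcond; apply: Rint_eq => y _.
  by rewrite /G xA /= /patch.
have G2 y : y \in B -> \int[mu]_(x in setT) G x y = \int[mu]_(x in A) F x y.
  move=> yB; rewrite [RHS]Rintegral_mkcond; apply: Rint_eq => x _.
  by rewrite /G yB andbT /patch.
have G1' x : x \notin A -> \int[mu]_(y in setT) G x y = 0.
  move=> xA; rewrite (_ : (fun y => _) = fun=> 0); first by rewrite /Rintegral integral0.
  by apply: funext => y; rewrite /G (negbTE xA).
have G2' y : y \notin B -> \int[mu]_(x in setT) G x y = 0.
  move=> yB; rewrite (_ : (fun x => _) = fun=> 0); first by rewrite /Rintegral integral0.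
  by apply: funext => x; rewrite /G (negbTE yB) andbF.
have E1 : (fun x => \int[mu]_(y in setT) G x y) = (fun x => \int[mu]_(y in B) F x y) \_ A.
  apply: funext => x; rewrite /patch; case: ifPn => xA; [exact: G1|exact: G1'].
have E2 : (fun y => \int[mu]_(x in setT) G x y) = (fun y => \int[mu]_(x in A) F x y) \_ B.
  apply: funext => y; rewrite /patch; case: ifPn => yB; [exact: G2|exact: G2'].
have Gb x y : `|G x y| <= (g \_ A) x * (h \_ B) y.
  rewrite /G /patch; case: ifPn; first by move=> /andP[xA yB]; rewrite xA yB; apply: Fgh; exact: set_mem.
  rewrite negb_and => /orP[/negbTE ->|/negbTE ->]; by rewrite normr0 ?mul0r ?mulr0.
have [i1 sw] := fubini_all mG gi' hi' Gb.
have mG' : measurable_fun setT (fun p : T * T => G p.2 p.1).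
  exact: (measurableT_comp mG (@measurable_swap _ _ T T)).
have Gb' x y : `|G y x| <= (h \_ B) x * (g \_ A) y by rewrite mulrC.
have [i2 _] := @fubini_all (fun x y => G y x) _ _ mG' hi' gi' Gb'.
split.
- by apply: (proj2 (mk A _ mA)); rewrite -E1.
- by apply: (proj2 (mk B _ mB)); rewrite -E2.
- by rewrite Rintegral_mkcond -E1 sw E2 -Rintegral_mkcond.
Qed.

Lemma Cfubini (A B : set T) (F : T -> T -> R[i]) (g h : T -> R) : measurable A -> measurable B ->
  Cmeasurable (A `*` B : set (T * T)) (fun p : T * T => F p.1 p.2) -> itg A g -> itg B h ->
  (forall x y, A x -> B y -> normc (F x y) <= g x * h y) ->
  [/\ Cintegrable A (fun x => Cintegral B (F x)),
      Cintegrable B (fun y => Cintegral A (F^~ y)) &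
      Cintegral A (fun x => Cintegral B (F x)) = Cintegral B (fun y => Cintegral A (F^~ y))].
Proof.
move=> mA mB [m1 m2] gi hi Fgh.
have [|i1 j1 e1] := @Rfubini A B (fun x y => Re (F x y)) g h mA mB m1 gi hi.
  by move=> x y Ax By; exact: le_trans (Re_le _) (Fgh _ _ Ax By).
have [|i2 j2 e2] := @Rfubini A B (fun x y => Im (F x y)) g h mA mB m2 gi hi.
  by move=> x y Ax By; exact: le_trans (Im_le _) (Fgh _ _ Ax By).
by split; [split|split|apply: eqC].
Qed.

Lemma meas_fst (A B : set T) (a : T -> R) : measurable A -> measurable B ->
  measurable_fun A a -> measurable_fun (A `*` B : set (T * T)) (fun p : T * T => a p.1).
Proof.
move=> mA mB ma; apply: (@measurable_comp _ _ _ _ _ _ A a _ fst) => //.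
  by move=> _ [p [? ?] <-].
by apply: measurable_funS measurable_fst.
Qed.

Lemma meas_snd (A B : set T) (b : T -> R) : measurable A -> measurable B ->
  measurable_fun B b -> measurable_fun (A `*` B : set (T * T)) (fun p : T * T => b p.2).
Proof.
move=> mA mB mb; apply: (@measurable_comp _ _ _ _ _ _ B b _ snd) => //.
  by move=> _ [p [? ?] <-].
by apply: measurable_funS measurable_snd.
Qed.

(** The exchange of integrals in a bilinear expression with a real kernel, the only form
    of Fubini needed with complex functions. *)
Lemma kernel_fubini (A B : set T) (a b : T -> R[i]) (k : T -> T -> R) (g h : T -> R) :
  measurable A -> measurable B -> measurable_fun setT (fun p : T * T => k p.1 p.2) ->
  Cmeasurable A a -> Cmeasurable B b -> itg A g -> itg B h ->
  (forall x y, A x -> B y -> normc (a x) * `|k x y| * normc (b y) <= g x * h y) ->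
  [/\ Cintegrable A (fun x => Cintegral B (fun y => a x * ((k x y)%:C * b y))),
      Cintegrable B (fun y => Cintegral A (fun x => a x * ((k x y)%:C * b y))) &
      Cintegral A (fun x => Cintegral B (fun y => a x * ((k x y)%:C * b y))) =
      Cintegral B (fun y => Cintegral A (fun x => a x * ((k x y)%:C * b y)))].
Proof.
move=> mA mB mk ma mb gi hi H.
apply: (@Cfubini A B (fun x y => a x * ((k x y)%:C * b y)) g h) => //.
  have [a1 a2] := ma; have [b1 b2] := mb.
  apply: CmeasM; first by split; [exact: (meas_fst mA mB a1)|exact: (meas_fst mA mB a2)].
  apply: CmeasM; last by split; [exact: (meas_snd mA mB b1)|exact: (meas_snd mA mB b2)].
  split => //; apply: measurable_funS mk => //.
by move=> x y Ax By; rewrite !normcM normc_R mulrA H.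
Qed.

End Fubini.

(** * Functions generated by the Dirichlet kernel on (-1,1) *)

Section BandLimiting.
Variable R : realType.
Local Notation mu := (@lebesgue_measure R).
Local Notation T := (measurableTypeR R).
Local Notation I11 := (@itv11 R).
Implicit Types (z w h : R[i]).

Lemma itv11_meas : measurable I11.
Proof. exact: measurable_itv. Qed.

Lemma itv11_mu : mu I11 = (2%:R)%:E.
Proof.
have -> : mu I11 = (if ((-1 : R)%:E < (1 : R)%:E)%E then ((1 : R)%:E - (-1 : R)%:E)%E else 0%E).
  exact: (@lebesgue_measure_itv R `](-1), 1[).
by rewrite lte_fin -EFinB opprK (_ : -1 < 1 :> R) //; lra.
Qed.

Lemma itg_bdd (f : R -> R) (M : R) : measurable_fun I11 f -> (forall x, I11 x -> `|f x| <= M) ->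
  itg I11 f.
Proof. by apply: itg_bounded; [exact: itv11_meas|rewrite itv11_mu ltry]. Qed.

Lemma itg_cst11 (M : R) : itg I11 (fun=> M).
Proof. by apply: (@itg_bdd _ `|M|). Qed.

Lemma Rint_cst11 (M : R) : \int[mu]_(t in I11) M = 2 * M.
Proof.
rewrite Rintegral_cst; last exact: itv11_meas.
transitivity (M * fine (2%:R)%:E); last by rewrite mulrC.
by congr (_ * fine _); exact: itv11_mu.
Qed.

Lemma Citg_bdd (f : R -> R[i]) (M : R) : Cmeasurable I11 f ->
  (forall x, I11 x -> normc (f x) <= M) -> Cintegrable I11 f.
Proof. by move=> mf fM; apply: (Citg_dom itv11_meas mf (itg_cst11 M)). Qed.

Lemma Citg_sum n (D : set R) (f : nat -> R -> R[i]) : measurable D ->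
  (forall i, Cintegrable D (f i)) -> Cintegrable D (fun x => \sum_(i < n) f i x) /\
  Cintegral D (fun x => \sum_(i < n) f i x) = \sum_(i < n) Cintegral D (f i).
Proof.
move=> mD fi; elim: n => [|n [IH1 IH2]].
  rewrite (_ : (fun x => _) = fun=> 0); last by apply: funext => x; rewrite big_ord0.
  rewrite big_ord0; split; first by split; exact: (integrable0 mu D).
  by apply: eqC; rewrite /= /Rintegral integral0.
rewrite (_ : (fun x => _) = fun x => \sum_(i < n) f i x + f n x); last first.
  by apply: funext => x; rewrite big_ord_recr.
by split; [exact: CitgD|rewrite CintD // big_ord_recr IH2].
Qed.

Variable s : R.
Hypothesis s0 : 0 < s.

Lemma sinc_meas_sub z (D : set R) : measurable D ->
  Cmeasurable D (fun t : R => sinc s (z - t%:C)).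
Proof.
move=> mD; rewrite (_ : (fun t : R => _) = fun t : R => sinc s (t%:C - z)); first exact: sinc_meas.
by apply: funext => t; rewrite -sincN opprB.
Qed.

Lemma Cmeas_cvg (D : set R) (F : nat -> R -> R[i]) (f : R -> R[i]) :
  (forall n, Cmeasurable D (F n)) -> measurable D ->
  (forall x, D x -> Ccvg (F^~ x) (f x)) -> Cmeasurable D f.
Proof.
move=> mF mD Ff; split.
  by apply: (measurable_fun_cvg (fun n => (mF n).1)) => x /Ff[].
by apply: (measurable_fun_cvg (fun n => (mF n).2)) => x /Ff[].
Qed.

(** Measurability passes to the limit of difference quotients of sinc. *)
Lemma sinc'_meas_sub z (D : set R) : measurable D ->
  Cmeasurable D (fun t : R => sinc' s (z - t%:C)).
Proof.
move=> mD.
pose e n : R := (2 * s)^-1 * (n.+1%:R)^-1.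
have i0 : 0 < (2 * s)^-1 by rewrite invr_gt0 mulr_gt0.
have e0 n : 0 < e n by rewrite mulr_gt0 // invr_gt0.
have es n : e n <= (2 * s)^-1 by rewrite ler_piMr ?(ltW i0) // invf_le1 // ler1n.
apply: (@Cmeas_cvg _ (fun n t => (e n)^-1%:C * (sinc s (z - t%:C + (e n)%:C) - sinc s (z - t%:C)))) => //.
  move=> n; apply: (CmeasM (f := fun=> _)); first by split; exact: measurable_cst.
  have [a1 a2] := sinc_meas_sub (z + (e n)%:C) mD; have [b1 b2] := sinc_meas_sub z mD.
  have E (t : R) : z - t%:C + (e n)%:C = z + (e n)%:C - t%:C by ring.
  split.
    rewrite (_ : (fun t => _) = fun t => Re (sinc s (z + (e n)%:C - t%:C)) - Re (sinc s (z - t%:C))).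
      exact: measurable_funB.
    by apply: funext => t; rewrite ReD ReN E.
  rewrite (_ : (fun t => _) = fun t => Im (sinc s (z + (e n)%:C - t%:C)) - Im (sinc s (z - t%:C))).
    exact: measurable_funB.
  by apply: funext => t; rewrite ImD ImN E.
move=> t _; set w := z - t%:C; set C := 10 * s ^+ 3 / pi * expR (s * `|Im w|).
apply: (@Ccvg_le _ _ _ (fun n => C * e n)).
  move=> n; have ne : normc ((e n)%:C : R[i]) = e n by rewrite normc_R gtr0_norm.
  have en0 : (e n)%:C != 0 :> R[i] by rewrite eq_complex /= gt_eqF.
  rewrite (_ : _ - _ = (e n)^-1%:C * (sinc s (w + (e n)%:C) - sinc s w - sinc' s w * (e n)%:C)).
    rewrite normcM normc_R gtr0_norm ?invr_gt0 //.
    have := @sinc_quad R s w (e n)%:C s0; rewrite ne => /(_ (es n)) H.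
    rewrite ler_pdivrMl //; apply: le_trans H _.
    by rewrite -/C [leRHS]mulrCA expr2.
  by rewrite fmorphV; field.
rewrite -(mulr0 C); apply: cvgMr; rewrite -(mulr0 (2 * s)^-1); apply: cvgMr.
exact: cvg_harmonic.
Qed.


(** The image of g under the operator with the Dirichlet kernel, at complex arguments.
    *)
Definition bandlim (g : R -> R[i]) z : R[i] := Cintegral I11 (fun t => sinc s (z - t%:C) * g t).
Definition bandlim' (g : R -> R[i]) z : R[i] := Cintegral I11 (fun t => sinc' s (z - t%:C) * g t).

Lemma Im_subr z (t : R) : Im (z - t%:C) = Im z.
Proof. by rewrite ImD ImN /= oppr0 addr0. Qed.

(** The majorant of the squared kernel is uniform for y in (-1,1). *)
Lemma sinc_sq_itv (t y : R) : I11 y ->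
  normc (sinc s (t%:C - y%:C)) ^+ 2 <= (2 * ((1 + s) / pi)) ^+ 2 * cauchyd t.
Proof.
have k0 : 0 <= (1 + s) / pi by rewrite divr_ge0 ?pi_ge0 // addr_ge0 // ltW.
move=> yI; apply: le_trans (sinc_sq_decay y%:C t (ltW s0)) _.
rewrite ler_wpM2r ?(ltW (cauchyd_gt0 t)) // /sincK.
rewrite (_ : Im y%:C = 0) // normr0 mulr0 expR0 mulr1 normc_R.
have y1 : 0 <= 1 + `|y| by rewrite addr_ge0.
rewrite ler_pXn2r ?nnegrE ?(mulr_ge0 k0 y1) ?(mulr_ge0 _ k0) // [leLHS]mulrC ler_wpM2r //.
have : `|y| <= 1; last by lra.
by move: yI; rewrite /itv11 /= in_itv /= ler_norml => /andP[/ltW -> /ltW ->].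
Qed.

Variable g : R -> R[i].
Hypothesis gi : Cintegrable I11 g.
Let mI := itv11_meas.
Let gn := Citg_normc mI gi.
Let ng := \int[mu]_(t in I11) normc (g t).

Lemma bandlim_citg z : Cintegrable I11 (fun t => sinc s (z - t%:C) * g t).
Proof.
apply: (Citg_dom mI _ (itgZ (s / pi * expR (s * `|Im z|)) mI gn)).
  by apply: CmeasM; [exact: sinc_meas_sub|exact: Cmeas_itg].
move=> t _; rewrite normcM ler_wpM2r ?normc_ge0 //.
by have := sinc_bound (z - t%:C) (ltW s0); rewrite Im_subr.
Qed.

Lemma bandlim'_citg z : Cintegrable I11 (fun t => sinc' s (z - t%:C) * g t).
Proof.
apply: (Citg_dom mI _ (itgZ (s ^+ 2 / pi * expR (s * `|Im z|)) mI gn)).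
  by apply: CmeasM; [exact: sinc'_meas_sub|exact: Cmeas_itg].
move=> t _; rewrite normcM ler_wpM2r ?normc_ge0 //.
by have := sinc'_bound (z - t%:C) (ltW s0); rewrite Im_subr.
Qed.

Lemma bandlim_bound z : normc (bandlim g z) <= s / pi * expR (s * `|Im z|) * ng.
Proof.
rewrite /ng -RintegralZl //; apply: Cint_norm => //; first exact: bandlim_citg.
  exact: itgZ.
move=> t _; rewrite normcM ler_wpM2r ?normc_ge0 //.
by have := sinc_bound (z - t%:C) (ltW s0); rewrite Im_subr.
Qed.

Lemma bandlim'_bound z : normc (bandlim' g z) <= s ^+ 2 / pi * expR (s * `|Im z|) * ng.
Proof.
rewrite /ng -RintegralZl //; apply: Cint_norm => //; first exact: bandlim'_citg.
  exact: itgZ.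
move=> t _; rewrite normcM ler_wpM2r ?normc_ge0 //.
by have := sinc'_bound (z - t%:C) (ltW s0); rewrite Im_subr.
Qed.

(** The Taylor remainder of the kernel is uniform in the variable of integration. *)
Lemma bandlim_quad z h : normc h <= (2 * s)^-1 ->
  normc (bandlim g (z + h) - bandlim g z - bandlim' g z * h) <=
    10 * s ^+ 3 / pi * expR (s * `|Im z|) * normc h ^+ 2 * ng.
Proof.
move=> hh; have c1 := bandlim_citg (z + h); have c2 := bandlim_citg z.
have c3 := CitgZ h mI (bandlim'_citg z).
have c4 := bandlim'_citg z; have c5 := CitgB mI c1 c2.
rewrite /bandlim /bandlim' (mulrC _ h) -(CintZ h mI c4) -(CintB mI c1 c2) -(CintB mI c5 c3).
rewrite /ng -RintegralZl //; apply: Cint_norm => //; last first.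
- move=> t _.
  rewrite (_ : _ - _ = (sinc s (z - t%:C + h) - sinc s (z - t%:C) - sinc' s (z - t%:C) * h) * g t).
    rewrite normcM ler_wpM2r ?normc_ge0 //.
    by have := sinc_quad (z - t%:C) s0 hh; rewrite Im_subr.
  have -> : z + h - t%:C = z - t%:C + h by ring.
  ring.
- exact: itgZ.
- by apply: CitgB => //; exact: CitgB.
Qed.

Lemma bandlim_holo z : holo (bandlim g) z.
Proof.
apply: (@holo_quad _ _ z (bandlim' g z) (10 * s ^+ 3 / pi * expR (s * `|Im z|) * ng) (2 * s)^-1).
  by rewrite invr_gt0 mulr_gt0.
by move=> h /ltW /(bandlim_quad z); rewrite [X in _ <= X -> _]mulrAC.
Qed.

Lemma bandlim_sq (t : R) :
  normc (bandlim g t%:C) ^+ 2 <= (2 * ((1 + s) / pi)) ^+ 2 * ng ^+ 2 * cauchyd t.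
Proof.
have ng0 : 0 <= ng by apply: Rintegral_ge0 => x _; exact: normc_ge0.
have k0 : 0 <= 2 * ((1 + s) / pi) by rewrite mulr_ge0 // divr_ge0 ?pi_ge0 // addr_ge0 // ltW.
have c0 := ltW (cauchyd_gt0 t).
have q0 := sqrtr_ge0 (cauchyd t).
have -> : cauchyd t = Num.sqrt (cauchyd t) ^+ 2 by rewrite sqr_sqrtr.
rewrite -!exprMn ler_pXn2r ?nnegrE ?normc_ge0 ?(mulr_ge0 (mulr_ge0 k0 ng0) q0) //.
rewrite [leRHS]mulrAC /ng -RintegralZl //; apply: Cint_norm => //.
- exact: bandlim_citg.
- exact: itgZ.
move=> y yI; rewrite normcM ler_wpM2r ?normc_ge0 //.
rewrite -(@ler_pXn2r _ 2) ?nnegrE ?normc_ge0 ?(mulr_ge0 k0 q0) // exprMn sqr_sqrtr //.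
exact: sinc_sq_itv.
Qed.

End BandLimiting.

(** * The Paley-Wiener space of the line *)

Section PaleyWiener.
Variable R : realType.
Local Notation mu := (@lebesgue_measure R).
Local Notation T := (measurableTypeR R).
Local Notation I11 := (@itv11 R).
Implicit Types (z w h : R[i]).
Variable s : R.
Hypothesis s0 : 0 < s.

Definition PW (f : R[i] -> R[i]) := [/\ forall w, holo f w, exp_type_le s f &
  itg setT (fun t : R => normc (f t%:C) ^+ 2)].

Lemma normcD_sq z w : normc (z + w) ^+ 2 <= 2 * normc z ^+ 2 + 2 * normc w ^+ 2.
Proof.
have := normcD z w; have := normc_ge0 z; have := normc_ge0 w; have := normc_ge0 (z + w).
move: (normc _) (normc z) (normc w) => c a b c0 b0 a0 cab.
have : c ^+ 2 <= (a + b) ^+ 2 by rewrite ler_pXn2r ?nnegrE ?addr_ge0.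
have := sqr_ge0 (a - b); nra.
Qed.

Lemma Cmeas_normc2 (D : set R) (f : R -> R[i]) : Cmeasurable D f ->
  measurable_fun D (fun t => normc (f t) ^+ 2).
Proof. by move=> mf; apply: measurable_funX; exact: Cmeas_normc. Qed.

Lemma CmeasD (D : set R) (f g : R -> R[i]) :
  Cmeasurable D f -> Cmeasurable D g -> Cmeasurable D (fun x => f x + g x).
Proof.
move=> [f1 f2] [g1 g2]; split.
  rewrite (_ : (fun x => _) = fun x => Re (f x) + Re (g x)); first exact: measurable_funD.
  by apply: funext => x; rewrite ReD.
rewrite (_ : (fun x => _) = fun x => Im (f x) + Im (g x)); first exact: measurable_funD.
by apply: funext => x; rewrite ImD.
Qed.

Lemma PWD f g : PW f -> PW g -> PW (fun w => f w + g w).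
Proof.
move=> [hf tf f2] [hg tg g2]; split.
- by move=> w; exact: holoD.
- move=> e e0; have [A AP] := tf e e0; have [B BP] := tg e e0; exists (A + B) => z.
  by rewrite mulrDl; apply: le_trans (normcD _ _) _; apply: lerD.
- apply: (@itg_dom _ _ _ (fun t => 2 * normc (f t%:C) ^+ 2 + 2 * normc (g t%:C) ^+ 2)) => //.
  + apply: (@Cmeas_normc2 _ (fun t : R => f t%:C + g t%:C)).
    by apply: CmeasD; apply: Cmeas_real.
  + by apply: itgD => //; exact: itgZ.
  + by move=> t _; rewrite ger0_norm ?sqr_ge0 //; exact: normcD_sq.
Qed.

Lemma sincD_bound z w :
  normc (sinc s (z - w)) <= s / pi * expR (s * normc z) * expR (s * normc w).
Proof.
apply: le_trans (sinc_bound (z - w) (ltW s0)) _.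
rewrite -[leRHS]mulrA -expRD ler_wpM2l ?divr_ge0 ?pi_ge0 ?(ltW s0) // ler_expR -mulrDr.
rewrite ler_wpM2l ?(ltW s0) //; apply: le_trans (Im_le _) _.
by have := normcD z (- w); rewrite normcN.
Qed.

Lemma exp_type_of_bound (f : R[i] -> R[i]) (A : R) : 0 <= A ->
  (forall w, normc (f w) <= A * expR (s * normc w)) -> exp_type_le s f.
Proof.
move=> A0 H e e0; exists A => w; apply: le_trans (H w) _.
by rewrite ler_wpM2l // ler_expR ler_wpM2r ?normc_ge0 // lerDl ltW.
Qed.

Lemma PW_sinc z : PW (fun w => sinc s (z - w)).
Proof.
split.
- move=> w; apply: holo_comp; last exact: sinc_holo.
  by apply: holoB; [exact: holo_cst|exact: holo_id].
- apply: (@exp_type_of_bound _ (s / pi * expR (s * normc z))); last exact: sincD_bound.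
  by rewrite mulr_ge0 ?expR_ge0 // divr_ge0 ?pi_ge0 // ltW.
- rewrite (_ : (fun t : R => _) = fun t : R => normc (sinc s (t%:C - z)) ^+ 2); first exact: sinc_L2.
  by apply: funext => t; rewrite -sincN opprB.
Qed.

Lemma PW_bandlim g : Cintegrable I11 g -> PW (bandlim s g).
Proof.
move=> gi; have gn : 0 <= \int[mu]_(t in I11) normc (g t).
  by apply: Rintegral_ge0 => x _; exact: normc_ge0.
split.
- by move=> w; exact: bandlim_holo.
- apply: (@exp_type_of_bound _ (s / pi * \int[mu]_(t in I11) normc (g t))).
    by rewrite mulr_ge0 // divr_ge0 ?pi_ge0 // ltW.
  move=> w; apply: le_trans (bandlim_bound s0 gi w) _.
  rewrite [leLHS]mulrAC ler_wpM2l ?mulr_ge0 ?invr_ge0 ?pi_ge0 ?(ltW s0) //.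
  by rewrite ler_expR ler_wpM2l ?(ltW s0) // Im_le.
- have ci := itgZ ((2 * ((1 + s) / pi)) ^+ 2 * (\int[mu]_(t in I11) normc (g t)) ^+ 2)
    measurableT (integral_cauchyd R).1.
  apply: (itg_dom measurableT _ ci).
    by apply: Cmeas_normc2; apply: Cmeas_real => // w; exact: bandlim_holo.
  by move=> t _; rewrite ger0_norm ?sqr_ge0 //; exact: bandlim_sq.
Qed.

Local Notation d := (dirichlet_kernel s).

Lemma dir_sinc (x y : R) : d x y = Re (sinc s (x%:C - y%:C)).
Proof. by rewrite sinc_real. Qed.

Lemma dir_normc (x y : R) : normc (sinc s (x%:C - y%:C)) = `|d x y|.
Proof. by rewrite sinc_real normc_R. Qed.

Lemma dir_sym (x y : R) : d x y = d y x.
Proof. by rewrite !dir_sinc -sincN opprB. Qed.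

Lemma dir_le (x y : R) : `|d x y| <= s / pi.
Proof.
rewrite -dir_normc; have := sinc_bound (x%:C - y%:C) (ltW s0).
by rewrite Im_subr (_ : Im x%:C = 0) // normr0 mulr0 expR0 mulr1.
Qed.

Lemma dir_meas : measurable_fun setT (fun p : T * T => d p.1 p.2).
Proof.
have H : measurable_fun setT (fun x : T => Re (sinc s (x%:C - 0%:C))).
  by have [] := sinc_meas 0 s0 measurableT.
have H2 : measurable_fun setT (fun p : T * T => p.1 - p.2 : T).
  by apply: measurable_funB; [exact: measurable_fst|exact: measurable_snd].
rewrite (_ : (fun p : T * T => _) = (fun x : T => Re (sinc s (x%:C - 0%:C))) \o (fun p : T * T => p.1 - p.2 : T)).
  exact: measurableT_comp.
by apply: funext => p; rewrite dir_sinc /= rmorphB subr0.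
Qed.

Lemma dir_meas1 (y : R) (D : set R) : measurable D -> measurable_fun D (fun x => d x y).
Proof.
move=> mD; have [H _] := sinc_meas y%:C s0 mD.
by rewrite (_ : (fun x => _) = fun x : R => Re (sinc s (x%:C - y%:C))) //; apply: funext => x; rewrite dir_sinc.
Qed.

Lemma dir_meas2 (x : R) (D : set R) : measurable D -> measurable_fun D (d x).
Proof.
move=> mD; rewrite (_ : d x = fun y => d y x); first exact: dir_meas1.
by apply: funext => y; rewrite dir_sym.
Qed.

Lemma dir_sq (x y : R) : I11 y -> d x y ^+ 2 <= (2 * ((1 + s) / pi)) ^+ 2 * cauchyd x.
Proof. by move=> /(sinc_sq_itv s0 x); rewrite dir_normc real_normK ?num_real. Qed.

End PaleyWiener.

(** * Energy inside and outside (-1,1) *)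

Section Energy.
Variable R : realType.
Local Notation mu := (@lebesgue_measure R).
Local Notation T := (measurableTypeR R).
Local Notation I11 := (@itv11 R).
Local Notation O11 := (~` I11).
Variable s : R.
Hypothesis s0 : 0 < s.
Local Notation d := (dirichlet_kernel s).
Let mI := @itv11_meas R.
Let mO : measurable O11 := measurableC mI.

Definition Dop (u : R -> R) (x : R) : R := \int[mu]_(y in I11) (d x y * u y).

Lemma Rint_setTIO (f : R -> R) : itg setT f ->
  \int[mu]_(x in setT) f x = \int[mu]_(x in I11) f x + \int[mu]_(x in O11) f x.
Proof.
move=> fi; rewrite -(setvU I11) setUC.
by apply: Rintegral_setU => //; rewrite ?setUv //; apply/disj_setPCl.
Qed.

Variables (u : R -> R) (M : R).
Hypothesis mu_ : measurable_fun I11 u.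
Hypothesis uM : forall y, I11 y -> `|u y| <= M.
Let v := Dop u.
Let V := bandlim s (fun t => (u t)%:C).

Let ui : itg I11 u. Proof. exact: itg_bdd uM. Qed.

Let Ui : Cintegrable I11 (fun t => (u t)%:C).
Proof. exact: Citg_real. Qed.

Lemma Dop_itg x : itg I11 (fun y => d x y * u y).
Proof.
apply: (@itg_bdd _ _ (s / pi * M)); first by apply: measurable_funM => //; exact: dir_meas2.
by move=> y yI; rewrite normrM ler_pM //; [exact: dir_le|exact: uM].
Qed.

Lemma Dop_bandlim x : V x%:C = (v x)%:C.
Proof.
rewrite /V /bandlim /v /Dop -Cint_real; apply: Cint_eq => y _.
by rewrite sinc_real -rmorphM.
Qed.

Let PV : PW s V. Proof. exact: PW_bandlim. Qed.

Let VE x : normc (V x%:C) ^+ 2 = v x ^+ 2.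
Proof. by rewrite Dop_bandlim normc_R real_normK ?num_real. Qed.

Lemma Dop_sq_itg : itg setT (fun x => v x ^+ 2).
Proof. by have [_ _ h] := PV; apply: itg_eq h => // x _; rewrite VE. Qed.

Lemma Dop_meas (D : set R) : measurable D -> measurable_fun D v.
Proof.
move=> mD; have [h _ _] := PV; have [h1 _] := Cmeas_real mD h.
by rewrite (_ : v = fun x => Re (V x%:C)) //; apply: funext => x; rewrite Dop_bandlim.
Qed.

Let dv_itg y : I11 y -> itg setT (fun x => d x y * v x).
Proof.
move=> yI.
apply: (itg_dom measurableT _ (itgD measurableT (itgZ ((2 * ((1 + s) / pi)) ^+ 2) measurableT
  (integral_cauchyd R).1) Dop_sq_itg)).
  by apply: measurable_funM; [exact: dir_meas1|exact: Dop_meas].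
move=> x _; have := dir_sq s0 x yI; rewrite normrM.
have := sqr_ge0 (`|d x y| - `|v x|); rewrite sqrrB !real_normK ?num_real //.
have := sqr_ge0 (v x); have := sqr_ge0 (d x y); lra.
Qed.

(** The function v is band-limited, hence reproduced by the Dirichlet kernel on the
    line. *)
Lemma Dop_reproduces y : \int[mu]_(x in setT) (d x y * v x) = v y.
Proof.
have [h t n] := PV; have := reproducing y%:C s0 h t n.
rewrite Dop_bandlim (_ : Cintegral _ _ = (\int[mu]_(x in setT) (d x y * v x))%:C).
  by case.
rewrite -Cint_real; apply: Cint_eq => x _.
by rewrite Dop_bandlim sinc_real -rmorphM dir_sym mulrC.
Qed.

(** Exchange the integrals over x and y, and recognize the reproduced value v(y). *)
Lemma Dop_energy : \int[mu]_(x in setT) v x ^+ 2 = \int[mu]_(y in I11) (u y * v y).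
Proof.
pose K := (2 * ((1 + s) / pi)) ^+ 2.
pose g x := (v x ^+ 2 + K * cauchyd x) / 2.
have gi : itg setT g.
  apply: (@itg_eq _ _ (fun x => 2^-1 * (v x ^+ 2 + K * cauchyd x))) => //.
    by move=> x _; rewrite /g mulrC.
  apply: itgZ => //; apply: itgD => //; first exact: Dop_sq_itg.
  by apply: itgZ => //; exact: (integral_cauchyd R).1.
have hi : itg I11 (fun=> M) := itg_cst11 M.
have [] := @Rfubini R setT I11 (fun x y => v x * (d x y * u y)) g (fun=> M) measurableT mI _ gi hi.
- apply: measurable_funM; first by apply: (meas_fst measurableT mI); exact: Dop_meas.
  apply: measurable_funM; last exact: (meas_snd measurableT mI).
  by apply: measurable_funS (dir_meas s0).
- move=> x y _ yI; rewrite normrM normrM mulrA ler_pM ?mulr_ge0 ?uM // /g.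
  have := dir_sq s0 x yI; rewrite -/K.
  have := sqr_ge0 (`|d x y| - `|v x|); rewrite sqrrB !real_normK ?num_real //; lra.
move=> _ _ E.
transitivity (\int[mu]_(x in setT) (\int[mu]_(y in I11) (v x * (d x y * u y)))).
  by apply: Rint_eq => x _; rewrite RintegralZl ?expr2 //; exact: Dop_itg.
rewrite E; apply: Rint_eq => y yI.
rewrite -[v y]Dop_reproduces -RintegralZl //; last exact: dv_itg.
by apply: Rint_eq => x _; ring.
Qed.

(** Expand the square of u - v over (-1,1) and replace the cross term by the energy of v
    on the whole line. *)
Lemma Dop_interior_exterior :
  \int[mu]_(x in I11) v x ^+ 2 + 2 * \int[mu]_(x in O11) v x ^+ 2 <= \int[mu]_(x in I11) u x ^+ 2.
Proof.
have v2 := Dop_sq_itg; have v2I := itg_sub measurableT mI (@subsetT _ I11) v2.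
have u2 : itg I11 (fun x => u x ^+ 2).
  apply: (@itg_bdd _ _ (M ^+ 2)); first exact: measurable_funX.
  by move=> x /uM H; rewrite normrX ler_pXn2r ?nnegrE // (le_trans _ H).
have uv : itg I11 (fun x => u x * v x).
  apply: (itg_dom mI _ (itgD mI u2 v2I)).
    by apply: measurable_funM => //; exact: Dop_meas.
  move=> x _; rewrite normrM.
  have := sqr_ge0 (`|u x| - `|v x|); rewrite sqrrB !real_normK ?num_real //.
  have := sqr_ge0 (v x); have := sqr_ge0 (u x); lra.
have H : 0 <= \int[mu]_(x in I11) (u x - v x) ^+ 2 by apply: Rintegral_ge0 => x _; exact: sqr_ge0.
have E : \int[mu]_(x in I11) (u x - v x) ^+ 2 =
    \int[mu]_(x in I11) u x ^+ 2 + \int[mu]_(x in I11) v x ^+ 2 - 2 * \int[mu]_(x in I11) (u x * v x).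
  rewrite -RintegralZl // -RintegralD // -RintegralB //; [|exact: itgD|exact: itgZ].
  by apply: Rint_eq => x _; ring.
move: H; rewrite E -Dop_energy (Rint_setTIO v2); lra.
Qed.

End Energy.

(** * Approximation of the Dirichlet kernel by its shifts *)

Section Shifts.
Variable R : realType.
Local Notation mu := (@lebesgue_measure R).
Local Notation T := (measurableTypeR R).
Local Notation I11 := (@itv11 R).
Local Notation O11 := (~` I11).
Implicit Types (z w h : R[i]).
Let mI := @itv11_meas R.
Let mO : measurable O11 := measurableC mI.

Lemma normc_exp z n : normc (z ^+ n) = normc z ^+ n.
Proof. by elim: n => [|n IH]; rewrite ?expr0 ?normc_1 // !exprS normcM IH. Qed.

Lemma cexp_nat z n : cexp (n%:R * z) = cexp z ^+ n.
Proof.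
elim: n => [|n IH]; first by rewrite mul0r cexp0 expr0.
by rewrite -natr1 mulrDl mul1r cexpD IH exprSr.
Qed.

Lemma one_sub_pow (q : R[i]) K : normc q <= 2 ->
  normc (1 - q ^+ K) <= K%:R * 2 ^+ K * normc (1 - q).
Proof.
move=> q2; elim: K => [|K IH]; first by rewrite expr0 subrr normc_0 mul0r mul0r.
rewrite (_ : 1 - q ^+ K.+1 = (1 - q ^+ K) + q ^+ K * (1 - q)); last by rewrite exprSr; ring.
apply: le_trans (normcD _ _) _; rewrite normcM normc_exp.
have qK : normc q ^+ K <= 2 ^+ K by rewrite lerXn2r ?nnegrE ?normc_ge0.
have := ler_wpM2r (normc_ge0 (1 - q)) qK.
have K0 : 0 <= K%:R * 2 ^+ K * normc (1 - q).
  by rewrite !mulr_ge0 ?normc_ge0 // exprn_ge0.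
have P0 : 0 <= 2 ^+ K * normc (1 - q) by rewrite !mulr_ge0 ?normc_ge0 // exprn_ge0.
rewrite -natr1 [2 ^+ K.+1]exprS; move: IH K0 P0; set k : R := K%:R; set P : R := 2 ^+ K.
set D := normc (1 - q); set X := normc (1 - _); set Y := normc q ^+ K; nra.
Qed.

(** Put q = 1 - (1 - w)^N. It is divisible by w, so q^K only contains powers w^i with i
    >= K, and q^K differs from 1 by at most K 2^K 2^-N. *)
Lemma shift_poly (K : nat) (e : R) : 0 < e -> exists p : {poly R[i]}, forall w,
  normc (1 - w) <= 1 / 2 -> normc (1 - \sum_(i < size p) p`_i * w ^+ (K + i)) <= e.
Proof.
move=> e0.
have [N NP] : exists N, K%:R * 2 ^+ K * (1 / 2) ^+ N <= e.
  have hc : geometric (K%:R * 2 ^+ K) (1 / 2 : R) @ \oo --> (0 : R).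
    by apply: cvg_geometric; rewrite ger0_norm //; lra.
  move/cvgrPdist_lt : hc => /(_ e e0)[N _ /(_ N (leqnn N))].
  rewrite /geometric /= sub0r normrN => H; exists N; apply: le_trans (ltW H); exact: ler_norm.
exists ((\sum_(j < N) (1 - 'X) ^+ j) ^+ K) => w hw.
set p := _ ^+ K.
have -> : \sum_(i < size p) p`_i * w ^+ (K + i) = w ^+ K * p.[w].
  rewrite horner_coef mulr_sumr; apply: eq_bigr => i _; rewrite exprD; ring.
have -> : w ^+ K * p.[w] = (1 - (1 - w) ^+ N) ^+ K.
  rewrite /p horner_exp -exprMn; congr (_ ^+ K).
  rewrite horner_sum (eq_bigr (fun j : 'I_N => (1 - w) ^+ j)); last first.
    by move=> j _; rewrite horner_exp hornerD hornerN hornerX hornerC.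
  by have := subrX1 (1 - w) N => E; rewrite -[RHS]opprB E; ring.
set dl := (1 - w) ^+ N.
have dle : normc dl <= (1 / 2) ^+ N.
  by rewrite normc_exp lerXn2r ?nnegrE ?normc_ge0 //; lra.
have d1 : normc dl <= 1 by apply: le_trans dle _; rewrite exprn_ile1 //; lra.
apply: le_trans (@one_sub_pow (1 - dl) K _) _.
  by apply: le_trans (normcD _ _) _; rewrite normc_1 normcN; lra.
rewrite opprB addrC subrK; apply: le_trans NP.
by rewrite ler_wpM2l // mulr_ge0 // exprn_ge0.
Qed.

Variable s : R.
Hypothesis s0 : 0 < s.

(** On the Fourier side a shift by h is multiplication by w = exp(i h xi), which is
    close to 1 for |xi| <= s when h is small, and K shifts by h add up to 2. *)
Lemma sinc_shifts (e : R) : 0 < e -> exists (n : nat) (r : nat -> R[i]) (a : nat -> R),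
  (forall i, 2 <= a i) /\ forall x : R,
  normc (sinc s x%:C - \sum_(i < n) r i * sinc s (x + a i)%:C) <= e.
Proof.
(* K > 8 s ensures h s <= 1/4, hence |1 - w| <= 2 h s <= 1/2 for every frequency *)
move=> e0; pose K := (Num.truncn (8 * s)).+1; pose h : R := 2 / K%:R.
have K0 : 0 < K%:R :> R by rewrite ltr0n.
have KS : 8 * s < K%:R by exact: truncnS_gt.
have hs : h * s <= 1 / 4.
  by rewrite /h mulrAC ler_pdivrMr //; lra.
have h0 : 0 < h by rewrite divr_gt0.
have e1 : 0 < e * pi / s by rewrite divr_gt0 // mulr_gt0 // pi_gt0.
have [p pP] := shift_poly K e1.
exists (size p), (fun i => p`_i), (fun i => h * (K + i)%:R); split.
  move=> i; rewrite natrD mulrDr {1}/h divfK ?gt_eqF // lerDl mulr_ge0 // ltW //.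
move=> x; have ss : - s <= s by rewrite ge0_cp ?(ltW s0).
pose E (i : nat) (t : R) := cexp (t%:C * ('i * (x + h * (K + i)%:R)%:C)) : R[i].
pose F (t : R) := cexp (t%:C * ('i * x%:C)) : R[i].
have Ei i : Cintegrable `[- s, s] (E i) by exact: cexp_line_citg.
have [Si SE] := Citg_sum (size p) (measurable_itv `[- s, s]) (fun i => CitgZ p`_i (measurable_itv _) (Ei i)).
have -> : sinc s x%:C - \sum_(i < size p) p`_i * sinc s (x + h * (K + i)%:R)%:C =
    (2 * pi%:C)^-1 * Cintegral `[- s, s] (fun t => F t - \sum_(i < size p) p`_i * E i t).
  rewrite CintB //; last exact: cexp_line_citg.
  rewrite mulrBr -sinc_integral ?ltW // SE mulr_sumr; congr (_ - _).
  apply: eq_bigr => i _; rewrite sinc_integral ?ltW // CintZ //; ring.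
rewrite normcM normcV normcM normc_R ger0_norm ?pi_ge0 //.
have -> : normc (2 : R[i]) = 2.
  by rewrite (_ : 2 = (2 : R)%:C) ?normc_R ?ger0_norm // rmorphMn.
have -> : e = (2 * pi)^-1 * (e * pi / s * (s - - s)).
  by rewrite opprK; have := pi_gt0 R; move: (pi) => P P0; field; rewrite ?gt_eqF.
rewrite ler_wpM2l ?invr_ge0 ?mulr_ge0 ?pi_ge0 // -Rint_len //.
apply: Cint_norm => //; first by apply: CitgB => //; exact: cexp_line_citg.
  by apply: itg_cont => u _; exact: cvg_cst.
move=> t tI; have ts : - s <= t <= s by move: tI; rewrite /= in_itv.
pose w := cexp (0 +i* (t * h)) : R[i].
have EE i : E i t = F t * w ^+ (K + i).
  rewrite /E /F /w -cexp_nat -cexpD; congr cexp; apply: eqC.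
    rewrite ReD !ReM /= -[((K + i)%:R : R[i])](rmorph_nat (real_complex R)) /=; ring.
  rewrite ImD !ImM /= -[((K + i)%:R : R[i])](rmorph_nat (real_complex R)) /=; ring.
have -> : F t - \sum_(i < size p) p`_i * E i t = F t * (1 - \sum_(i < size p) p`_i * w ^+ (K + i)).
  rewrite mulrBr mulr1 mulr_sumr; congr (_ - _); apply: eq_bigr => i _; rewrite EE; ring.
have n1 : normc (F t) <= 1.
  by have := @cexp_line_norm R t s x%:C ts; rewrite (_ : Im x%:C = 0) // normr0 mulr0 expR0.
rewrite normcM -[leRHS]mul1r; apply: ler_pM; rewrite ?normc_ge0 //.
apply: pP; rewrite normcB; apply: le_trans (cexp_imag_dist _) _.
have ts' : `|t| <= s by rewrite ler_norml.
rewrite normrM (gtr0_norm h0); have := ler_wpM2r (ltW h0) ts'; lra.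
Qed.

End Shifts.

(** * Strict contractivity *)

Section Contraction.
Variable R : realType.
Local Notation mu := (@lebesgue_measure R).
Local Notation T := (measurableTypeR R).
Local Notation I11 := (@itv11 R).
Local Notation O11 := (~` I11).
Let mI := @itv11_meas R.
Let mO : measurable O11 := measurableC mI.

(** A shift by at least 2 moves (-1,1) into its complement. *)
Lemma shifted_energy (f : R -> R) (a : R) : (forall x, 0 <= f x) -> itg setT f -> 2 <= a ->
  itg I11 (fun x => f (x + a)) /\
  \int[mu]_(x in I11) f (x + a) <= \int[mu]_(x in O11) f x.
Proof.
move=> f0 fi a2; pose g := f \_ O11.
have fO : itg O11 f by exact: itg_sub fi.
have gi : itg setT g.
  by rewrite /itg /g -restrict_EFin; apply: (proj1 (integrable_mkcond _ _)) => //; exact: fO.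
have [gai ga] := itg_translate a gi.
have [fai _] := itg_translate a fi.
split; first exact: itg_sub fai.
rewrite [leRHS]Rintegral_mkcond -/g -ga (Rint_setTIO gai).
rewrite (_ : \int[mu]_(x in I11) f (x + a) = \int[mu]_(x in I11) g (x + a)).
  rewrite lerDl; apply: Rintegral_ge0 => x _; rewrite /g /patch; by case: ifP.
apply: Rint_eq => x; rewrite /itv11 /= in_itv /= => /andP[x1 x2].
rewrite /g /patch mem_set // /itv11 /= in_itv /= => /andP[_]; lra.
Qed.

Lemma shifted_sum_energy (n : nat) (r : nat -> R[i]) (a : nat -> R) : (forall i, 2 <= a i) ->
  exists2 C : R, 0 <= C & forall W : R -> R[i], Cmeasurable setT W ->
    itg setT (fun x => normc (W x) ^+ 2) ->
    [/\ Cmeasurable setT (fun x : R => \sum_(i < n) r i * W (x + a i)),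
        itg I11 (fun x => normc (\sum_(i < n) r i * W (x + a i)) ^+ 2) &
        \int[mu]_(x in I11) normc (\sum_(i < n) r i * W (x + a i)) ^+ 2 <=
        C * \int[mu]_(x in O11) normc (W x) ^+ 2].
Proof.
move=> a2; elim: n => [|n [C C0 IH]].
  exists 0 => // W _ _; rewrite (_ : (fun x => _) = fun=> 0); last first.
    by apply: funext => x; rewrite big_ord0.
  rewrite (_ : (fun x : R => normc (\sum_(i < 0) _) ^+ 2) = fun=> 0); last first.
    by apply: funext => x; rewrite big_ord0 normc_0 expr0n.
  split.
  - by split; exact: measurable_cst.
  - exact: itg_cst11.
  - by rewrite mul0r Rint_cst11 mulr0.
exists (2 * C + 2 * normc (r n) ^+ 2); first by rewrite addr_ge0 // mulr_ge0 // sqr_ge0.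
move=> W mW W2; have [mS iS lS] := IH W mW W2.
have [iT lT] := shifted_energy (fun x => sqr_ge0 (normc (W x))) W2 (a2 n).
pose S (x : R) : R[i] := \sum_(i < n) r i * W (x + a i).
have E x : \sum_(i < n.+1) r i * W (x + a i) = S x + r n * W (x + a n) by rewrite big_ord_recr.
rewrite (_ : (fun x => \sum_(i < n.+1) _) = fun x => S x + r n * W (x + a n)); last first.
  by apply: funext.
rewrite (_ : (fun x => normc (\sum_(i < n.+1) _) ^+ 2) = fun x => normc (S x + r n * W (x + a n)) ^+ 2); last first.
  by apply: funext => x; rewrite E.
have mT : Cmeasurable setT (fun x : R => S x + r n * W (x + a n)).
  apply: CmeasD => //; apply: (CmeasM (f := fun=> _)); first by split; exact: measurable_cst.
  have ma : measurable_fun setT (fun x : R => x + a n) by exact: measurable_funD.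
  by have [w1 w2] := mW; split; [exact: (measurableT_comp w1)|exact: (measurableT_comp w2)].
pose G (x : R) : R := 2 * normc (S x) ^+ 2 + (2 * normc (r n) ^+ 2) * normc (W (x + a n)) ^+ 2.
have SG x : normc (S x + r n * W (x + a n)) ^+ 2 <= G x.
  have := normcD_sq (S x) (r n * W (x + a n)); rewrite normcM exprMn.
  by rewrite (mulrA _ (normc (r n) ^+ 2)).
have Gi : itg I11 G by apply: itgD => //; exact: itgZ.
have Ti : itg I11 (fun x => normc (S x + r n * W (x + a n)) ^+ 2).
  apply: (itg_dom mI _ Gi).
    by apply: Cmeas_normc2; have [m1 m2] := mT; split; apply: measurable_funS _ m1 || apply: measurable_funS _ m2.
  by move=> x _; rewrite ger0_norm ?sqr_ge0.
split => //.
apply: (@le_trans _ _ (\int[mu]_(x in I11) G x)).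
  by apply: (@le_Rintegral _ _ _ mu I11 _ _ mI Ti Gi).
rewrite /G RintegralD //; [|exact: itgZ|exact: itgZ].
rewrite !RintegralZl //; have := ler_wpM2l (sqr_ge0 (normc (r n))) lT.
move: lS; rewrite -/(S _).
move: (\int[mu]_(x in O11) _) (\int[mu]_(x in I11) normc (W _) ^+ 2) (normc (r n) ^+ 2).
move: (\int[mu]_(x in I11) _) => a1 a3 a4 a5; lra.
Qed.

Variable s : R.
Hypothesis s0 : 0 < s.

Lemma sq_mean (u : R -> R) : itg I11 (fun x => `|u x|) -> itg I11 (fun x => u x ^+ 2) ->
  (\int[mu]_(x in I11) `|u x|) ^+ 2 <= 2 * \int[mu]_(x in I11) u x ^+ 2.
Proof.
move=> u1 u2; set U := \int[mu]_(x in I11) `|u x|.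
have H : 0 <= \int[mu]_(x in I11) (`|u x| - U / 2) ^+ 2.
  by apply: Rintegral_ge0 => x _; exact: sqr_ge0.
have E : \int[mu]_(x in I11) (`|u x| - U / 2) ^+ 2 =
    \int[mu]_(x in I11) u x ^+ 2 - U * U + 2 * (U / 2) ^+ 2.
  rewrite -Rint_cst11 -[X in _ - U * X]/(\int[mu]_(x in I11) `|u x|) -RintegralZl // -RintegralB //; last exact: itgZ.
  rewrite -RintegralD //; [|by apply: itgB => //; exact: itgZ|exact: itg_cst11].
  by apply: Rint_eq => x _; rewrite -[u x ^+ 2]real_normK ?num_real //; field.
move: H; rewrite E expr2; nra.
Qed.

(** Let A and B be the energies of v = D u inside and outside (-1,1), and u2 the energy
    of u. Up to a small multiple of u2, the shift approximation bounds A by a constant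
    times B; together with A + 2 B <= u2 this prevents A from being close to u2. *)
Lemma contraction : exists2 q : R, 0 < q < 1 & forall (u : R -> R) (M : R),
  measurable_fun I11 u -> (forall y, I11 y -> `|u y| <= M) ->
  \int[mu]_(x in I11) Dop s u x ^+ 2 <= q ^+ 2 * \int[mu]_(x in I11) u x ^+ 2.
Proof.
(* An approximation error 1/4 costs 4 (U / 4)^2 <= u2 / 2, where U is the integral of
   |u| and U^2 <= 2 u2. *)
have e0 : 0 < 1 / 4 :> R by lra.
have [n [r [a [a2 ra]]]] := sinc_shifts s0 e0.
have [C C0 CP] := shifted_sum_energy n r a2.
(* A <= 2 C B + u2 / 2 and A + 2 B <= u2 give (C + 1) A <= (C + 1 / 2) u2 *)
pose Q := (2 * C + 1) / (2 * C + 2).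
have c2 : 0 < 2 * C + 2 by lra.
have Q0 : 0 < Q by rewrite divr_gt0 //; lra.
have Q1 : Q < 1 by rewrite ltr_pdivrMr //; lra.
exists (Num.sqrt Q); first by rewrite sqrtr_gt0 Q0 -[ltRHS]sqrtr1 ltr_sqrt.
move=> u M mu_ uM; rewrite sqr_sqrtr ?(ltW Q0) //.
have ui : itg I11 u by exact: itg_bdd uM.
have un : itg I11 (fun x => `|u x|) := integrable_norm ui.
have u2 : itg I11 (fun x => u x ^+ 2).
  apply: (@itg_bdd _ _ (M ^+ 2)); first exact: measurable_funX.
  by move=> x /uM H; rewrite normrX ler_pXn2r ?nnegrE // (le_trans _ H).
pose V := bandlim s (fun t => (u t)%:C).
have Ui : Cintegrable I11 (fun t => (u t)%:C) by exact: Citg_real.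
have [hV _ V2] : PW s V by exact: PW_bandlim.
have VE x : normc (V x%:C) ^+ 2 = Dop s u x ^+ 2.
  by rewrite /V Dop_bandlim normc_R real_normK ?num_real.
pose W (x : R) := V x%:C.
have mW : Cmeasurable setT W by exact: Cmeas_real.
have [mS iS lS] := CP W mW V2.
pose S (x : R) : R[i] := \sum_(i < n) r i * W (x + a i).
set U := \int[mu]_(x in I11) `|u x|.
have U0 : 0 <= U by apply: Rintegral_ge0.
have ES x : I11 x -> normc (W x - S x) <= 1 / 4 * U.
  move=> xI.
  pose f i (t : R) := r i * (sinc s ((x + a i)%:C - t%:C) * (u t)%:C).
  have fi i : Cintegrable I11 (f i) by apply: CitgZ => //; exact: bandlim_citg.
  have [Si SE] := Citg_sum n mI fi.
  have -> : W x - S x = Cintegral I11 (fun t => sinc s (x%:C - t%:C) * (u t)%:C - \sum_(i < n) f i t).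
    rewrite CintB //; last exact: bandlim_citg.
    rewrite SE; congr (_ - _); apply: eq_bigr => i _.
    by rewrite /f CintZ //; exact: bandlim_citg.
  rewrite /U -RintegralZl //; apply: Cint_norm => //.
  - by apply: CitgB => //; exact: bandlim_citg.
  - exact: itgZ.
  move=> t _; rewrite (_ : _ - _ = (sinc s (x - t)%:C - \sum_(i < n) r i * sinc s (x - t + a i)%:C) * (u t)%:C).
    by rewrite normcM normc_R ler_wpM2r.
  rewrite mulrBl mulr_suml rmorphB; congr (_ - _); apply: eq_bigr => i _.
  rewrite /f mulrA; congr (_ * sinc _ _ * _).
  by rewrite -(rmorphB (real_complex R)); congr (_%:C); ring.
have V2I : itg I11 (fun x => Dop s u x ^+ 2).
  by apply: itg_sub (Dop_sq_itg s0 mu_ uM).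
set A := \int[mu]_(x in I11) Dop s u x ^+ 2; set u2' := \int[mu]_(x in I11) u x ^+ 2.
set B := \int[mu]_(x in O11) Dop s u x ^+ 2.
have AB : A + 2 * B <= u2' := Dop_interior_exterior s0 mu_ uM.
have WB : \int[mu]_(x in O11) normc (W x) ^+ 2 = B by apply: Rint_eq => x _; exact: VE.
have US : U ^+ 2 <= 2 * u2' by exact: sq_mean.
have AC : A <= 2 * (C * B) + 1 / 4 * U ^+ 2.
  pose G (x : R) : R := 2 * normc (S x) ^+ 2 + 2 * (1 / 4 * U) ^+ 2.
  have Gi : itg I11 G by apply: itgD => //; [exact: itgZ|exact: itg_cst11].
  apply: (@le_trans _ _ (\int[mu]_(x in I11) G x)).
    apply: (@le_Rintegral _ _ _ mu I11 _ _ mI V2I Gi) => x xI.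
    rewrite -VE -/(W x) -[W x](subrK (S x)) addrC.
    apply: le_trans (normcD_sq _ _) _; rewrite /G lerD2l ler_wpM2l //.
    by rewrite ler_pXn2r ?nnegrE ?normc_ge0 ?mulr_ge0 // ?ES //; lra.
  rewrite /G RintegralD //; [|exact: itgZ|exact: itg_cst11].
  rewrite RintegralZl // Rint_cst11; move: lS; rewrite WB -/(S _) => lS.
  rewrite lerD //; first by rewrite ler_wpM2l.
  rewrite exprMn; lra.
rewrite /Q mulrAC ler_pdivlMr //.
have B0 : 0 <= B by apply: Rintegral_ge0 => x _; exact: sqr_ge0.
have := ler_wpM2l C0 AB; lra.
Qed.

End Contraction.

(** * The Neumann series of the resolvent kernel *)

Section Resolvent.
Variable R : realType.
Local Notation mu := (@lebesgue_measure R).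
Local Notation T := (measurableTypeR R).
Local Notation I11 := (@itv11 R).
Let mI := @itv11_meas R.
Variable s : R.
Hypothesis s0 : 0 < s.
Local Notation d := (dirichlet_kernel s).

(** The kernel of the (n+1)-st power of D, as a function of its first argument x. *)
Fixpoint iterk (n : nat) (y x : R) : R :=
  if n is m.+1 then Dop s (iterk m y) x else d x y.

Let m := s / pi.
Let m0 : 0 < m. Proof. by rewrite divr_gt0 // pi_gt0. Qed.

Lemma iterk_meas_bdd n : (forall y D, measurable D -> measurable_fun D (iterk n y)) /\
  exists M : R, forall y x, `|iterk n y x| <= M.
Proof.
elim: n => [|n [IHm [M HM]]].
  by split; [move=> y D; exact: dir_meas1|exists m => y x; exact: dir_le].
have IHI y := IHm y I11 mI.
split=> [y D mD|]; first by apply: (Dop_meas s0 (IHI y) (M := M)) => // x _; exact: HM.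
exists (2 * (m * M)) => y x; rewrite -Rint_cst11; apply: Rint_norm => //.
- by apply: (Dop_itg s0 (IHI y) (M := M)) => // t _; exact: HM.
- exact: itg_cst11.
- by move=> t _; rewrite normrM ler_pM // dir_le.
Qed.

Lemma iterk_meas n y (D : set R) : measurable D -> measurable_fun D (iterk n y).
Proof. by move=> mD; have [h _] := iterk_meas_bdd n; exact: h. Qed.

Lemma iterk_itg n y x : itg I11 (fun t => d x t * iterk n y t).
Proof.
have [_ [M HM]] := iterk_meas_bdd n.
by apply: (Dop_itg s0 (iterk_meas n y mI) (M := M)) => t _; exact: HM.
Qed.

(** Contractivity makes the L^2 norms decrease geometrically. One more application of D
    gives a uniform bound, through the inequality 2 |a b| <= q^n a^2 + q^-n b^2. *)
Lemma iterk_geometric : exists q C : R, [/\ 0 < q, q < 1, 0 < C &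
  forall n y x, `|iterk n y x| <= C * q ^+ n].
Proof.
have [q /andP[q0 q1] qP] := contraction s0.
exists q, (m + 2 * m ^+ 2 / q).
have C1 : 0 < 2 * m ^+ 2 / q by rewrite divr_gt0 // mulr_gt0 // exprn_gt0.
split => //; first by rewrite addr_gt0.
have d2 x : itg I11 (fun t => d x t ^+ 2).
  apply: (@itg_bdd _ _ (m ^+ 2)); first by apply: measurable_funX; exact: dir_meas2.
  by move=> t _; rewrite normrX ler_pXn2r ?nnegrE ?(ltW m0) // dir_le.
have d2m x : \int[mu]_(t in I11) d x t ^+ 2 <= 2 * m ^+ 2.
  rewrite -Rint_cst11; apply: (@le_Rintegral _ _ _ mu I11 _ _ mI (d2 x) (itg_cst11 _)) => t _.
  by rewrite -real_normK ?num_real // ler_pXn2r ?nnegrE ?(ltW m0) // dir_le.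
have E n y : \int[mu]_(t in I11) iterk n y t ^+ 2 <= 2 * m ^+ 2 * (q ^+ n) ^+ 2.
  elim: n => [|n IH].
    rewrite expr0 expr1n mulr1 (_ : \int[mu]_(t in I11) _ = \int[mu]_(t in I11) d y t ^+ 2) //.
    by apply: Rint_eq => t _; rewrite /= dir_sym.
  have [_ [M HM]] := iterk_meas_bdd n.
  apply: le_trans (qP (iterk n y) M (iterk_meas n y mI) _) _; first by move=> t _; exact: HM.
  rewrite (_ : _ * (q ^+ n.+1) ^+ 2 = q ^+ 2 * (2 * m ^+ 2 * (q ^+ n) ^+ 2)); last by rewrite (exprSr q); ring.
  by rewrite ler_wpM2l ?sqr_ge0.
move=> [|n] y x.
  by rewrite expr0 mulr1; apply: le_trans (dir_le s0 x y) _; rewrite lerDl ltW.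
have [_ [M HM]] := iterk_meas_bdd n.
have qn : 0 < q ^+ n by exact: exprn_gt0.
have u2 : itg I11 (fun t => iterk n y t ^+ 2).
  apply: (@itg_bdd _ _ (M ^+ 2)); first by apply: measurable_funX; exact: iterk_meas.
  by move=> t _; rewrite normrX ler_pXn2r ?nnegrE // (le_trans _ (HM y t)).
pose G t := q ^+ n / 2 * d x t ^+ 2 + (2 * q ^+ n)^-1 * iterk n y t ^+ 2.
have Gi : itg I11 G by apply: itgD => //; exact: itgZ.
apply: (@le_trans _ _ (\int[mu]_(t in I11) G t)).
  apply: Rint_norm => //; first exact: iterk_itg.
  move=> t _; rewrite /G normrM.
  have : 0 <= (q ^+ n * `|d x t| - `|iterk n y t|) ^+ 2 / (2 * q ^+ n).
    by rewrite divr_ge0 ?sqr_ge0 // mulr_ge0 // ltW.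
  rewrite -[d x t ^+ 2]real_normK ?num_real // -[iterk n y t ^+ 2]real_normK ?num_real //.
  move: (q ^+ n) qn `|d x t| `|iterk n y t| => p p0 a b.
  rewrite (_ : (p * a - b) ^+ 2 / (2 * p) = p / 2 * a ^+ 2 + (2 * p)^-1 * b ^+ 2 - a * b).
    by rewrite subr_ge0.
  by field; rewrite gt_eqF.
rewrite /G RintegralD //; [|exact: itgZ|exact: itgZ].
rewrite !RintegralZl //; last exact: d2.
rewrite (exprSr q).
have h1 := ler_wpM2l (ltW (divr_gt0 qn (ltr0Sn R 1))) (d2m x).
have p0 : 0 <= (2 * q ^+ n)^-1 by rewrite invr_ge0 mulr_ge0 // ltW.
have h2 := ler_wpM2l p0 (E n y).
apply: (le_trans (lerD h1 h2)).
have E1 : q ^+ n / 2 * (2 * m ^+ 2) + (2 * q ^+ n)^-1 * (2 * m ^+ 2 * (q ^+ n) ^+ 2) =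
    2 * m ^+ 2 * q ^+ n.
  by move: (q ^+ n) qn m => p pp r; field; rewrite ?gt_eqF.
have E2 : (m + 2 * m ^+ 2 / q) * (q ^+ n * q) = m * (q ^+ n * q) + 2 * m ^+ 2 * q ^+ n.
  by move: (q ^+ n) m => p r; field; rewrite ?gt_eqF.
by rewrite E1 E2 lerDr (mulr_ge0 (ltW m0)) // mulr_ge0 // ltW.
Qed.

Definition rsv_part (n : nat) (y x : R) : R := series (fun k => iterk k y x) n.
Definition rsv (x y : R) : R := limn (fun n => rsv_part n y x).

Lemma rsv_part_cvg x y : rsv_part n y x @[n --> \oo] --> rsv x y.
Proof.
have [q [C [q0 q1 C0 H]]] := iterk_geometric.
suff : cvgn (series (fun k => iterk k y x)) by [].
apply: normed_cvg; apply: (@series_le_cvg _ _ (geometric C q)) => //.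
- by move=> n; exact: normr_ge0.
- by move=> n; rewrite /geometric /= mulr_ge0 ?(ltW C0) // exprn_ge0 // ltW.
- by move=> n; exact: H.
- by apply: is_cvg_geometric_series; rewrite ger0_norm // ltW.
Qed.

Lemma rsv_part_bdd : exists2 B : R, 0 < B & forall n y x, `|rsv_part n y x| <= B.
Proof.
have [q [C [q0 q1 C0 H]]] := iterk_geometric.
have q1' : 0 < 1 - q by rewrite subr_gt0.
exists (C / (1 - q)); first by rewrite divr_gt0.
move=> n y x; apply: (@le_trans _ _ (C * (1 - q ^+ n) / (1 - q))).
  elim: n => [|n IH]; first by rewrite /rsv_part /series /= big_geq // normr0 expr0 subrr mulr0 mul0r.
  rewrite /rsv_part seriesSr; apply: le_trans (ler_normD _ _) _.
  apply: (le_trans (lerD IH (H n y x))); rewrite exprSr.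
  by move: (q ^+ n) => p; rewrite -subr_ge0 (_ : _ - _ = 0) //; field; rewrite gt_eqF.
rewrite ler_wpM2r ?invr_ge0 ?(ltW q1') // -[leRHS]mulr1 ler_wpM2l ?(ltW C0) //.
by rewrite lerBlDr lerDl exprn_ge0 // ltW.
Qed.

Lemma rsv_part_meas n y (D : set R) : measurable D -> measurable_fun D (rsv_part n y).
Proof.
move=> mD; elim: n => [|n IH].
  rewrite (_ : rsv_part 0 y = fun=> 0); first exact: measurable_cst.
  by apply: funext => x; rewrite /rsv_part /series /= big_geq.
rewrite (_ : rsv_part n.+1 y = fun x => rsv_part n y x + iterk n y x).
  by apply: measurable_funD => //; exact: iterk_meas.
by apply: funext => x; rewrite /rsv_part seriesSr.
Qed.

(** The recursion of the partial sums, whose limit is the resolvent equation. *)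
Lemma rsv_part_rec n y x : rsv_part n.+1 y x = d x y + Dop s (rsv_part n y) x.
Proof.
have [B _ BP] := rsv_part_bdd.
elim: n => [|n IH].
  rewrite /rsv_part seriesSr {1}/series /= big_geq // add0r /Dop.
  rewrite (_ : Rintegral _ _ _ = 0) ?addr0 //.
  rewrite (_ : (fun y0 => _) = fun=> 0); first by rewrite /Rintegral integral0.
  by apply: funext => t; rewrite /series /= big_geq // mulr0.
rewrite /rsv_part seriesSr -[series _ n.+1]/(rsv_part n.+1 y x) IH -addrA; congr (_ + _).
rewrite /= /Dop -RintegralD //; last exact: iterk_itg.
  by apply: Rint_eq => t _; rewrite -mulrDr /rsv_part seriesSr.
by apply: (Dop_itg s0 (rsv_part_meas n y mI) (M := B)) => t _; exact: BP.
Qed.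

Lemma rsv_bdd : exists2 B : R, 0 < B & forall x y, `|rsv x y| <= B.
Proof.
have [B B0 BP] := rsv_part_bdd; exists B => // x y.
have cv : cvgn (fun n => rsv_part n y x) by apply/cvg_ex; eexists; exact: rsv_part_cvg.
by rewrite ler_norml /rsv; apply/andP; split; [apply: limr_ge|apply: limr_le] => //;
  apply: nearW => n; have := BP n y x; rewrite ler_norml => /andP[].
Qed.

Lemma rsv_meas1 y (D : set R) : measurable D -> measurable_fun D (rsv^~ y).
Proof.
move=> mD; apply: (@measurable_fun_cvg _ _ _ D (fun n => rsv_part n y)).
  by move=> n; exact: rsv_part_meas.
by move=> x _; exact: rsv_part_cvg.
Qed.

(** The resolvent equation R = D + D R, by dominated convergence in the recursion of the
    partial sums. *)
Lemma rsv_eql x y : rsv x y = d x y + \int[mu]_(t in I11) (d x t * rsv t y).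
Proof.
have [B B0 BP] := rsv_part_bdd.
have [||||_ cv] := @Rint_dct R I11 (fun n t => d x t * rsv_part n y t) (fun t => d x t * rsv t y)
  (fun=> m * B) mI.
- by move=> n; apply: measurable_funM; [exact: dir_meas2|exact: rsv_part_meas].
- exact: itg_cst11.
- by move=> n t _; rewrite normrM ler_pM // dir_le.
- by move=> t _; apply: cvgMr; exact: rsv_part_cvg.
have cv2 : d x y + Dop s (rsv_part n y) x @[n --> \oo] --> d x y + \int[mu]_(t in I11) (d x t * rsv t y).
  by apply: cvgD => //; exact: cvg_cst.
have cv1 : rsv_part n.+1 y x @[n --> \oo] --> rsv x y.
  by rewrite (cvg_shiftS (fun n => rsv_part n y x)); exact: rsv_part_cvg.
apply: (@cvg_unique _ (@norm_hausdorff _ R) _ _ _ _ cv1).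
rewrite /= (_ : (fun n => rsv_part n.+1 y x) = fun n => d x y + Dop s (rsv_part n y) x) //.
by apply: funext => n; exact: rsv_part_rec.
Qed.

(** The operator D is self-adjoint, so that R_x integrates against (1 - D) R_y as (1 -
    D) R_x does against R_y, where R_y = R(., y) and (1 - D) R_y is the column of D at
    y. *)
Lemma rsv_sym x y : rsv x y = rsv y x.
Proof.
have [B B0 BP] := rsv_bdd.
have bi a b : itg I11 (fun t => rsv t a * d t b).
  apply: (@itg_bdd _ _ (B * m)); first by apply: measurable_funM; [exact: rsv_meas1|exact: dir_meas1].
  by move=> t _; rewrite normrM ler_pM // dir_le.
have di a b : itg I11 (fun t => d a t * rsv t b).
  apply: (@itg_bdd _ _ (m * B)); first by apply: measurable_funM; [exact: dir_meas2|exact: rsv_meas1].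
  by move=> t _; rewrite normrM ler_pM // dir_le.
have ri a b : itg I11 (fun t => rsv t a * rsv t b).
  apply: (@itg_bdd _ _ (B * B)); first by apply: measurable_funM; exact: rsv_meas1.
  by move=> t _; rewrite normrM ler_pM // dir_le.
have RZ (c : R) (f : R -> R) : itg I11 f ->
    \int[mu]_(t in I11) (c * f t) = c * \int[mu]_(t in I11) f t.
  by move=> fi; rewrite RintegralZl.
have P a b : \int[mu]_(t in I11) (rsv t a * \int[mu]_(r in I11) (d t r * rsv r b)) =
    \int[mu]_(t in I11) (rsv t a * rsv t b) - (rsv b a - d b a).
  have -> : rsv b a - d b a = \int[mu]_(t in I11) (d b t * rsv t a).
    by rewrite rsv_eql addrC addKr.
  rewrite -RintegralB //; [|exact: ri|exact: di].
  apply: Rint_eq => t _; rewrite [rsv t b in RHS]rsv_eql dir_sym; ring.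
have [] := @Rfubini R I11 I11 (fun t r => rsv t x * (d t r * rsv r y)) (fun=> B) (fun=> m * B) mI mI _
   (itg_cst11 _) (itg_cst11 _).
- apply: measurable_funM; first exact: (meas_fst mI mI (rsv_meas1 x mI)).
  apply: measurable_funM; last exact: (meas_snd mI mI (rsv_meas1 y mI)).
  by apply: measurable_funS (dir_meas s0).
- by move=> t r _ _; rewrite !normrM ler_pM ?mulr_ge0 // ler_pM // dir_le.
move=> _ _ F.
have L : \int[mu]_(t in I11) \int[mu]_(r in I11) (rsv t x * (d t r * rsv r y)) =
    \int[mu]_(t in I11) (rsv t x * rsv t y) - (rsv y x - d y x).
  by rewrite -P; apply: Rint_eq => t _; exact: (RZ _ _ (di t y)).
have Q : \int[mu]_(r in I11) \int[mu]_(t in I11) (rsv t x * (d t r * rsv r y)) =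
    \int[mu]_(t in I11) (rsv t x * rsv t y) - (rsv x y - d x y).
  rewrite (_ : \int[mu]_(t in I11) (rsv t x * rsv t y) = \int[mu]_(t in I11) (rsv t y * rsv t x)).
    rewrite -P; apply: Rint_eq => r _; rewrite -(RZ _ _ (di r x)).
    apply: Rint_eq => t _; rewrite (dir_sym s t r); ring.
  by apply: Rint_eq => t _; rewrite mulrC.
by move: F; rewrite L Q => /addrI/oppr_inj; rewrite (dir_sym s y x) => /addIr.
Qed.

Lemma rsv_meas2 x (D : set R) : measurable D -> measurable_fun D (rsv x).
Proof.
move=> mD; rewrite (_ : rsv x = rsv^~ x); first exact: rsv_meas1.
by apply: funext => y; rewrite rsv_sym.
Qed.

Lemma rsv_eqr x y : rsv x y = d x y + \int[mu]_(t in I11) (rsv x t * d t y).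
Proof.
rewrite rsv_sym rsv_eql dir_sym; congr (_ + _); apply: Rint_eq => t _.
by rewrite dir_sym rsv_sym mulrC.
Qed.

End Resolvent.

(** * Joint measurability of the resolvent kernel *)

Section JointMeasurability.
Variable R : realType.
Local Notation mu := (@lebesgue_measure R).
Local Notation T := (measurableTypeR R).
Local Notation I11 := (@itv11 R).
Let mI := @itv11_meas R.
Variable s : R.
Hypothesis s0 : 0 < s.
Local Notation d := (dirichlet_kernel s).

(** Tonelli's theorem is applied to the integrand shifted by a constant that makes it
    nonnegative. *)
Lemma Dop_joint_meas (u : T -> T -> R) (M : R) :
  measurable_fun setT (fun p : T * T => u p.1 p.2) -> (forall y t, `|u y t| <= M) ->
  measurable_fun setT (fun p : T * T => Dop s (u p.1) p.2).
Proof.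
move=> mu_ uM; pose c := s / pi * M.
pose f (q : (T * T) * T) : R := (d q.1.2 q.2 * u q.1.1 q.2 + c) * \1_I11 q.2.
have mf : measurable_fun setT f.
  apply: measurable_funM; last first.
    by apply: (measurableT_comp (measurable_indic mI)); exact: measurable_snd.
  apply: measurable_funD; last exact: measurable_cst.
  have m1 : measurable_fun setT (fun q : (T * T) * T => q.1.1 : T).
    exact: (measurableT_comp measurable_fst measurable_fst).
  have m2 : measurable_fun setT (fun q : (T * T) * T => q.1.2 : T).
    exact: (measurableT_comp measurable_snd measurable_fst).
  apply: measurable_funM.
    exact: (measurableT_comp (dir_meas s0) (measurable_fun_pair m2 measurable_snd)).
  exact: (measurableT_comp mu_ (measurable_fun_pair m1 measurable_snd)).
have du p t : `|d p t.2 * u t.1 t.2| <= c by rewrite normrM ler_pM // dir_le.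
have f0 q : (0 <= (f q)%:E)%E.
  rewrite lee_fin mulr_ge0 //.
  by have := du q.1.2 (q.1.1, q.2); rewrite ler_norml /= => /andP[]; lra.
have mF := @measurable_fun_fubini_tonelli_F _ _ (T * T)%type T R mu (fun q => (f q)%:E).
have {mF} := mF _ f0; move=> /(_ (proj2 (measurable_EFinP _ _) mf)) mF.
have mu1 y : measurable_fun I11 (u y).
  apply: measurable_funS (measurableT) _ _ => //.
  exact: (measurableT_comp mu_ (@pair1_measurable _ _ T T y)).
have di (p : T * T) : itg I11 (fun t => d p.2 t * u p.1 t).
  by apply: (Dop_itg s0 (mu1 p.1) (M := M)) => t _; exact: uM.
have FE p : fubini_F mu (fun q => (f q)%:E) p = (Dop s (u p.1) p.2 + 2 * c)%:E.
  have dci := itgD mI (di p) (itg_cst11 c).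
  rewrite -Rint_cst11 -RintegralD //; [|exact: di|exact: itg_cst11].
  have -> : (\int[mu]_(x in I11) (d p.2 x * u p.1 x + c))%:E =
      (\int[mu]_(x in I11) (d p.2 x * u p.1 x + c)%:E)%E.
    exact: (fineK (@integrable_fin_num _ T R mu I11 mI _ dci)).
  rewrite [RHS]integral_mkcond; apply: eq_integral => t _.
  by rewrite /f patchE indicE /=; case: ifP; rewrite ?mulr1 ?mulr0.
rewrite (_ : (fun p => _) = fun p => fine (fubini_F mu (fun q => (f q)%:E) p) - 2 * c).
  by apply: measurable_funB => //; exact: measurableT_comp.
by apply: funext => p; rewrite FE /= addrK.
Qed.

Lemma iterk_joint_meas n : measurable_fun setT (fun p : T * T => iterk s n p.1 p.2).
Proof.
elim: n => [|n IH].
  rewrite (_ : (fun p : T * T => _) = fun p : T * T => d p.1 p.2); first exact: dir_meas.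
  by apply: funext => p; rewrite /= dir_sym.
have [_ [M HM]] := iterk_meas_bdd s0 n.
exact: (@Dop_joint_meas (fun y t => iterk s n y t) M IH HM).
Qed.

Lemma rsv_meas : measurable_fun setT (fun p : T * T => rsv s p.1 p.2).
Proof.
apply: (@measurable_fun_cvg _ _ _ _ (fun n (p : T * T) => rsv_part s n p.2 p.1)); last first.
  by move=> p _; exact: rsv_part_cvg.
move=> n.
have H : measurable_fun setT (fun p : T * T => rsv_part s n p.1 p.2).
  elim: n => [|n IH].
    rewrite (_ : (fun p : T * T => _) = fun=> 0); first exact: measurable_cst.
    by apply: funext => p; rewrite /rsv_part /series /= big_geq.
  rewrite (_ : (fun p : T * T => _) = fun p : T * T => rsv_part s n p.1 p.2 + iterk s n p.1 p.2).
    by apply: measurable_funD => //; exact: iterk_joint_meas.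
  by apply: funext => p; rewrite /rsv_part seriesSr.
exact: (measurableT_comp H (@measurable_swap _ _ T T)).
Qed.

End JointMeasurability.

(** * Continuation of the resolvent kernel to complex arguments *)

Section ComplexResolvent.
Variable R : realType.
Local Notation mu := (@lebesgue_measure R).
Local Notation T := (measurableTypeR R).
Local Notation I11 := (@itv11 R).
Implicit Types (z w h : R[i]).
Let mI := @itv11_meas R.
Variable s : R.
Hypothesis s0 : 0 < s.
Local Notation d := (dirichlet_kernel s).
Local Notation r := (rsv s).

(** The equation R = D + D R continues the left argument of R, and then R = D + R D, in
    rsvC, the right one. *)
Definition rsvL (z : R[i]) (t : R) : R[i] :=
  sinc s (z - t%:C) + bandlim s (fun u => (r u t)%:C) z.
Definition rsvL' (z : R[i]) (t : R) : R[i] :=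
  sinc' s (z - t%:C) + bandlim' s (fun u => (r u t)%:C) z.
Definition rsvC (z w : R[i]) : R[i] := sinc s (z - w) + bandlim s (rsvL z) w.

Lemma rsv_col_citg t : Cintegrable I11 (fun u => (r u t)%:C).
Proof.
have [B B0 BP] := rsv_bdd s0.
by apply: Citg_real => //; apply: (@itg_bdd _ _ B) => //; exact: rsv_meas1.
Qed.

Lemma rsv_col_norm : exists2 B : R, 0 < B & forall t, \int[mu]_(u in I11) normc (r u t)%:C <= B.
Proof.
have [B B0 BP] := rsv_bdd s0; exists (2 * B); first by rewrite mulr_gt0.
move=> t; rewrite -Rint_cst11; apply: (@le_Rintegral _ _ _ mu I11 _ _ mI _ (itg_cst11 B)).
  exact: Citg_normc (rsv_col_citg t).
by move=> u _; rewrite normc_R.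
Qed.

Let sinc_le z t : normc (sinc s (z - t%:C)) <= s / pi * expR (s * `|Im z|).
Proof. by have := sinc_bound (z - t%:C) (ltW s0); rewrite Im_subr. Qed.

Let sinc'_le z t : normc (sinc' s (z - t%:C)) <= s ^+ 2 / pi * expR (s * `|Im z|).
Proof. by have := sinc'_bound (z - t%:C) (ltW s0); rewrite Im_subr. Qed.

Lemma rsvL_bdd z : exists M : R, forall t, normc (rsvL z t) <= M /\ normc (rsvL' z t) <= M.
Proof.
have [B B0 BP] := rsv_col_norm.
pose E := expR (s * `|Im z|); have E0 : 0 <= E by exact: expR_ge0.
have p0 : 0 <= pi^-1 :> R by rewrite invr_ge0 pi_ge0.
pose M1 := s / pi * E; pose M2 := s ^+ 2 / pi * E.
have M10 : 0 <= M1 by rewrite !mulr_ge0 // ltW.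
have M20 : 0 <= M2 by rewrite !mulr_ge0 // ltW.
exists ((M1 + M2) * (1 + B)) => t.
have b1 := le_trans (bandlim_bound s0 (rsv_col_citg t) z) (ler_wpM2l M10 (BP t)).
have b2 := le_trans (bandlim'_bound s0 (rsv_col_citg t) z) (ler_wpM2l M20 (BP t)).
have := mulr_ge0 M10 (ltW B0); have := mulr_ge0 M20 (ltW B0) => h1 h2.
split; apply: le_trans (normcD _ _) _.
  by have := sinc_le z t; rewrite -/E -/M1; lra.
by have := sinc'_le z t; rewrite -/E -/M2; lra.
Qed.

(** Partial integrals against the resolvent kernel depend measurably on the remaining
    variable. *)
Lemma rsv_transpose_citg (a : R -> R[i]) (M : R) : Cmeasurable I11 a ->
  (forall t, I11 t -> normc (a t) <= M) ->
  Cintegrable I11 (fun t => Cintegral I11 (fun u => a u * (r u t)%:C)).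
Proof.
move=> ma aM; have [B B0 BP] := rsv_bdd s0.
have [] := @kernel_fubini R I11 I11 a (fun=> 1) r (fun=> M * B) (fun=> 1) mI mI (rsv_meas s0) ma _
  (itg_cst11 _) (itg_cst11 _).
- by split; exact: measurable_cst.
- by move=> x y Ix Iy; rewrite normc_1 !mulr1 ler_pM ?normc_ge0 ?aM.
move=> _ h _; apply: (Citg_eq mI _ h) => t _.
by apply: Cint_eq => u _; rewrite mulr1.
Qed.

Lemma rsvL_citg z : Cintegrable I11 (rsvL z) /\ Cintegrable I11 (rsvL' z).
Proof.
split; apply: CitgD => //.
- by apply: (@Citg_bdd _ _ (s / pi * expR (s * `|Im z|))) => // ; exact: sinc_meas_sub.
- apply: (@rsv_transpose_citg (fun u => sinc s (z - u%:C)) (s / pi * expR (s * `|Im z|))) => //.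
  exact: sinc_meas_sub.
- by apply: (@Citg_bdd _ _ (s ^+ 2 / pi * expR (s * `|Im z|))) => // ; exact: sinc'_meas_sub.
- apply: (@rsv_transpose_citg (fun u => sinc' s (z - u%:C)) (s ^+ 2 / pi * expR (s * `|Im z|))) => //.
  exact: sinc'_meas_sub.
Qed.

Lemma rsvL_real (x t : R) : rsvL x%:C t = (r x t)%:C.
Proof.
rewrite /rsvL rsv_eql // rmorphD /= sinc_real; congr (_ + _).
rewrite -Cint_real; apply: Cint_eq => u _; by rewrite sinc_real -rmorphM.
Qed.

Lemma rsvC_PW z : PW s (rsvC z).
Proof. by apply: PWD; [exact: PW_sinc|apply: PW_bandlim => //; exact: (rsvL_citg z).1]. Qed.

(** At real arguments the second continuation adds nothing: exchange the integrals and
    use R = D + R D. *)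
Lemma rsvC_rsvL z (t : R) : rsvC z t%:C = rsvL z t.
Proof.
have [B B0 BP] := rsv_bdd s0; set M := s / pi * expR (s * `|Im z|).
have M0 : 0 <= M by rewrite !mulr_ge0 ?expR_ge0 ?invr_ge0 ?pi_ge0 ?(ltW s0).
have rot3 (a b c : R[i]) : a * (b * c) = b * (c * a) by ring.
rewrite /rsvC /rsvL; congr (_ + _).
have ms : Cmeasurable I11 (fun u : R => sinc s (z - u%:C)) by exact: sinc_meas_sub.
have md : Cmeasurable I11 (fun u => (d u t)%:C) by split => //; exact: dir_meas1.
have [|i1 i2 E] := @kernel_fubini R I11 I11 (fun u : R => sinc s (z - u%:C)) (fun v => (d v t)%:C) r
  (fun=> M * B) (fun=> s / pi) mI mI (rsv_meas s0) ms md (itg_cst11 _) (itg_cst11 _).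
  move=> x y _ _; rewrite normc_R ler_pM ?dir_le ?mulr_ge0 ?normc_ge0 // ler_pM ?normc_ge0 //.
have sd : Cintegrable I11 (fun u : R => sinc s (z - u%:C) * (d u t)%:C).
  apply: (@Citg_bdd _ _ (M * (s / pi))); first exact: CmeasM.
  by move=> u _; rewrite normcM normc_R ler_pM ?normc_ge0 ?dir_le.
transitivity (Cintegral I11 (fun u : R => sinc s (z - u%:C) * (d u t)%:C) +
    Cintegral I11 (fun v => Cintegral I11 (fun u : R => sinc s (z - u%:C) * ((r u v)%:C * (d v t)%:C)))).
  rewrite -(CintD mI sd i2); apply: Cint_eq => v _.
  rewrite sinc_real mulrC mulrDl dir_sym; congr (_ + _).
  rewrite /bandlim mulrC -(CintZ _ mI (bandlim_citg s0 (rsv_col_citg v) z)).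
  by apply: Cint_eq => u _; exact: rot3.
rewrite -E -(CintD mI sd i1); apply: Cint_eq => u _.
have rd : Cintegrable I11 (fun v => (r u v)%:C * (d v t)%:C).
  apply: (@Citg_bdd _ _ (B * (s / pi))).
    apply: (CmeasM (f := fun v => (r u v)%:C) _ md).
    by split; [exact: (rsv_meas2 s0 u mI)|exact: measurable_cst].
  move=> v _; rewrite normcM !normc_R.
  exact: ler_pM (normr_ge0 _) (normr_ge0 _) (BP u v) (dir_le s0 v t).
rewrite (CintZ _ mI rd).
have re : Cintegral I11 (fun v => (r u v)%:C * (d v t)%:C) = (\int[mu]_(v in I11) (r u v * d v t))%:C.
  by rewrite -Cint_real; apply: Cint_eq => v _; rewrite -rmorphM.
rewrite re.
rewrite -mulrDr.
rewrite (rsv_eqr s0 u t).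
by rewrite rmorphD.
Qed.

Lemma rsvC_real (x y : R) : rsvC x%:C y%:C = (r x y)%:C.
Proof. by rewrite rsvC_rsvL rsvL_real. Qed.

Lemma rsvC_eq z w : rsvC z w = sinc s (z - w) + bandlim s (fun t => rsvC z t%:C) w.
Proof.
have -> : (fun t : R => rsvC z t%:C) = rsvL z by apply: funext => t; exact: rsvC_rsvL.
by [].
Qed.

Lemma rsvC_citg z : Cintegrable I11 (fun t => rsvC z t%:C).
Proof. by apply: (Citg_eq mI _ (rsvL_citg z).1) => t _; rewrite rsvC_rsvL. Qed.

Lemma rsvC_bdd z : exists M : R, forall t : R, normc (rsvC z t%:C) <= M.
Proof. by have [M MP] := rsvL_bdd z; exists M => t; rewrite rsvC_rsvL; have [] := MP t. Qed.

Lemma Cint_conj (D : set R) (f : R -> R[i]) : measurable D -> Cintegrable D f ->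
  conjc (Cintegral D f) = Cintegral D (fun t => conjc (f t)).
Proof.
move=> mD [f1 f2]; apply: eqC; rewrite /=.
  by apply: Rint_eq => t _; case: (f t).
rewrite -[LHS]mulN1r -RintegralZl //; apply: Rint_eq => t _; case: (f t) => a b /=.
by rewrite mulN1r.
Qed.

Lemma rsvC_conj z (t : R) : conjc (rsvC (conjc z) t%:C) = rsvC z t%:C.
Proof.
have cR (x : R) : conjc x%:C = x%:C by apply: eqC; rewrite //= oppr0.
have cD (a b : R[i]) : conjc (a + b) = conjc a + conjc b by exact: rmorphD.
have cM (a b : R[i]) : conjc (a * b) = conjc a * conjc b by exact: rmorphM.
have sc (u : R) : conjc (sinc s (conjc z - u%:C)) = sinc s (z - u%:C).
  have := sinc_conj (conjc z - u%:C) (ltW s0) => ->; congr sinc.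
  by case: (z) => a b; apply: eqC; rewrite /=; ring.
rewrite !rsvC_rsvL /rsvL cD sc; congr (_ + _).
rewrite /bandlim Cint_conj //; last exact: bandlim_citg (rsv_col_citg t) _.
by apply: Cint_eq => u _; rewrite cM sc cR.
Qed.

End ComplexResolvent.

(** * Identification of the evaluators *)

Section Evaluator.
Variable R : realType.
Local Notation mu := (@lebesgue_measure R).
Local Notation T := (measurableTypeR R).
Local Notation I11 := (@itv11 R).
Local Notation O11 := (~` I11).
Implicit Types (z w h : R[i]).
Let mI := @itv11_meas R.
Let mO : measurable O11 := measurableC mI.

Lemma L2_itg (D : set R) (f : R -> R[i]) : measurable D -> L2 D f ->
  Cmeasurable D f /\ itg D (fun t => normc (f t) ^+ 2).
Proof.
move=> mD [mf f2]; split => //; apply/integrableP; split.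
  by apply/(@measurable_EFinP _ T); exact: Cmeas_normc2.
apply: le_lt_trans f2; apply: ge0_le_integral => //.
- apply: (@measurableT_comp _ _ _ T) => //.
  by apply/(@measurable_EFinP _ T); exact: Cmeas_normc2.
- by apply/(@measurable_EFinP _ T); exact: Cmeas_normc2.
- by move=> x _; rewrite /= ger0_norm ?sqr_ge0.
Qed.

Lemma itg_L2 (D : set R) (f : R -> R[i]) : measurable D ->
  Cmeasurable D f -> itg D (fun t => normc (f t) ^+ 2) -> L2 D f.
Proof.
move=> mD mf /integrableP[_ h]; split => //; apply: le_lt_trans h.
apply: ge0_le_integral => //.
- by move=> x _; rewrite lee_fin sqr_ge0.
- by apply/(@measurable_EFinP _ T); exact: Cmeas_normc2.
- apply: (@measurableT_comp _ _ _ T) => //.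
  by apply/(@measurable_EFinP _ T); exact: Cmeas_normc2.
- by move=> x _; rewrite /= ger0_norm ?sqr_ge0.
Qed.

Lemma L2_Citg (f : R -> R[i]) : Cmeasurable I11 f -> itg I11 (fun t => normc (f t) ^+ 2) ->
  Cintegrable I11 f.
Proof.
move=> mf f2; apply: (Citg_dom mI mf (itgD mI (itg_cst11 1) f2)) => t _.
have := sqr_ge0 (normc (f t) - 1); have := sqr_ge0 (normc (f t)); nra.
Qed.

Variable s : R.
Hypothesis s0 : 0 < s.
Local Notation d := (dirichlet_kernel s).

Lemma mPW_PW f : mPW s f -> PW s f.
Proof.
move=> [ef tf /(L2_itg mO)[_ f2]]; split => //.
have hf w : holo f w := ef w.
have c1 : itg `[-1, 1] (fun t : R => normc (f t%:C) ^+ 2).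
  apply: itg_cont => x _.
  have [h1 h2] : Rcont (fun t : R => f t%:C) x by exact: (@Rcont_h R f 0 x (holo_cont (hf _))).
  rewrite (_ : (fun t : R => _) = fun t : R => Re (f t%:C) ^+ 2 + Im (f t%:C) ^+ 2).
    by apply: cvgD; apply: cvgM.
  by apply: funext => t; rewrite normc_sqr.
have m11 : measurable (`[-1, 1]%classic : set R) by exact: measurable_itv.
have cI : itg I11 (fun t : R => normc (f t%:C) ^+ 2).
  by apply: itg_sub c1 => //; apply: subset_itv; rewrite bnd_simp.
pose n2 (t : R) := normc (f t%:C) ^+ 2.
have pI : itg setT (n2 \_ I11).
  by rewrite /itg -restrict_EFin; apply: (proj1 (integrable_mkcond _ _)) => //; exact: cI.
have pO : itg setT (n2 \_ O11).
  by rewrite /itg -restrict_EFin; apply: (proj1 (integrable_mkcond _ _)) => //; exact: f2.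
apply: (itg_eq _ _ (itgD measurableT pI pO)) => // t _; rewrite /patch in_setC.
by case: (t \in I11); rewrite ?addr0 ?add0r.
Qed.

Lemma PW_mPW f : PW s f -> mPW s f.
Proof.
move=> [hf tf f2]; split => //.
by apply: itg_L2 => //; [exact: Cmeas_real|exact: itg_sub f2].
Qed.

Lemma Cint_setTIO (f : R -> R[i]) : Cintegrable setT f ->
  Cintegral setT f = Cintegral O11 f + Cintegral I11 f.
Proof. by move=> [f1 f2]; apply: eqC; rewrite ?ReD ?ImD addrC; exact: Rint_setTIO. Qed.

Section Representation.
Variable f : R[i] -> R[i].
Hypothesis pf : PW s f.
Let hf : forall w, holo f w. Proof. by have [] := pf. Qed.
Let f2 : itg setT (fun t : R => normc (f t%:C) ^+ 2). Proof. by have [] := pf. Qed.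
Let mf (D : set R) : measurable D -> Cmeasurable D (fun t : R => f t%:C).
Proof. by move=> mD; exact: Cmeas_real. Qed.

Let fs_citg w (D : set R) : measurable D ->
  Cintegrable D (fun t : R => f t%:C * sinc s (w - t%:C)).
Proof.
move=> mD; apply: (CitgM_L2 mD (mf mD) (sinc_meas_sub s0 w mD)); first exact: itg_sub f2.
have [_ _ h] := PW_sinc s0 w; exact: itg_sub h.
Qed.

Let fI : Cintegrable I11 (fun t : R => f t%:C).
Proof. by apply: L2_Citg; [exact: mf|exact: itg_sub f2]. Qed.

Let ext w := Cintegral O11 (fun t : R => f t%:C * sinc s (w - t%:C)).

Let ext_eq w : f w = ext w + bandlim s (fun t => f t%:C) w.
Proof.
have E := reproducing w s0 hf (let: And3 _ h _ := pf in h) f2.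
rewrite {1}E Cint_setTIO; last exact: fs_citg.
by congr (_ + _); apply: Cint_eq => t _; rewrite mulrC.
Qed.

(** Let X(t) = rsvC z t, so that X = sinc(z - .) + X D. Integrating f X outside (-1,1)
    and exchanging integrals yields the exterior part of the reproducing formula for f
    at z, plus the integral over (-1,1) of X times the exterior parts at real points.
    Those are f - D f, and self-adjointness turns X (f - D f) into f times sinc(z - .),
    the missing interior part. *)
Lemma rsvC_reproduces z : Cintegral O11 (fun t : R => f t%:C * rsvC s z t%:C) = f z.
Proof.
have [X XE] : exists X : R -> R[i], X = fun t => rsvC s z t%:C by eexists.
have [M MP] : exists M, forall t, normc (X t) <= M by rewrite XE; exact: rsvC_bdd.
have Xi : Cintegrable I11 X by rewrite XE; exact: rsvC_citg.
have XB t : X t = sinc s (z - t%:C) + bandlim s X t%:C.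
  by rewrite XE; exact: (rsvC_eq s0 z t%:C).
rewrite (_ : (fun t : R => f t%:C * rsvC s z t%:C) = fun t => f t%:C * X t); last by rewrite XE.
move: XE => _.
have mX : Cmeasurable I11 X by exact: Cmeas_itg.
pose K := (2 * ((1 + s) / pi)) ^+ 2.
pose g (t : R) : R := 2^-1 * (normc (f t%:C) ^+ 2 + K * cauchyd t).
have gi : itg O11 g.
  apply: itgZ => //; apply: itgD => //; first exact: itg_sub f2.
  by apply: itgZ => //; apply: itg_sub (integral_cauchyd R).1.
have M0 : 0 <= M := le_trans (normc_ge0 _) (MP 0).
have [|i1 i2 E1] := @kernel_fubini R O11 I11 (fun t : R => f t%:C) X d g (fun=> M) mO mI
    (dir_meas s0) (mf mO) mX gi (itg_cst11 M).
  move=> x y _ yI; apply: ler_pM; rewrite ?mulr_ge0 ?normc_ge0 ?normr_ge0 ?MP //.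
  have := dir_sq s0 x yI; rewrite -/K /g.
  have := sqr_ge0 (`|d x y| - normc (f x%:C)); rewrite sqrrB real_normK ?num_real //; lra.
have m0 : 0 <= s / pi := divr_ge0 (ltW s0) (pi_ge0 R).
have [|j1 j2 E2] := @kernel_fubini R I11 I11 X (fun t : R => f t%:C) d (fun=> M * (s / pi))
    (fun t => normc (f t%:C)) mI mI (dir_meas s0) mX (mf mI) (itg_cst11 _) (Citg_normc mI fI).
  move=> x y _ _; apply: ler_wpM2r; first exact: normc_ge0.
  exact: ler_pM (normc_ge0 _) (normr_ge0 _) (MP x) (dir_le s0 x y).
pose f1 (t : R) := f t%:C * sinc s (z - t%:C).
have f1O : Cintegrable O11 f1 by exact: fs_citg.
have f1I : Cintegrable I11 f1 by exact: fs_citg.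
have S1 : Cintegral O11 (fun t : R => f t%:C * X t) = ext z +
    Cintegral O11 (fun t : R => Cintegral I11 (fun u => f t%:C * ((d t u)%:C * X u))).
  rewrite -[ext z]/(Cintegral O11 f1) -(CintD mO f1O i1); apply: Cint_eq => t _.
  rewrite XB mulrDr; congr (_ + _); rewrite /bandlim -(CintZ _ mI (bandlim_citg s0 Xi t%:C)).
  by apply: Cint_eq => u _; rewrite sinc_real.
have alg1 (x a b e : R[i]) : e = a + b -> x * a = x * e - x * b by move=> ->; ring.
have alg2 (x a b e : R[i]) : x = a + b -> e * b = x * e - e * a by move=> ->; ring.
have rot3 (a b c : R[i]) : a * (b * c) = c * (a * b) by ring.
have swap3 (a b c : R[i]) : a * (b * c) = c * (b * a) by ring.
have S2 : Cintegral I11 (fun u => Cintegral O11 (fun t : R => f t%:C * ((d t u)%:C * X u))) =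
    Cintegral I11 (fun u => X u * ext u%:C).
  apply: Cint_eq => u _; rewrite -(CintZ _ mO (fs_citg u%:C mO)).
  by apply: Cint_eq => t _; rewrite sinc_real (dir_sym s u t); exact: rot3.
have XfI : Cintegrable I11 (fun u => X u * f u%:C).
  have := CitgM_L2 mI mX (mf mI) _ (itg_sub measurableT mI (@subsetT _ _) f2); apply.
  apply: (@itg_bdd _ _ (M ^+ 2)); first exact: Cmeas_normc2.
  move=> t _; rewrite ger0_norm; last exact: sqr_ge0.
  by apply: lerXn2r; rewrite ?nnegrE; [exact: normc_ge0|exact: M0|exact: MP].
have S3 : Cintegral I11 (fun u => X u * ext u%:C) = Cintegral I11 (fun u => X u * f u%:C) -
    Cintegral I11 (fun t : R => Cintegral I11 (fun u => X t * ((d t u)%:C * f u%:C))).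
  rewrite -(CintB mI XfI j1); apply: Cint_eq => t _.
  have E : Cintegral I11 (fun u => X t * ((d t u)%:C * f u%:C)) = X t * bandlim s (fun t => f t%:C) t%:C.
    rewrite /bandlim -(CintZ _ mI (bandlim_citg s0 fI t%:C)).
    by apply: Cint_eq => u _; rewrite sinc_real.
  rewrite E; exact: alg1 (ext_eq t%:C).
have S4 : Cintegral I11 (fun u => Cintegral I11 (fun t : R => X t * ((d t u)%:C * f u%:C))) =
    Cintegral I11 (fun u => X u * f u%:C) - Cintegral I11 f1.
  rewrite -(CintB mI XfI f1I); apply: Cint_eq => u _.
  have E : Cintegral I11 (fun t : R => X t * ((d t u)%:C * f u%:C)) = f u%:C * bandlim s X u%:C.
    rewrite /bandlim -(CintZ _ mI (bandlim_citg s0 Xi u%:C)).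
    by apply: Cint_eq => t _; rewrite sinc_real (dir_sym s u t); exact: swap3.
  rewrite E; exact: alg2 (XB u).
have S5 : Cintegral I11 f1 = bandlim s (fun t => f t%:C) z by apply: Cint_eq => t _; exact: mulrC.
by rewrite S1 E1 S2 S3 E2 S4 subKr S5 -ext_eq.
Qed.

End Representation.

Lemma rsvC_evaluator z : is_evaluator s z (rsvC s (conjc z)).
Proof.
split; first by apply: PW_mPW; exact: rsvC_PW.
move=> f /mPW_PW pf; rewrite -[RHS](rsvC_reproduces pf); apply: Cint_eq => t _.
by congr (_ * _); exact: rsvC_conj.
Qed.

Lemma mPW_dot_conj f g : mPW s f -> mPW s g -> mPW_dot g f = conjc (mPW_dot f g).
Proof.
move=> /mPW_PW[hf _ f2] /mPW_PW[hg _ g2].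
have mD (k : R[i] -> R[i]) : (forall w, holo k w) -> Cmeasurable O11 (fun t : R => k t%:C).
  by move=> hk; exact: Cmeas_real.
have nc (w : R[i]) : normc (conjc w) = normc w by exact: normcJ.
rewrite /mPW_dot Cint_conj //.
  apply: Cint_eq => t _.
  have cM (a b : R[i]) : conjc (a * b) = conjc a * conjc b by exact: rmorphM.
  by rewrite cM conjcK mulrC.
apply: (CitgM_L2 (g := fun t : R => conjc (g t%:C)) mO (mD f hf)); first 1 last.
- exact: itg_sub f2.
- by apply: (itg_eq _ _ (itg_sub measurableT mO (@subsetT _ _) g2)) => // t _; rewrite nc.
have [m1 m2] := mD g hg; split.
  by rewrite (_ : (fun t : R => _) = fun t : R => Re (g t%:C)) //; apply: funext => t; case: (g _).
rewrite (_ : (fun t : R => _) = fun t : R => - Im (g t%:C)); first exact: measurable_funN.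
by apply: funext => t; case: (g _).
Qed.

(** The evaluator E at w can be tested against both candidates: X(w) = (X, E) is the
    conjugate of (E, X) = E(z). *)
Lemma evaluator_unique z X Y w : is_evaluator s z X -> is_evaluator s z Y -> X w = Y w.
Proof.
have H V : is_evaluator s z V -> V w = conjc (rsvC s (conjc w) z).
  move=> [pV eV]; have [pE eE] := rsvC_evaluator w.
  by rewrite -(eE V pV) (mPW_dot_conj pE pV) (eV _ pE).
by move=> /H -> /H ->.
Qed.

Lemma evaluatorE z w : evaluator s (conjc z) w = rsvC s z w.
Proof.
have E := rsvC_evaluator (conjc z); rewrite conjcK in E.
have [V] : [set X | is_evaluator s (conjc z) X] (evaluator s (conjc z)).
  by rewrite /evaluator; apply: xgetPex; exists (rsvC s z).
move=> eV; apply: (evaluator_unique w _ E); split; [exact: V|exact: eV].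
Qed.

End Evaluator.

(** * The resolvent identities *)

Section ResolventKernel.
Variable R : realType.
Local Notation mu := (@lebesgue_measure R).
Local Notation T := (measurableTypeR R).
Local Notation I11 := (@itv11 R).
Let mI := @itv11_meas R.

Definition bounded_kernel (k : R -> R -> R) (B : R) :=
  measurable_fun setT (fun p : T * T => k p.1 p.2) /\ forall x y, `|k x y| <= B.

Definition real_op (k : R -> R -> R) (f : R -> R[i]) := integral_op (fun x y => (k x y)%:C) f.

Lemma kernel_row_meas k B x : bounded_kernel k B -> Cmeasurable I11 (fun y => (k x y)%:C).
Proof.
move=> [mk _]; split; last exact: measurable_cst.
exact: (measurable_funS measurableT (@subsetT _ _) (measurableT_comp mk (@pair1_measurable _ _ T T x))).
Qed.

Lemma real_op_citg k B f x : bounded_kernel k B -> Cintegrable I11 f ->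
  Cintegrable I11 (fun y => (k x y)%:C * f y).
Proof.
move=> bk fi; apply: (Citg_dom mI _ (itgZ B mI (Citg_normc mI fi))).
  by apply: CmeasM; [exact: kernel_row_meas bk|exact: Cmeas_itg].
move=> y _; rewrite normcM normc_R; apply: ler_wpM2r; first exact: normc_ge0.
exact: bk.2.
Qed.

Lemma real_op_bdd k B f x : bounded_kernel k B -> Cintegrable I11 f ->
  normc (real_op k f x) <= B * \int[mu]_(y in I11) normc (f y).
Proof.
move=> bk fi; have fn := Citg_normc mI fi.
rewrite -RintegralZl //; apply: (Cint_norm mI (real_op_citg x bk fi) (itgZ B mI fn)) => y _.
rewrite normcM normc_R; apply: ler_wpM2r; [exact: normc_ge0|exact: bk.2].
Qed.

Lemma real_op_measbdd k B f : bounded_kernel k B -> Cintegrable I11 f ->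
  Cintegrable I11 (real_op k f).
Proof.
move=> bk fi.
have m1 : Cmeasurable I11 (fun=> 1 : R[i]) by split; exact: measurable_cst.
have [|h _ _] := @kernel_fubini R I11 I11 (fun=> 1) f k (fun=> B) (fun y => normc (f y)) mI mI bk.1
  m1 (Cmeas_itg fi) (itg_cst11 B) (Citg_normc mI fi).
  move=> x y _ _; rewrite normc_1 mul1r; apply: ler_wpM2r; [exact: normc_ge0|exact: bk.2].
apply: (Citg_eq mI _ h) => x _; apply: Cint_eq => y _; exact: mul1r.
Qed.

Lemma real_op_comp k1 B1 k2 B2 f x : bounded_kernel k1 B1 -> bounded_kernel k2 B2 ->
  Cintegrable I11 f ->
  real_op k1 (real_op k2 f) x =
  real_op (fun x y => \int[mu]_(t in I11) (k1 x t * k2 t y)) f x.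
Proof.
move=> b1 b2 fi.
have [|h1 h2 E] := @kernel_fubini R I11 I11 (fun t => (k1 x t)%:C) f k2 (fun=> B1 * B2)
  (fun y => normc (f y)) mI mI b2.1 (kernel_row_meas x b1) (Cmeas_itg fi) (itg_cst11 _)
  (Citg_normc mI fi).
  move=> t y _ _; apply: ler_wpM2r; first exact: normc_ge0.
  by rewrite normc_R; apply: ler_pM; [exact: normr_ge0|exact: normr_ge0|exact: b1.2|exact: b2.2].
transitivity (Cintegral I11 (fun t => Cintegral I11 (fun y => (k1 x t)%:C * ((k2 t y)%:C * f y)))).
  by apply: Cint_eq => t _; rewrite (CintZ _ mI (real_op_citg t b2 fi)).
rewrite E; apply: Cint_eq => y _.
have kk : Cintegrable I11 (fun t => (k1 x t * k2 t y)%:C).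
  apply: (@Citg_bdd _ _ (B1 * B2)).
    split; last exact: measurable_cst.
    apply: measurable_funM; first by have [] := kernel_row_meas x b1.
    exact: (measurable_funS measurableT (@subsetT _ _) (measurableT_comp b2.1 (@pair2_measurable _ _ T T y))).
  move=> t _; rewrite normc_R normrM.
  by apply: ler_pM; [exact: normr_ge0|exact: normr_ge0|exact: b1.2|exact: b2.2].
rewrite -Cint_real mulrC -(CintZ _ mI kk); apply: Cint_eq => t _.
have alg (a b c : R[i]) : a * (b * c) = c * (a * b) by ring.
by rewrite alg rmorphM.
Qed.

Lemma real_opB k B f g x : bounded_kernel k B -> Cintegrable I11 f -> Cintegrable I11 g ->
  real_op k (f \- g) x = real_op k f x - real_op k g x.
Proof.
move=> bk fi gi; rewrite /real_op /integral_op.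
rewrite -(CintB mI (real_op_citg x bk fi) (real_op_citg x bk gi)).
by apply: Cint_eq => y _; rewrite mulrBr.
Qed.

Lemma real_opD k B f g x : bounded_kernel k B -> Cintegrable I11 f -> Cintegrable I11 g ->
  real_op k (f \+ g) x = real_op k f x + real_op k g x.
Proof.
move=> bk fi gi; rewrite /real_op /integral_op.
rewrite -(CintD mI (real_op_citg x bk fi) (real_op_citg x bk gi)).
by apply: Cint_eq => y _; rewrite mulrDr.
Qed.

Lemma bounded_L2 (f : R -> R[i]) (M : R) : Cmeasurable I11 f ->
  (forall x, I11 x -> normc (f x) <= M) -> L2 I11 f.
Proof.
move=> mf fM; apply: itg_L2 => //; apply: (@itg_bdd _ _ (M ^+ 2)); first exact: Cmeas_normc2.
move=> x /fM H; rewrite ger0_norm; last exact: sqr_ge0.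
by apply: lerXn2r; rewrite ?nnegrE ?normc_ge0 // (le_trans (normc_ge0 _) H).
Qed.

Lemma bounded_L2_kernel k B : bounded_kernel k B -> L2_kernel (fun x y => (k x y)%:C).
Proof.
move=> bk; split.
  by split; [apply: measurable_funS bk.1|exact: measurable_cst].
move=> f /(L2_itg mI)[mf f2]; have fi := L2_Citg mf f2; split.
  by apply: aeW => x _; exact: real_op_citg bk fi.
apply: (bounded_L2 (Cmeas_itg (real_op_measbdd bk fi))) => x _.
exact: real_op_bdd bk fi.
Qed.

Variable s : R.
Hypothesis s0 : 0 < s.
Local Notation d := (dirichlet_kernel s).
Local Notation r := (rsv s).

Lemma dir_bounded : bounded_kernel d (s / pi).
Proof. by split; [exact: dir_meas|exact: dir_le]. Qed.

Lemma rsv_bounded : exists B, bounded_kernel r B.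
Proof. by have [B _ BP] := rsv_bdd s0; exists B; split; [exact: rsv_meas|exact: BP]. Qed.

(** Both resolvent equations, integrated against f. *)
Lemma rsv_dir_op f x : Cintegrable I11 f ->
  real_op r (real_op d f) x = real_op r f x - real_op d f x /\
  real_op d (real_op r f) x = real_op r f x - real_op d f x.
Proof.
move=> fi; have [B bB] := rsv_bounded.
have E : real_op r f x - real_op d f x = Cintegral I11 (fun y => (r x y - d x y)%:C * f y).
  rewrite /real_op /integral_op -(CintB mI (real_op_citg x bB fi) (real_op_citg x dir_bounded fi)).
  by apply: Cint_eq => y _; rewrite rmorphB mulrBl.
have sub (a b c : R) : a = b + c -> c = a - b by move=> ->; rewrite addrAC subrr add0r.
rewrite (real_op_comp x bB dir_bounded fi) (real_op_comp x dir_bounded bB fi) E.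
split; apply: Cint_eq => y _; congr (_%:C * _); apply: sub.
  exact: rsv_eqr.
exact: rsv_eql.
Qed.

Lemma resolvent_left f : Cintegrable I11 f ->
  (f \- real_op d f) \+ real_op r (f \- real_op d f) = f.
Proof.
move=> fi; have [B bB] := rsv_bounded; have Di := real_op_measbdd dir_bounded fi.
apply: funext => x /=; rewrite (real_opB x bB fi Di) (rsv_dir_op x fi).1.
by move: (f x) (real_op r f x) (real_op d f x) => a b c; ring.
Qed.

Lemma resolvent_right f : Cintegrable I11 f ->
  (f \+ real_op r f) \- real_op d (f \+ real_op r f) = f.
Proof.
move=> fi; have [B bB] := rsv_bounded; have Ri := real_op_measbdd bB fi.
apply: funext => x /=; rewrite (real_opD x dir_bounded fi Ri) (rsv_dir_op x fi).2.
by move: (f x) (real_op r f x) (real_op d f x) => a b c; ring.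
Qed.

Lemma rsv_is_resolvent : is_resolvent_kernel s (fun x y => (r x y)%:C).
Proof.
have [B bB] := rsv_bounded; split; first exact: bounded_L2_kernel bB.
have ae (g h : R -> R[i]) : g = h -> g = h %[ae mu in I11] by move=> ->; apply: aeW.
move=> f /(L2_itg mI)[mf f2]; have fi := L2_Citg mf f2.
by split; apply: ae; [exact: resolvent_left|exact: resolvent_right].
Qed.

End ResolventKernel.

(** * Differentiability in two complex variables *)

Lemma differentiable_eps (K : numFieldType) (V W : normedModType K) (f : V -> W)
  (df : {linear V -> W}) (x : V) : continuous df ->
  (forall e : K, 0 < e -> \forall h \near (0 : V), `|f (h + x) - (f x + df h)| <= e * `|h|) ->
  differentiable f x.
Proof.
move=> cd H.
have E : f \o shift x = cst (f x) + df +o_ 0 id by apply/eqaddoP => e e0; exact: H.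
by apply/diff_locallyP; rewrite (diff_unique cd E).
Qed.

Section Differentiability.
Variable R : realType.
Local Notation C := ((R[i])^o).
Implicit Types (z w h k a b : R[i]).

Let dlin a b (q : C * C) : C := a * q.1 + b * q.2.

Let dlin_linear a b : linear (dlin a b).
Proof. by move=> t x y; rewrite /dlin /= /GRing.scale /=; ring. Qed.

HB.instance Definition _ a b :=
  GRing.isLinear.Build R[i] (C * C)%type C _ (dlin a b) (dlin_linear a b).

Let pair_norm (q : C * C) : `|q| = (Num.max (normc q.1) (normc q.2))%:C.
Proof.
rewrite prod_normE /= !normrC /Order.max ltcR; by case: ifP.
Qed.

(** A quadratic remainder along the two complex directions implies differentiability at
    a point of the product. *)
Lemma differentiable_quad (F : R[i] -> R[i] -> R[i]) z w a b (c dl : R) : 0 < dl ->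
  (forall h k, normc h < dl -> normc k < dl ->
    normc (F (z + h) (w + k) - F z w - (a * h + b * k)) <= c * (normc h + normc k) ^+ 2) ->
  differentiable (fun q : C * C => F q.1 q.2 : C) ((z, w) : C * C).
Proof.
move=> dl0 H; set f := fun q : C * C => F q.1 q.2 : C.
have cd : continuous (dlin a b).
  move=> q; apply: cvgD; apply: cvgM; try exact: cvg_cst; [exact: cvg_fst|exact: cvg_snd].
apply: (@differentiable_eps _ _ _ f (dlin a b) (z, w)) => // e e0.
  have e0' : 0 < Re e by move: e0; rewrite ltcE => /andP[].
  have eE : e = (Re e)%:C by move: e0; rewrite ltcE => /andP[/eqP /= ? _]; apply: eqC.
  have cp : 0 < 4 * (`|c| + 1) by rewrite mulr_gt0 // ltr_wpDl.
  apply/nbhs_normP; exists (Num.min dl (Re e / (4 * (`|c| + 1))))%:C.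
    by rewrite /= ltcR lt_min dl0 divr_gt0.
  move=> [h k]; rewrite /ball_ /= sub0r normrN !pair_norm /= ltcR lt_min => /andP[m1 m2].
  set m := Num.max _ _ in m1 m2 *.
  have hm : normc h <= m by rewrite /m le_max lexx.
  have km : normc k <= m by rewrite /m le_max lexx orbT.
  have m0 : 0 <= m := le_trans (normc_ge0 h) hm.
  rewrite eE normrC -rmorphM lecR.
  have -> : f ((h, k) + (z, w)) - (f (z, w) + dlin a b (h, k)) =
      F (z + h) (w + k) - F z w - (a * h + b * k).
    by rewrite /f /dlin /= opprD addrA [h + z]addrC [k + w]addrC.
  apply: le_trans (H h k (le_lt_trans hm m1) (le_lt_trans km m1)) _.
  apply: (@le_trans _ _ (4 * (`|c| + 1) * m * m)); last first.
    by apply: ler_wpM2r => //; rewrite mulrC -ler_pdivlMr // ltW.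
  have s0 : 0 <= normc h + normc k by rewrite addr_ge0 ?normc_ge0.
  have s2 : (normc h + normc k) ^+ 2 <= (2 * m) ^+ 2.
    by rewrite ler_pXn2r ?nnegrE // ?mulr_ge0 //; lra.
  apply: (@le_trans _ _ ((`|c| + 1) * (normc h + normc k) ^+ 2)).
    by apply: ler_wpM2r; rewrite ?sqr_ge0 // (le_trans (ler_norm _)) // lerDl.
  have c1 : 0 <= `|c| + 1 by rewrite addr_ge0.
  have := ler_wpM2l c1 s2; lra.
Qed.

End Differentiability.

(** * The continued kernel is entire *)

Section EntireResolvent.
Variable R : realType.
Local Notation mu := (@lebesgue_measure R).
Local Notation I11 := (@itv11 R).
Implicit Types (z w h k : R[i]).
Let mI := @itv11_meas R.
Variable s : R.
Hypothesis s0 : 0 < s.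

(** The product rule for first-order expansions with quadratic remainders, with explicit
    constants so that it can be integrated. *)
Lemma quad_mul (x a a' y p p' h k : R[i]) (c m : R) : 0 <= c -> 0 <= m -> m <= 1 ->
  normc h <= m -> normc k <= m -> normc a <= c -> normc a' <= c -> normc p <= c -> normc p' <= c ->
  normc (x - a - a' * k) <= c * m ^+ 2 -> normc (y - p - p' * h) <= c * m ^+ 2 ->
  normc (x * y - a * p - (a * p' * h + a' * p * k)) <= 6 * c ^+ 2 * m ^+ 2.
Proof.
move=> c0 m0 m1 hm km ac a'c pc p'c; set rho := x - a - a' * k; set sg := y - p - p' * h => rc sc.
have cm0 : 0 <= c * m by exact: mulr_ge0.
have cm : c * m <= c by rewrite ler_piMr.
have m2 : m ^+ 2 <= 1 by rewrite exprn_ile1.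
have cm2 : c * m ^+ 2 <= c by rewrite ler_piMr.
have cm20 : 0 <= c * m ^+ 2 by rewrite mulr_ge0 // sqr_ge0.
have a'k : normc (a' * k) <= c * m by rewrite normcM; apply: ler_pM => //; exact: normc_ge0.
have p'h : normc (p' * h) <= c * m by rewrite normcM; apply: ler_pM => //; exact: normc_ge0.
have -> : x * y - a * p - (a * p' * h + a' * p * k) =
    a' * k * (p' * h) + (a + a' * k) * sg + rho * (p + p' * h + sg).
  by rewrite /rho /sg; ring.
have t1 : normc (a' * k * (p' * h)) <= c ^+ 2 * m ^+ 2.
  by rewrite normcM -exprMn expr2; apply: ler_pM => //; exact: normc_ge0.
have t2 : normc ((a + a' * k) * sg) <= 2 * c * (c * m ^+ 2).
  rewrite normcM; apply: ler_pM; rewrite ?normc_ge0 //.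
  by apply: le_trans (normcD _ _) _; lra.
have t3 : normc (rho * (p + p' * h + sg)) <= c * m ^+ 2 * (3 * c).
  rewrite normcM; apply: ler_pM; rewrite ?normc_ge0 //.
  by apply: le_trans (normcD _ _) _; have := normcD p (p' * h); lra.
apply: le_trans (normcD _ _) _; have := normcD (a' * k * (p' * h)) ((a + a' * k) * sg).
move: t1 t2 t3; rewrite !expr2; lra.
Qed.

Let K3 (z : R[i]) := 10 * s ^+ 3 / pi * expR (s * `|Im z|).

Let K3_ge0 z : 0 <= K3 z.
Proof.
apply: mulr_ge0; last exact: expR_ge0.
by apply: divr_ge0; [apply: mulr_ge0 => //; apply: exprn_ge0; exact: ltW|exact: pi_ge0].
Qed.

(** The expansion in z is uniform in the real variable t. *)
Lemma rsvL_quad z : exists2 c : R, 0 <= c & forall h t, normc h <= (2 * s)^-1 ->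
  normc (rsvL s (z + h) t - rsvL s z t - rsvL' s z t * h) <= c * normc h ^+ 2.
Proof.
have [B B0 BP] := rsv_col_norm s0.
have KB : 0 <= K3 z * B by apply: mulr_ge0 (K3_ge0 z) (ltW B0).
exists (K3 z + K3 z * B); first by apply: addr_ge0 (K3_ge0 z) KB.
move=> h t hs.
have h1 := sinc_quad (z - t%:C) s0 hs; rewrite Im_subr -/(K3 z) in h1.
have h2 := bandlim_quad s0 (rsv_col_citg s0 t) z hs; rewrite -/(K3 z) in h2.
have alg (a a1 a2 b b1 b2 e : R[i]) : a + b - (a1 + b1) - (a2 + b2) * e =
  (a - a1 - a2 * e) + (b - b1 - b2 * e) by ring.
have sh : z + h - t%:C = z - t%:C + h by ring.
rewrite /rsvL /rsvL' alg sh mulrDl; apply: le_trans (normcD _ _) (lerD h1 (le_trans h2 _)).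
rewrite [leLHS]mulrAC; apply: ler_wpM2r; first exact: sqr_ge0.
by apply: ler_wpM2l; [exact: K3_ge0|exact: BP].
Qed.

(** The kernel is an integral of products of a function of w and a function of z, both
    of which have uniform first-order expansions. *)
Lemma rsvC_quad z w : exists a b (c dl : R), 0 < dl /\ forall h k, normc h < dl -> normc k < dl ->
  normc (rsvC s (z + h) (w + k) - rsvC s z w - (a * h + b * k)) <= c * (normc h + normc k) ^+ 2.
Proof.
have [c1 c10 L1] := rsvL_quad z.
have [M MP] := rsvL_bdd s0 z.
pose S0 := s / pi * expR (s * `|Im w|); pose S1 := s ^+ 2 / pi * expR (s * `|Im w|).
have e0 := expR_ge0 (s * `|Im w|); have p0 := pi_ge0 R; have s0' := ltW s0.
have S00 : 0 <= S0 by apply: mulr_ge0 => //; exact: divr_ge0.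
have S10 : 0 <= S1 by apply: mulr_ge0 => //; apply: divr_ge0 => //; exact: sqr_ge0.
have M0 : 0 <= M := le_trans (normc_ge0 _) (MP 0).1.
pose c := c1 + M + S0 + S1 + K3 w.
have K0 := K3_ge0 w.
have c0 : 0 <= c by rewrite /c; lra.
pose dl := Num.min 1 (2 * s)^-1 / 2.
have dl0 : 0 < dl by rewrite divr_gt0 // lt_min ltr01 invr_gt0 mulr_gt0.
exists (sinc' s (z - w) + bandlim s (rsvL' s z) w), (- sinc' s (z - w) + bandlim' s (rsvL s z) w),
  (K3 (z - w) + 2 * (6 * c ^+ 2)), dl; split => // h k hd kd.
set m := normc h + normc k.
have h0 := normc_ge0 h; have k0 := normc_ge0 k.
have m0 : 0 <= m by exact: addr_ge0.
have hm : normc h <= m by rewrite lerDl.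
have km : normc k <= m by rewrite lerDr.
have md : m <= Num.min 1 (2 * s)^-1 by move: hd kd; rewrite /dl /m; lra.
have [m1 ms] : m <= 1 /\ m <= (2 * s)^-1 by move: md; rewrite le_min => /andP[].
have sqm (u : R) : 0 <= u -> u <= m -> u ^+ 2 <= m ^+ 2.
  by move=> u0 um; apply: lerXn2r.
have hk : normc (h - k) <= m by have := normcD h (- k); rewrite normcN.
have q1 := sinc_quad (z - w) s0 (le_trans hk ms); rewrite -/(K3 (z - w)) in q1.
have q2 := le_trans q1 (ler_wpM2l (K3_ge0 (z - w)) (sqm _ (normc_ge0 _) hk)).
have [LC L'C] := rsvL_citg s0 z; have [LhC _] := rsvL_citg s0 (z + h).
pose F (t : R) := sinc s (w + k - t%:C) * rsvL s (z + h) t - sinc s (w - t%:C) * rsvL s z t -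
   (h * (sinc s (w - t%:C) * rsvL' s z t) + k * (sinc' s (w - t%:C) * rsvL s z t)).
have b1 := bandlim_citg s0 LhC (w + k); have b2 := bandlim_citg s0 LC w.
have b3 := bandlim_citg s0 L'C w; have b4 := bandlim'_citg s0 LC w.
have b12 := CitgB mI b1 b2; have b34 := CitgD mI (CitgZ h mI b3) (CitgZ k mI b4).
have FE : Cintegral I11 F = bandlim s (rsvL s (z + h)) (w + k) - bandlim s (rsvL s z) w -
    (h * bandlim s (rsvL' s z) w + k * bandlim' s (rsvL s z) w).
  by rewrite /F (CintB mI b12 b34) (CintB mI b1 b2) (CintD mI (CitgZ h mI b3) (CitgZ k mI b4))
    (CintZ h mI b3) (CintZ k mI b4).
have Fi : Cintegrable I11 F := CitgB mI b12 b34.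
have FB : normc (Cintegral I11 F) <= 2 * (6 * c ^+ 2 * m ^+ 2).
  rewrite -Rint_cst11; apply: (Cint_norm mI Fi (itg_cst11 _)) => t _.
  have [P1 P2] := MP t.
  have a1 := sinc_bound (w - t%:C) s0'; rewrite Im_subr -/S0 in a1.
  have a2 := sinc'_bound (w - t%:C) s0'; rewrite Im_subr -/S1 in a2.
  have a3 := sinc_quad (w - t%:C) s0 (le_trans km ms); rewrite Im_subr -/(K3 w) in a3.
  have a4 := L1 h t (le_trans hm ms).
  have kc : K3 w <= c by rewrite /c; lra.
  have c1c : c1 <= c by rewrite /c; lra.
  have a5 := le_trans a3 (ler_pM K0 (sqr_ge0 _) kc (sqm _ k0 km)).
  have a6 := le_trans a4 (ler_pM c10 (sqr_ge0 _) c1c (sqm _ h0 hm)).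
  have sh : w + k - t%:C = w - t%:C + k by ring.
  have alg (x a a' y p p' u v : R[i]) : x * y - a * p - (u * (a * p') + v * (a' * p)) =
    x * y - a * p - (a * p' * u + a' * p * v) by ring.
  rewrite /F alg sh; apply: quad_mul c0 m0 m1 hm km _ _ _ _ a5 a6.
  - by apply: le_trans a1 _; rewrite /c; lra.
  - by apply: le_trans a2 _; rewrite /c; lra.
  - by apply: le_trans P1 _; rewrite /c; lra.
  - by apply: le_trans P2 _; rewrite /c; lra.
have shz : z + h - (w + k) = z - w + (h - k) by ring.
have alg (x a b y p q r u v : R[i]) : x + y - (a + p) - ((b + q) * u + (- b + r) * v) =
  (x - a - b * (u - v)) + (y - p - (u * q + v * r)) by ring.
rewrite /rsvC alg shz -FE; apply: le_trans (normcD _ _) _.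
rewrite mulrDl; apply: lerD; first exact: q2.
by apply: le_trans FB _; rewrite mulrA.
Qed.

Lemma rsvC_entire2 : entire2 (rsvC s).
Proof.
move=> [z w]; have [a [b [c [dl [dl0 H]]]]] := rsvC_quad z w.
exact: differentiable_quad dl0 H.
Qed.

End EntireResolvent.

(** * Uniqueness of the resolvent kernel *)

Section KernelUniqueness.
Variable R : realType.
Local Notation mu := (@lebesgue_measure R).
Local Notation T := (measurableTypeR R).
Local Notation I11 := (@itv11 R).
Let mI := @itv11_meas R.

(** The primitive of h is zero at the rational points, hence at every point where it is
    continuous, and almost everywhere it is differentiable with derivative h. *)
Lemma ae0_of_primitive (h : R -> R) : itg setT h ->
  (forall q : rat, \int[mu]_(t in `]-oo, (ratr q : R)]) h t = 0) ->
  {ae mu, forall x : T, h x = 0}.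
Proof.
move=> hi h0.
have hiy (y : R) : mu.-integrable `]-oo, y] (EFin \o h) by exact: itg_sub hi.
have lh : locally_integrable [set: R] h.
  by apply: open_integrable_locally => //; exact: openT.
pose F (x : R) := \int[mu]_(t in `]-oo, x]) h t.
have [N [mN N0 NP]] := FTC1Ny hiy lh.
exists N; split => // x /= hx; apply: NP => /= -[dF EF]; apply: hx.
have {}EF : derive1 F x = h x by exact: EF.
have {}dF : derivable F x 1 by exact: dF.
have cF : {for x, continuous F}.
  by apply: differentiable_continuous; exact/derivable1_diffP.
have rat_near (e : R) : 0 < e -> exists2 q : rat, x < ratr q & ratr q < x + e.
  move=> e0; have [q] := @rat_in_itvoo R x (x + e) (ltr_pwDr e0 (lexx x)).
  by rewrite in_itv /= => /andP[]; exists q.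
have F0 : F x = 0.
  apply/eqP; apply: contraT => Fx; have n0 : 0 < `|F x| by rewrite normr_gt0.
  have /cvgrPdist_lt/(_ _ n0)/nbhs_normP[e /= e0 eP] := cF.
  have [q q1 q2] := rat_near e e0.
  have : `|F x - F (ratr q)| < `|F x|.
    by apply: eP; rewrite /ball_ /= distrC gtr0_norm ?subr_gt0 //; lra.
  by rewrite [F (ratr q)]h0 subr0 ltxx.
rewrite -EF; apply/eqP; apply: contraT => l0.
have n0 : 0 < `|derive1 F x| by rewrite normr_gt0.
have cv : k^-1 *: (F (k + x) - F x) @[k --> 0^'] --> derive1 F x.
  have := dF; rewrite /derivable derive1E /derive.
  by under eq_fun do rewrite [_ *: 1]mulr1.
have /cvgrPdist_lt/(_ _ n0) := cv; rewrite near_withinE => /nbhs_normP[e /= e0 eP].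
have [q q1 q2] := rat_near e e0.
have := eP (ratr q - x); rewrite /ball_ /= sub0r normrN gtr0_norm ?subr_gt0 // subrK.
rewrite [F (ratr q)]h0 F0 subrr scaler0 subr0 ltxx => H.
suff: false by []; apply: H; first by lra.
by rewrite subr_eq0 gt_eqF.
Qed.

Let ray (q : rat) : set R := `]-oo, (ratr q : R)]%classic.

Let ae0_patch (h : R -> R) : itg I11 h ->
  (forall q, \int[mu]_(t in I11) (h t * \1_(ray q) t) = 0) ->
  {ae mu, forall x : T, I11 x -> h x = 0}.
Proof.
move=> hi h0.
have hi' : itg setT (h \_ I11).
  by rewrite /itg -restrict_EFin; apply: (proj1 (integrable_mkcond _ _)) => //; exact: hi.
have [|N [mN N0 NP]] := ae0_of_primitive hi'.
  move=> q; rewrite -(h0 q) Rintegral_mkcond [RHS]Rintegral_mkcond.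
  apply: Rint_eq => t _; rewrite /patch indicE /ray.
  by case: (t \in I11); case: (t \in _); rewrite ?mulr1 ?mulr0.
exists N; split => // x /= hx; apply: NP => /= H; apply: hx => Ix.
by move: H; rewrite patchE mem_set.
Qed.

(** The countably many indicators of half-lines with rational endpoints detect an
    integrable function up to a null set. *)
Lemma row_ae0 (H : R -> R[i]) : Cintegrable I11 H ->
  (forall q, Cintegral I11 (fun t => H t * (\1_(ray q) t)%:C) = 0) ->
  {ae mu, forall x : T, I11 x -> H x = 0}.
Proof.
move=> [H1 H2] H0.
have [||N [mN N0 NP]] := @ae0_patch (fun t => Re (H t)).
- exact: H1.
- move=> q; have /(congr1 (@complex.Re R)) /= <- := H0 q.
  by apply: Rint_eq => t _; rewrite ReM /= mulr0 subr0.
have [||N' [mN' N0' NP']] := @ae0_patch (fun t => Im (H t)).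
- exact: H2.
- move=> q; have /(congr1 (@complex.Im R)) /= <- := H0 q.
  by apply: Rint_eq => t _; rewrite ImM /= mulr0 add0r.
exists (N `|` N'); split; first exact: measurableU.
  by apply/eqP; rewrite -measure_le0 (le_trans (measureU2 _ mN mN')) // [X in (X + _)%E]N0 [X in (_ + X)%E]N0' adde0.
move=> x /= hx; apply: contrapT => /not_orP[n1 n2]; apply: hx => Ix; apply: eqC.
  by apply: contrapT => h; apply: n1; apply: NP => /= /(_ Ix).
by apply: contrapT => h; apply: n2; apply: NP' => /= /(_ Ix).
Qed.

(** The product measure is the integral of the measures of the sections. *)
Lemma null_of_sections (N : set (T * T)) : measurable N ->
  {ae mu, forall x : T, mu.-negligible (xsection N x)} -> (mu \x mu)%E N = 0%E.
Proof.
move=> mN [Z [mZ Z0 ZP]].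
transitivity (\int[mu]_x mu (xsection N x))%E; first by [].
transitivity (\int[mu]_x (0 : \bar R))%E; last exact: integral0.
apply: (@ae_eq_integral _ T R mu setT) => //; first exact: measurable_fun_xsection.
exists Z; split => // x /= hx; apply: ZP => /= nx; apply: hx => _.
by apply: measure_negligible => //; exact: measurable_xsection.
Qed.

Variable s : R.
Hypothesis s0 : 0 < s.
Local Notation r := (rsv s).

(** Apply (1 + K) (1 - D) to g = (1 + R) f: since (1 - D) g = f, this says that (1 + K)
    f = (1 + R) f almost everywhere. *)
Lemma resolvent_op_unique K f M : is_resolvent_kernel s K -> Cmeasurable I11 f ->
  (forall x, I11 x -> normc (f x) <= M) ->
  {ae mu, forall x : T, I11 x -> integral_op K f x = real_op r f x}.
Proof.
move=> [_ HK] mf fM; have fi := Citg_bdd mf fM; have [B bB] := rsv_bounded s0.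
have ri := real_op_measbdd bB fi.
pose g := f \+ real_op r f.
have g2 : L2 I11 g.
  apply: (@bounded_L2 _ g (M + B * \int[mu]_(y in I11) normc (f y))).
    by apply: CmeasD => //; exact: Cmeas_itg.
  by move=> x Ix; apply: le_trans (normcD _ _) (lerD (fM x Ix) (real_op_bdd x bB fi)).
have [[N [mN N0 NP]] _] := HK g g2.
exists N; split => // x /= hx; apply: NP => /= E; apply: hx => Ix.
have gE : g \- integral_op (fun x y => (dirichlet_kernel s x y)%:C) g = f.
  exact (resolvent_right s0 fi).
have gx : g x - integral_op (fun x y => (dirichlet_kernel s x y)%:C) g x = f x.
  exact (f_equal (fun h : R -> R[i] => h x) gE).
by have := E Ix; rewrite /= gE gx /g /= => /addrI.
Qed.

(** The exceptional sets of the countably many test functions are gathered before the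
    row of the kernel is fixed. *)
Lemma resolvent_row_unique K : is_resolvent_kernel s K ->
  {ae mu, forall x : T, I11 x -> {ae mu, forall y : T, I11 y -> K x y = (r x y)%:C}}.
Proof.
move=> HK; have [B bB] := rsv_bounded s0.
pose f q (y : R) : R[i] := (\1_(ray q) y)%:C.
have mray q : measurable (ray q) by exact: measurable_itv.
have mf q : Cmeasurable I11 (f q).
  by split; [exact: measurable_indic|exact: measurable_cst].
have f1 q x : I11 x -> normc (f q x) <= 1.
  by move=> _; rewrite normc_R indicE; case: (_ \in _); rewrite ?normr1 ?normr0.
have m1 : Cmeasurable I11 (fun=> 1 : R[i]) by split; exact: measurable_cst.
have one2 : L2 I11 (fun=> 1 : R[i]).
  by apply: (@bounded_L2 _ _ 1) => // x _; rewrite normc_1.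
have [[_ /(_ _ one2)[int1 _]] _] := HK.
have U n : {ae mu, forall x : T, I11 x ->
    integral_op K (f (odflt 0 (unpickle n))) x = real_op r (f (odflt 0 (unpickle n))) x}.
  exact: resolvent_op_unique HK (mf _) (f1 _).
have [N [mN N0 NP]] := ae_foralln U.
have [N' [mN' N0' NP']] := int1.
exists (N `|` N'); split; first exact: measurableU.
  by apply/eqP; rewrite -measure_le0 (le_trans (measureU2 _ mN mN')) // [X in (X + _)%E]N0 [X in (_ + X)%E]N0' adde0.
move=> x /= hx; apply: contrapT => /not_orP[n1 n2]; apply: hx => Ix.
have H1 : Cintegrable I11 (fun y => K x y * 1).
  by apply: contrapT => h; apply: n2; apply: NP' => /= /(_ Ix).
have Ki : Cintegrable I11 (K x) by apply: (Citg_eq mI _ H1) => y _; rewrite mulr1.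
have H2 q : integral_op K (f q) x = real_op r (f q) x.
  apply: contrapT => h; apply: n1; apply: NP => /= /(_ (pickle q) Ix).
  by rewrite pickleK.
have r1 := real_op_citg x bB (Citg_bdd m1 (fun x _ => (le_refl (normc 1) : normc (1 : R[i]) <= normc 1))).
have Ri : Cintegrable I11 (fun y => (r x y)%:C) by apply: (Citg_eq mI _ r1) => y _; rewrite mulr1.
have KRi := CitgB mI Ki Ri.
have mK : Cmeasurable I11 (K x) := Cmeas_itg Ki.
have [|Z [mZ Z0 ZP]] := row_ae0 KRi.
  move=> q; have Kq : Cintegrable I11 (fun y => K x y * f q y).
    apply: (Citg_dom mI (CmeasM mK (mf q)) (Citg_normc mI Ki)) => y Iy.
    by rewrite normcM ler_piMr ?normc_ge0 // f1.
  have Rq := real_op_citg x bB (Citg_bdd (mf q) (f1 q)).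
  transitivity (integral_op K (f q) x - real_op r (f q) x).
    by rewrite /integral_op -(CintB mI Kq Rq); apply: Cint_eq => y _; rewrite mulrBl.
  by rewrite H2 subrr.
exists Z; split => // y /= hy; apply: ZP => /= h; apply: hy => Iy.
by have /eqP := h Iy; rewrite subr_eq0 => /eqP.
Qed.

Lemma resolvent_kernel_unique K : is_resolvent_kernel s K ->
  (fun p : T * T => K p.1 p.2) = (fun p => (r p.1 p.2)%:C)
    %[ae (mu \x mu)%E in I11 `*` I11].
Proof.
move=> HK; have [[[mK _] _] [N [mN N0 NP]]] := (HK, resolvent_row_unique HK).
pose D (p : T * T) := normc (K p.1 p.2 - (r p.1 p.2)%:C).
have mII : measurable (I11 `*` I11 : set (T * T)) by exact: measurableX.
have mD : measurable_fun (I11 `*` I11 : set (T * T)) D.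
  apply: Cmeas_normc; have [k1 k2] := mK; split.
    rewrite (_ : (fun p => _) = fun p : T * T => Re (K p.1 p.2) - r p.1 p.2).
      by apply: measurable_funB => //; apply: measurable_funS (rsv_meas s0).
    by apply: funext => p; rewrite ReD ReN.
  rewrite (_ : (fun p => _) = fun p : T * T => Im (K p.1 p.2)) //.
  by apply: funext => p; rewrite ImD ImN /= oppr0 addr0.
pose Z := (I11 `*` I11 : set (T * T)) `&` D @^-1` [set~ 0].
have mZ : measurable Z.
  by apply: mD => //; apply: measurableC; exact: measurable_set1.
exists Z; split => //.
  apply: (null_of_sections mZ).
  exists N; split => // x /= hx; apply: NP => /= rowx; apply: hx.
  have [Ix|nIx] := pselect (I11 x); last first.
    rewrite (_ : xsection Z x = set0); first exact: negligible_set0.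
    by apply/seteqP; split => // y; rewrite /xsection /= inE => -[[]].
  apply: negligibleS (rowx Ix) => y; rewrite /xsection /= inE => -[[_ /= Iy] h] /(_ Iy) E.
  by apply: h; rewrite /D /= E subrr normc_0.
move=> p /= hp; apply: contrapT => nZ; apply: hp => Ip; apply: contrapT => ne; apply: nZ.
split => //= D0; apply: ne; apply/eqP; rewrite -subr_eq0 -normc_eq0; exact/eqP.
Qed.

End KernelUniqueness.

(** * The theorem *)

Theorem mainTheorem9 (R : realType) (s : R) (hs : 0 < s) :
  exists Rs : R[i] -> R[i] -> R[i],
    [/\ entire2 Rs,
        is_resolvent_kernel s (fun x y : R => Rs x%:C y%:C),
        (forall K : R -> R -> R[i], is_resolvent_kernel s K ->
           (fun p : R * R => K p.1 p.2) = (fun p => Rs p.1%:C p.2%:C)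
             %[ae (lebesgue_measure \x lebesgue_measure)%E
               in itv11 `*` itv11]) &
        forall z w : R[i], Rs z w = evaluator s z^* w].
Proof.
exists (rsvC s); have E (x y : R) : rsvC s x%:C y%:C = (rsv s x y)%:C := rsvC_real hs x y.
split.
- exact: rsvC_entire2.
- rewrite (_ : (fun x y : R => _) = fun x y : R => (rsv s x y)%:C); first exact: rsv_is_resolvent.
  by apply: funext => x; apply: funext => y.
- move=> K HK; have [N [mN N0 NP]] := resolvent_kernel_unique hs HK.
  by exists N; split => // p /= hp; apply: NP => /= e; apply: hp => /e ->; rewrite E.
- by move=> z w; rewrite evaluatorE.
Qed.
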